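(* Let $n\ge 2$. The joint process $(\mathcal L(t),X(t))_{t\ge 0}$ of the centred local time profile and the position of the self-repellent random walk on $\mathbb Z_n$ is a second-order lift of the reversible diffusion $(Z(t))_{t\ge 0}$ on $\mathcal S$ solving the discrete stochastic heat equation $$\mathrm dZ(t)=\frac{1}{2n}\Delta_nZ(t)\,\mathrm dt+\frac{1}{\sqrt n}\,\mathrm dW(t),$$ where $W$ is a Brownian motion on $\mathcal S$. That is, there exists a core $C$ of $(\mathfrak L,\mathrm{Dom}(\mathfrak L))$ such that $f\circ\pi\in\mathrm{Dom}(\hat{\mathfrak L})$ for all $f\in C$ and, for all $f,g\in C$, $$\big\langle\hat{\mathfrak L}(f\circ\pi),g\circ\pi\big\rangle_{L^2(\hat\mu)}=0\qquad\text{and}\qquad \tfrac12\big\langle\hat{\mathfrak L}(f\circ\pi),\hat{\mathfrak L}(g\circ\pi)\big\rangle_{L^2(\hat\mu)}=-\langle f,\mathfrak Lg\rangle_{L^2(\mu)}.$$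
   Context: Setting. $\mathbb Z_n=\mathbb Z/n\mathbb Z$; all indices are periodic in $\mathbb Z_n$. $(a)_+=\max(a,0)$, $(a)_-=\max(-a,0)$. For $l\in\mathbb R^n$, $l_i'=l_{i+1}-l_i$. $\mathcal S=\{\ell\in\mathbb R^n:\sum_{i=1}^n\ell_i=0\}$, $\mathbf 1=(1,\dots,1)^\top$. For a function $f$ on $\mathcal S$, $\partial_{\ell_i}f$ denotes the directional derivative of $f$ in direction $e_i-n^{-1}\mathbf 1\in\mathcal S$. The discrete Laplacian is $(\Delta_nl)_i=l_{i+1}-2l_i+l_{i-1}$; it is a bijection $\mathcal S\to\mathcal S$. $\mu=\mathcal N(0,-\Delta_n^{-1})$ is the Gaussian probability measure on $\mathcal S$ with density proportional to $\exp(-U)$, $U(\ell)=\frac12\sum_{i=1}^n(\ell_{i+1}-\ell_i)^2$, with respect to Lebesgue (Haar) measure on $\mathcal S$. $\hat\mu=\mu\otimes\mathrm{Unif}(\mathbb Z_n)$. $\pi:\mathcal S\times\mathbb Z_n\to\mathcal S$ is $\pi(\ell,i)=\ell$. Self-repellent random walk. $X(t)$ is a continuous-time process on $\mathbb Z_n$ with local time $L_i(t)=\int_0^t1_{\{i\}}(X(s))\,\mathrm ds$, jumping $i\to i+1$ with rate $q^+(l,i)=(l_i')_-$ and $i\to i-1$ with rate $q^-(l,i)=(l_{i-1}')_+$, where $l$ is the current value of $L(t)$. Put $\mathcal L_i(t)=L_i(t)-\frac1n\sum_jL_j(t)=L_i(t)-t/n$. Then $(\mathcal L(t),X(t))$ is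 a piecewise deterministic Markov process on $\mathcal S\times\mathbb Z_n$ (considered for arbitrary initial states): while $X=i$, $\mathcal L$ moves with velocity $e_i-n^{-1}\mathbf 1$, and $X$ jumps with rates $q^\pm(\mathcal L,X)$. On $f\in C_b^1(\mathcal S\times\mathbb Z_n)$ its generator is $$\hat{\mathfrak L}f(\ell,i)=\partial_{\ell_i}f(\ell,i)+(\ell_i')_-\big(f(\ell,i+1)-f(\ell,i)\big)+(\ell_{i-1}')_+\big(f(\ell,i-1)-f(\ell,i)\big).$$ $\hat\mu$ is invariant, and the transition function induces a strongly continuous contraction semigroup on $L^2(\hat\mu)$, whose generator $(\hat{\mathfrak L},\mathrm{Dom}(\hat{\mathfrak L}))$ extends the operator above. Collapse. A Brownian motion on $\mathcal S$ is the orthogonal projection to $\mathcal S$ of a standard Brownian motion in $\mathbb R^n$. $(Z(t))$ is reversible with respect to $\mu$, and its $L^2(\mu)$ generator is $\mathfrak Lg(\ell)=\frac1{2n}\sum_{i=1}^n\big(\partial_{\ell_i}^2g(\ell)+(\Delta_n\ell)_i\,\partial_{\ell_i}g(\ell)\big)$ with $\mathrm{Dom}(\mathfrak L)=H^{2,2}(\mathcal S,\mu)$ (the Sobolev space of functions with weak derivatives up to order two in $L^2(\mu)$). *)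

(* Defs.v *)
From HB Require Import structures.
From mathcomp Require Import all_boot all_order all_algebra.
From mathcomp Require Import finmap.
From mathcomp Require Import all_classical all_reals all_analysis.
From mathcomp Require Import measurable_realfun.

Set Implicit Arguments.
Unset Strict Implicit.
Unset Printing Implicit Defensive.

Import Order.TTheory GRing.Theory Num.Theory.
Import numFieldNormedType.Exports.

Local Open Scope classical_set_scope.
Local Open Scope ring_scope.

(* R^n, with coordinates indexed by 'Z_n = 'I_(Zp_trunc n).+2; for n >= 2 the
   number (Zp_trunc n).+2 = #|'Z_n| is equal to n. *)
Notation profile R n := 'rV[R]_(Zp_trunc n).+2 (only parsing).

Section SumZero.
Variables (R : realType) (n : nat).

Definition sumzero_pred : {pred profile R n} :=
  [pred l : profile R n | \sum_i l 0 i == 0].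

Lemma sumzero_submod : submod_closed sumzero_pred.
Proof.
split=> [|a u v]; rewrite !inE.
  by rewrite big1// => i _; rewrite mxE.
move=> /eqP u0 /eqP v0.
under eq_bigr do rewrite !mxE.
by rewrite big_split/= -mulr_sumr u0 v0 mulr0 addr0.
Qed.

HB.instance Definition _ :=
  GRing.isSubmodClosed.Build R (profile R n) sumzero_pred sumzero_submod.

Record sumzero := SumZero { szval :> profile R n; _ : szval \in sumzero_pred }.

HB.instance Definition _ := [isSub for szval].
HB.instance Definition _ := [Choice of sumzero by <:].
HB.instance Definition _ := [SubChoice_isSubLmodule of sumzero by <:].

(* The sup norm inherited from R^n; only its topology and its Borel sets
   matter. *)
Let sznorm (l : sumzero) : R := `|val l|.

Let sznormD x y : sznorm (x + y) <= sznorm x + sznorm y.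
Proof. exact: ler_normD. Qed.

Let sznorm0 x : sznorm x = 0 -> x = 0.
Proof. by move=> /normr0_eq0 x0; apply: val_inj. Qed.

Let sznormMn x k : sznorm (x *+ k) = sznorm x *+ k.
Proof. by rewrite /sznorm raddfMn normrMn. Qed.

Let sznormN x : sznorm (- x) = sznorm x.
Proof. by rewrite /sznorm raddfN normrN. Qed.

HB.instance Definition _ := Num.Zmodule_isNormed.Build R sumzero
  sznormD sznorm0 sznormMn sznormN.
HB.instance Definition _ := PseudoMetric.copy sumzero (pseudoMetric_normed sumzero).
HB.instance Definition _ := isPointed.Build sumzero 0.
HB.instance Definition _ := NormedZmod_PseudoMetric_eq.Build R sumzero erefl.

Let sznormZ (a : R) (x : sumzero) : `|a *: x| = `|a| * `|x|.
Proof. exact: (normrZ a (val x)). Qed.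

HB.instance Definition _ :=
  PseudoMetricNormedZmod_Lmodule_isNormedModule.Build R sumzero sznormZ.

HB.instance Definition _ :=
  @isMeasurable.Build (sigma_display (@open sumzero)) sumzero <<s @open sumzero >>
    (@sigma_algebra0 _ setT (@open sumzero)) (@sigma_algebraC sumzero (@open sumzero))
    (@sigma_algebra_bigcup _ setT (@open sumzero)).

Lemma centre_subproof (l : profile R n) :
  l - const_mx ((#|'Z_n|%:R)^-1 * \sum_j l 0 j) \in sumzero_pred.
Proof.
rewrite inE; under eq_bigr do rewrite !mxE.
rewrite big_split/= sumrN sumr_const -[X in _ - X]mulr_natl mulrA divff ?mul1r ?subrr//.
by rewrite card_ord pnatr_eq0.
Qed.

(* l |-> l - (mean of l) 1, the orthogonal projection of R^n onto sumzero *)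
Definition centre (l : profile R n) : sumzero := SumZero (centre_subproof l).

(* e_i - n^-1 1 *)
Definition drift (i : 'Z_n) : sumzero := centre (delta_mx 0 i).

Definition diffR (l : sumzero) (i : 'Z_n) : R := val l 0 (i + 1) - val l 0 i.

Definition laplacian (l : sumzero) (i : 'Z_n) : R :=
  val l 0 (i + 1) - 2 * val l 0 i + val l 0 (i - 1).

Definition energy (l : sumzero) : R := 2^-1 * \sum_(i : 'Z_n) diffR l i ^+ 2.

End SumZero.

HB.instance Definition _ (m : nat) := isPointed.Build 'I_m.+1 ord0.
HB.instance Definition _ (m : nat) := @isMeasurable.Build default_measure_display
  'I_m.+1 discrete_measurable discrete_measurable0
  discrete_measurableC discrete_measurableU.


Section Gaussian.
Variables (R : realType) (n : nat).
Local Notation S := (sumzero R n).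

(* Lebesgue measure on sumzero, up to a positive factor: a nonzero
   translation-invariant Borel measure that is finite on compact sets. *)
Definition is_haar (lambda : {measure set S -> \bar R}) : Prop :=
  [/\ forall (v : S) (A : set S), measurable A ->
        lambda ((fun l => l + v) @^-1` A) = lambda A,
      forall K : set S, compact K -> (lambda K < +oo)%E
    & (0 < lambda setT)%E].

Variable lambda : {measure set S -> \bar R}.

Definition gibbs (A : set S) : \bar R :=
  (\int[lambda]_(l in A) (expR (- energy l))%:E)%E.

Lemma measurable_sumzero_coord (i : 'Z_n) :
  measurable_fun setT (fun l : S => val l 0 i).
Proof.
have cc : continuous (fun l : S => val l 0 i).
  move=> l; apply/(@cvgrPdist_le R R^o S (nbhs l)) => e e0; near=> l'.
  have -> : val l 0 i - val l' 0 i = val (l - l') 0 i by rewrite !mxE.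
  apply: (@le_trans _ _ `|l - l'|).
    rewrite [leRHS]/Num.norm/= [leRHS]mx_normrE.
    exact: (le_bigmax _ (fun ij => `|val (l - l') ij.1 ij.2|) (0, i)).
  by near: l'; apply: (@cvgr_dist_le R S S (nbhs l) _ id l (@cvg_id _ (nbhs l))).
move=> mD; apply: (measurability _ (RGenOpens.measurableE R)) => //.
move=> _ [_ [a [b ->] <-]]; rewrite setTI; apply: sub_sigma_algebra.
by move/continuousP: cc; apply; exact: interval_open.
Unshelve. all: by end_near. Qed.

Lemma measurable_energy : measurable_fun setT (@energy R n).
Proof.
apply: measurable_funM => //.
apply: measurable_sum => i; apply: measurable_funX.
by apply: measurable_funB; exact: measurable_sumzero_coord.
Qed.

Let gibbs0 : gibbs set0 = 0%E.
Proof. by rewrite /gibbs integral_set0. Qed.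

Let gibbs_ge0 A : (0 <= gibbs A)%E.
Proof. by apply: integral_ge0 => l _; rewrite lee_fin expR_ge0. Qed.

Let gibbs_sigma_additive : semi_sigma_additive gibbs.
Proof.
move=> F mF tF mUF; rewrite /gibbs; apply: cvg_toP.
  apply: ereal_nondecreasing_is_cvgn => p q pq.
  by apply: lee_sum_nneg_natr => // k _ _; exact: gibbs_ge0.
rewrite ge0_integral_bigcup//=.
apply: measurable_funTS; apply: measurableT_comp => //.
by apply: measurableT_comp => //; apply: measurableT_comp => //;
  exact: measurable_energy.
Qed.

HB.instance Definition _ :=
  isMeasure.Build _ _ _ gibbs gibbs0 gibbs_ge0 gibbs_sigma_additive.

(* mnormalize divides by the total mass, which is in ]0, +oo[ when is_haar
   lambda and 1 < n; its last argument is a junk value. *)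
Definition gaussian : probability S R := mnormalize gibbs (\d_(0 : S)).

Definition unif : probability 'Z_n R :=
  mnormalize (@counting 'Z_n R) (\d_(0 : 'Z_n)).

Definition gaussian_unif : {measure set (S * 'Z_n) -> \bar R} :=
  (gaussian \x unif)%E.

End Gaussian.

Section L2.
Variables (R : realType) (d : measure_display) (T : measurableType d).
Variable mu : {measure set T -> \bar R}.

Definition L2 : set (T -> R) := [set f | f \in Lfun mu 2%:E].

Definition inner (f g : T -> R) : R := \int[mu]_x (f x * g x).

Definition norm2 (f : T -> R) : \bar R := 'N[mu]_(2%:E)[EFin \o f].

(* C is a core of the operator A on L^2(mu) with domain D. *)
Definition is_core (D : set (T -> R)) (A : (T -> R) -> (T -> R))
    (C : set (T -> R)) : Prop :=
  [/\ C `<=` D,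
      C (cst 0),
      forall (a : R) f g, C f -> C g -> C (fun x => a * f x + g x)
    & forall f, D f -> forall e : R, 0 < e -> exists g, [/\ C g,
        (norm2 (f \- g)%R < e%:E)%E & (norm2 (A f \- A g)%R < e%:E)%E]].

(* Generator in L^2(mu) of a family of operators P t, t >= 0. *)
Variable P : R -> (T -> R) -> (T -> R).

Definition has_gen (f g : T -> R) : Prop :=
  L2 g /\ norm2 (fun x => t^-1 * (P t f x - f x) - g x) @[t --> 0^'+] --> 0%E.

Definition gen_dom : set (T -> R) := [set f | L2 f /\ exists g, has_gen f g].

Definition gen (f : T -> R) : T -> R := xget (cst 0) [set g | has_gen f g].

End L2.

Section Sobolev.
Variables (R : realType) (n : nat).
Local Notation S := (sumzero R n).
Variable lambda : {measure set S -> \bar R}.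
Local Notation mu := (gaussian lambda).

Fixpoint cont_diff (k : nat) (f : S -> R) : Prop :=
  continuous f /\
  if k is k'.+1 then forall v : S,
    (forall l, derivable f l v) /\ cont_diff k' (fun l => 'D_v f l)
  else True.

Definition test_function (f : S -> R) : Prop :=
  (forall k, cont_diff k f) /\ compact (closure [set l | f l != 0]).

(* g is the weak derivative of f in direction v *)
Definition weak_derivative (v : S) (f g : S -> R) : Prop :=
  forall phi, test_function phi ->
    \int[lambda]_l (f l * 'D_v phi l) = - \int[lambda]_l (g l * phi l).

Definition H22 : set (S -> R) := [set f | L2 mu f /\
  forall v, exists g, [/\ L2 mu g, weak_derivative v f g &
    forall w, exists h, L2 mu h /\ weak_derivative w g h]].

(* A representative of the weak derivative, unique almost everywhere. *)
Definition wD (v : S) (f : S -> R) : S -> R :=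
  xget (cst 0) [set g | L2 mu g /\ weak_derivative v f g].

(* Generator in L^2(mu), with domain H22, of the stationary diffusion
   dZ = (2n)^-1 (laplacian Z) dt + n^-1/2 dW, the derivatives being weak ones. *)
Definition genZ (g : S -> R) : S -> R := fun l =>
  (2 * n%:R)^-1 * \sum_(i : 'Z_n)
    (wD (drift R i) (wD (drift R i) g) l
     + laplacian l i * wD (drift R i) g l).

End Sobolev.

Section Clocks.
Variables (d : measure_display) (Om : measurableType d) (R : realType).
Variable P : probability Om R.

Definition mutually_independent (I : choiceType) (X : I -> {RV P >-> R}) :=
  forall (J : seq I) (A : I -> set R), uniq J -> (forall j, measurable (A j)) ->
    P [set w | forall j, j \in J -> A j (X j w)] =
    (\prod_(j <- J) fine (P (X j @^-1` A j)))%:E.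

Definition iid_exp1 (I : choiceType) (X : I -> {RV P >-> R}) :=
  mutually_independent X /\
  forall i A, measurable A -> distribution P (X i) A = exponential_prob 1 A.

End Clocks.

(* The self-repellent walk and its centred local time profile, as a function of
   the realisation e of a family of i.i.d. Exp(1) clocks: after its k-th jump the
   walk moves right when the integrated rate to the right reaches e (k, true),
   or left when the integrated rate to the left reaches e (k, false), whichever
   happens first; thus P(no jump right before s) = exp(- integrated rate). *)
Section Walk.
Variables (R : realType) (n : nat).
Local Notation S := (sumzero R n).

Definition rateR (l : S) (i : 'Z_n) : R := Num.max (- diffR l i) 0.
Definition rateL (l : S) (i : 'Z_n) : R := Num.max (diffR l (i - 1)) 0.

(* First time the rate q, integrated along the motion from (l, i) in the absence
   of jumps, reaches e. *)
Definition ringing (q : S -> 'Z_n -> R) (l : S) (i : 'Z_n) (e : R) : R :=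
  inf [set s | 0 <= s /\
    e <= \int[@lebesgue_measure R]_(r in `[0, s]) q (l + r *: drift R i) i].

Variables (e : nat * bool -> R) (x : S * 'Z_n).

(* (time of the k-th jump, state right after it) *)
Fixpoint jump (k : nat) : R * (S * 'Z_n) :=
  if k is k'.+1 then
    let: (t, (l, i)) := jump k' in
    let sR := ringing rateR l i (e (k', true)) in
    let sL := ringing rateL l i (e (k', false)) in
    let s := Num.min sR sL in
    (t + s, (l + s *: drift R i, if sR <= sL then i + 1 else i - 1))
  else (0, x).

(* The default x.2 only matters from the explosion time on, which is almost
   surely infinite. *)
Definition position (t : R) : 'Z_n :=
  xget x.2 [set i | exists k,
    [/\ (jump k).1 <= t, t < (jump k.+1).1 & i = (jump k).2.2]].

Definition local_time (t : R) : profile R n :=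
  \row_i \int[@lebesgue_measure R]_(s in `[0, t]) (position s == i)%:R.

Definition walk (t : R) : S * 'Z_n := (x.1 + centre (local_time t), position t).

End Walk.

(* The action on functions of the transition function of the walk; it depends on
   (P, E) only through the law of E. *)
Definition walk_semigroup (R : realType) (n : nat) (d : measure_display)
    (Om : measurableType d) (P : probability Om R)
    (E : nat * bool -> {RV P >-> R}) (t : R) (f : sumzero R n * 'Z_n -> R) :
    sumzero R n * 'Z_n -> R :=
  fun x => \int[P]_w f (walk (fun k => E k w) x t).

(* Main.v *)
(* The core is the space of smooth compactly supported functions f. From a state
   (l, i) the walk stays on the line l + t (e_i - 1/n) until its first jump, which
   occurs before a small time t with probability O(t) only, uniformly for l in a
   ball; Taylor's formula then bounds t^-1 (P_t (f o pi) - f o pi) - D_i f by K t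
   everywhere, where D_i is the derivative along e_i - 1/n. Hence the generator
   maps f o pi to (l, i) |-> D_i f(l). The first identity follows from
   sum_i D_i f = 0, as the drifts add up to zero, and the second one from the
   Gaussian integration by parts of D_i, applied to f D_i g.

   For the core property, cut off an element f of H^{2,2}, mollify it, and take a
   diagonal sequence. The only point where the unbounded drift matters is that
   (Delta l)_i D_i f must be square integrable: for a test function u, integration
   by parts bounds |(Delta l)_i u| in L^2(mu) by u and D_i u, and this passes to
   the weak derivatives by mollification. *)

Require Import Defs.
From HB Require Import structures.
From mathcomp Require Import all_boot all_order all_algebra.
From mathcomp Require Import all_classical all_reals all_analysis.
From mathcomp Require Import measurable_realfun ring lra.

Set Implicit Arguments.
Unset Strict Implicit.
Unset Printing Implicit Defensive.

Import Order.TTheory GRing.Theory Num.Theory.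
Import numFieldNormedType.Exports.

Local Open Scope classical_set_scope.
Local Open Scope ring_scope.

(** * Coordinates on the space of sum-zero profiles *)

(** Several objects are less regular than their names suggest, and this shapes the proof. The
    semigroup integrates over the clocks a function that is not shown to be measurable, neither in
    the clocks nor in the initial state. Every estimate on it is therefore a pointwise bound
    combined with monotonicity of nonnegative integrals, which holds for arbitrary functions. The
    generator [gen] and the weak derivatives [wD] are values picked by [xget]; a uniqueness
    statement identifies them almost everywhere before they enter an inner product. The reference
    measure is known only through its invariance, so no volume formula is at hand: a doubling
    estimate for balls yields the finite Gaussian mass and the positivity of balls. [cont_diff]
    treats each direction separately, so additivity in the direction has to be derived.
    Mollification lives in L^2(lambda) and the estimates in L^2(mu); the two norms are comparable
    only on a fixed ball, hence cutting off precedes mollifying, and the constant in the bound on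
    the drift term must not depend on the ball. *)

Section DirectionalDerivative.
Variables (R : realType) (V : normedModType R).
Implicit Types (f g : V -> R) (l v : V).

(** Restriction to a line turns directional derivatives into one-variable ones, so that the chain
    rule and the mean value theorem apply without differentiability in the full space. *)
Lemma is_derive_line f l v (d : R) :
  is_derive l v f d <-> is_derive (0 : R) (1 : R) (fun h : R => f (h *: v + l)) d.
Proof.
have e : (fun h : R => h^-1 *: ((f \o shift l) (h *: v) - f l)) =
   (fun h => h^-1 *: (((fun h : R => f (h *: v + l)) \o shift 0) (h *: 1) -
                       f (0 *: v + l))).
  by rewrite funeqE => h /=; rewrite addr0 scale0r add0r [_%:A]mulr1.
by split=> -[df dE]; split; [move: df|rewrite -dE|move: df|rewrite -dE];
  rewrite /derivable /derive ?e// -e.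
Qed.

Lemma is_derive_comp (psi : R -> R) f l v (dpsi df : R) :
  is_derive (f l) (1 : R) psi dpsi -> is_derive l v f df ->
  is_derive l v (psi \o f) (dpsi * df).
Proof.
move=> hpsi /is_derive_line hf; apply/is_derive_line.
set g := fun h : R => f (h *: v + l).
have g0 : g 0 = f l by rewrite /g scale0r add0r.
have dg : derivable g 0 1 by apply: ex_derive.
have dp : derivable psi (g 0) 1 by rewrite g0; apply: ex_derive.
split.
  apply/derivable1_diffP.
  by apply: (@differentiable_comp _ _ _ _ g psi); exact/derivable1_diffP.
have := derive1_comp dg dp; rewrite !derive1E g0.
rewrite (@derive_val _ _ _ _ _ psi _ hpsi) (@derive_val _ _ _ _ _ g _ hf).
exact.
Qed.

End DirectionalDerivative.

Section DirectionalMVT.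
Variables (R : realType) (V : normedModType R).
Implicit Types (f g : V -> R) (l v : V).

Lemma is_derive_shift_line f l v (s : R) : derivable f (s *: v + l) v ->
  is_derive s (1 : R) (fun h : R => f (h *: v + l)) ('D_v f (s *: v + l)).
Proof.
move=> df; have /is_derive_line h := derivableP df.
have -> : (fun h : R => f (h *: v + l)) =
          (fun h : R => f (h *: v + (s *: v + l))) \o (fun h => h - s).
  by apply/funext => u /=; rewrite addrA -scalerDl subrK.
rewrite -[X in is_derive _ _ _ X]mulr1.
apply: (@is_derive_comp R R^o); rewrite ?subrr//.
by apply: is_derive_eq; rewrite subr0.
Qed.

Lemma line_MVT f l v (a b : R) : a <= b ->
  (forall x, derivable f x v) ->
  exists2 c, c \in `[a, b] &
    f (b *: v + l) - f (a *: v + l) = 'D_v f (c *: v + l) * (b - a).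
Proof.
move=> ab df.
apply: (@MVT_segment R (fun h => f (h *: v + l)) (fun h => 'D_v f (h *: v + l)) a b ab).
  by move=> x _; exact: is_derive_shift_line.
apply: derivable_within_continuous => x _.
by case: (is_derive_shift_line (df (x *: v + l))).
Qed.

(** Covers both signs of [h]; of the intermediate point only its size is kept, which is what the
    Taylor bounds use. *)
Lemma line_MVT0 f l v (h : R) : (forall x, derivable f x v) ->
  exists2 c : R, `|c| <= `|h| & f (l + h *: v) - f l = h * 'D_v f (l + c *: v).
Proof.
move=> df; have [h0|h0] := leP 0 h.
  have [c ci] := line_MVT l h0 df.
  rewrite scale0r add0r subr0 (addrC _ l) => ->; exists c.
    by move: ci; rewrite in_itv/= => /andP[c0 ch]; rewrite !ger0_norm.
  by rewrite mulrC addrC.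
have [c ci] := line_MVT l (ltW h0) df.
rewrite scale0r add0r sub0r => e; exists c.
  by move: ci; rewrite in_itv/= => /andP[c0 ch]; rewrite !ler0_norm ?lerN2// ltW.
by apply: oppr_inj; rewrite opprB (addrC l) e mulrN mulrC (addrC l).
Qed.

End DirectionalMVT.

Section Geometry.
Variables (R : realType) (n : nat).
Local Notation S := (sumzero R n).
Local Notation N := (Zp_trunc n).+2.
Implicit Types (l v : S) (i : 'Z_n).

Lemma sznormE l : `|l| = `|val l|. Proof. by []. Qed.

Lemma coord_le_norm l i : `|val l 0 i| <= `|l|.
Proof.
rewrite sznormE [leRHS]/Num.norm/= [leRHS]mx_normrE.
exact: (le_bigmax _ (fun ij => `|val l ij.1 ij.2|) (0, i)).
Qed.

Lemma rv_norm_le (l : profile R n) (c : R) :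
  0 <= c -> (forall i, `|l 0 i| <= c) -> `|l| <= c.
Proof.
move=> c0 h; rewrite [leLHS]/Num.norm/= [leLHS]mx_normrE.
apply: bigmax_le => //= -[j i] _ /=; rewrite (ord1 j); exact: h.
Qed.

Lemma norm_le_coord l (c : R) :
  0 <= c -> (forall i, `|val l 0 i| <= c) -> `|l| <= c.
Proof. exact: rv_norm_le. Qed.

Lemma szcoordD (u v : S) i : val (u + v) 0 i = val u 0 i + val v 0 i.
Proof. by rewrite raddfD mxE. Qed.

Lemma szcoordN (v : S) i : val (- v) 0 i = - val v 0 i.
Proof. by rewrite raddfN mxE. Qed.

Lemma szcoordB (u v : S) i : val (u - v) 0 i = val u 0 i - val v 0 i.
Proof. by rewrite szcoordD szcoordN. Qed.

Lemma szcoordZ (a : R) (v : S) i : val (a *: v) 0 i = a * val v 0 i.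
Proof. by rewrite !mxE. Qed.

Lemma sz_sum0 l : \sum_i val l 0 i = 0.
Proof. by case: l => l /= h; apply/eqP; rewrite inE in h. Qed.

Lemma szcoord_sum (I : Type) (r : seq I) (P : pred I) (F : I -> S) i :
  val (\sum_(j <- r | P j) F j) 0 i = \sum_(j <- r | P j) val (F j) 0 i.
Proof. by rewrite raddf_sum summxE. Qed.

Lemma szP (u v : S) : (forall i, val u 0 i = val v 0 i) -> u = v.
Proof. by move=> h; apply: val_inj; apply/rowP. Qed.

Lemma centre_coord (l : profile R n) i :
  val (centre l) 0 i = l 0 i - N%:R^-1 * \sum_j l 0 j.
Proof. by rewrite !mxE card_ord. Qed.

Lemma centre_norm (l : profile R n) : `|centre l| <= 2 * `|l|.
Proof.
have hc i : `|l 0 i| <= `|l|.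
  rewrite [leRHS]/Num.norm/= [leRHS]mx_normrE.
  exact: (le_bigmax _ (fun ij => `|l ij.1 ij.2|) (0, i)).
apply: norm_le_coord => [|i]; first by rewrite mulr_ge0.
rewrite centre_coord mulr_natl mulr2n (le_trans (ler_normB _ _))// lerD//.
rewrite normrM ger0_norm ?invr_ge0// ler_pdivrMl ?ltr0n//.
apply: le_trans (ler_norm_sum _ _ _) _.
apply: (@le_trans _ _ (\sum_(i < N) `|l|)); first exact: ler_sum.
by rewrite sumr_const card_ord mulr_natl.
Qed.

Lemma centreZ (a : R) (l : profile R n) : centre (a *: l) = a *: centre l.
Proof.
apply: szP => i; rewrite szcoordZ !centre_coord mxE mulrBr; congr (_ - _).
rewrite [in RHS]mulrCA; congr (_ * _); rewrite mulr_sumr.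
by apply: eq_bigr => j _; rewrite mxE.
Qed.

Lemma drift_coord i j : val (drift R i) 0 j = (j == i)%:R - N%:R^-1.
Proof.
rewrite centre_coord mxE eqxx/=; congr (_ - _).
rewrite (bigD1 i)//= mxE !eqxx big1 ?addr0 ?mulr1// => k ki.
by rewrite mxE (negPf ki) andbF.
Qed.

Lemma drift_norm i : `|drift R i| <= 2.
Proof.
apply: le_trans (centre_norm _) _; apply: ler_piMr => //.
apply: rv_norm_le => // j; by rewrite mxE; case: (_ && _); rewrite ?normr1 ?normr0.
Qed.

Lemma drift_sum0 : \sum_i drift R i = 0 :> S.
Proof.
apply: szP => j; rewrite szcoord_sum.
under eq_bigr do rewrite drift_coord.
rewrite big_split/= sumr_const card_ord mulNrn -[_ *+ _]mulr_natl divff ?pnatr_eq0//.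
rewrite (bigD1 j)//= eqxx big1 ?addr0 ?subrr ?mxE// => k /negPf.
by rewrite eq_sym => ->.
Qed.

(** The constant parts of the drifts are weighted by the sum of the coordinates, which is zero. The
    drifts thus span the space and serve in place of a basis, although they are linearly
    dependent. *)
Lemma sz_drift_decomp l : l = \sum_i val l 0 i *: drift R i.
Proof.
apply: szP => j; rewrite szcoord_sum.
under eq_bigr do rewrite szcoordZ drift_coord mulrBr.
rewrite big_split/= sumrN -mulr_suml sz_sum0 mul0r subr0.
rewrite (bigD1 j)//= eqxx mulr1 big1 ?addr0// => k /negPf.
by rewrite eq_sym => ->; rewrite mulr0.
Qed.

Lemma sz_drift_sum l : \sum_i val l 0 i *: drift R i = l.
Proof. by rewrite -sz_drift_decomp. Qed.

Lemma coord_continuous i : continuous (fun l : S => val l 0 i).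
Proof.
move=> l; apply/(@cvgrPdist_le R R^o S (nbhs l)) => e e0; near=> l'.
rewrite -szcoordB; apply: le_trans (coord_le_norm _ _) _.
by near: l'; apply: (@cvgr_dist_le R S S (nbhs l) _ id l (@cvg_id _ (nbhs l))).
Unshelve. all: by end_near. Qed.

Lemma lipschitz_continuous (f : S -> R) (M : R) :
  (forall x y, `|f x - f y| <= M * `|x - y|) -> continuous f.
Proof.
move=> h l; apply/(@cvgrPdist_le R R^o S (nbhs l)) => e e0; near=> l'.
apply: le_trans (h _ _) _.
have M1 : 0 < `|M| + 1 by rewrite ltr_wpDl.
rewrite (@le_trans _ _ ((`|M| + 1) * `|l - l'|))//.
  by rewrite ler_wpM2r// (le_trans (ler_norm _))// lerDl.
rewrite -ler_pdivlMl//; near: l'.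
apply: (@cvgr_dist_le R S S (nbhs l) _ id l (@cvg_id _ (nbhs l))).
by rewrite mulr_gt0// invr_gt0.
Unshelve. all: by end_near. Qed.

(** Transferred from R^n: the ball is a closed subset of the image of the ball of R^n under
    [centre], a continuous map that fixes sum-zero profiles. *)
Lemma closed_ball_compact (r : R) : compact [set l : S | `|l| <= r].
Proof.
have vc : continuous (val : S -> profile R n).
  move=> l; apply/(@cvgrPdist_le R (profile R n) S (nbhs l)) => e e0; near=> l'.
  rewrite -raddfB -sznormE.
  by near: l'; apply: (@cvgr_dist_le R S S (nbhs l) _ id l (@cvg_id _ (nbhs l))).
pose B : set (profile R n) := [set x | `|x| <= r].
have cB : compact B.
  apply: bounded_closed_compact.
    exists r; split; first exact: num_real.
    by move=> M rM x /= xr; rewrite (le_trans xr)// ltW.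
  rewrite (_ : B = Num.norm @^-1` [set x | x <= r])//.
  apply: closed_comp; last exact: closed_le.
  by move=> x _; exact: norm_continuous.
have cc : continuous (@centre R n).
  move=> l; apply/(@cvgrPdist_le R S (profile R n) (nbhs l)) => e e0; near=> l'.
  have -> : centre l - centre l' = centre (l - l').
    apply: szP => i; rewrite szcoordB !centre_coord !mxE.
    under [in RHS]eq_bigr do rewrite !mxE.
    by rewrite big_split/= sumrN mulrBr; ring.
  rewrite (le_trans (centre_norm _))// -ler_pdivlMl//; near: l'.
  apply: (@cvgr_dist_le R (profile R n) (profile R n) (nbhs l) _ id l (@cvg_id _ (nbhs l))).
  by rewrite mulr_gt0// invr_gt0.
have centreK l : centre (val l) = l.
  by apply: szP => i; rewrite centre_coord sz_sum0 mulr0 subr0.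
have cC : closed [set l : S | `|l| <= r].
  rewrite (_ : [set l : S | _] = Num.norm @^-1` [set x : R | x <= r])//.
  apply: closed_comp; last exact: closed_le.
  by move=> x _; exact: norm_continuous.
apply: (@subclosed_compact _ _ (@centre R n @` B)) => //.
  apply: continuous_compact => //; exact: continuous_subspaceT.
by move=> l /= lr; exists (val l).
Unshelve. all: by end_near. Qed.

End Geometry.

(** * Smooth functions *)

Section Continuity.
Variables (R : realType) (T : topologicalType) (V : normedModType R).

Lemma continuous_add (f g : T -> R) :
  continuous f -> continuous g -> continuous (fun x => f x + g x).
Proof. by move=> cf cg x; apply: cvgD; [exact: cf|exact: cg]. Qed.

Lemma continuous_mul (f g : T -> R) :
  continuous f -> continuous g -> continuous (fun x => f x * g x).
Proof. by move=> cf cg x; apply: cvgM; [exact: cf|exact: cg]. Qed.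

Lemma continuous_affine_comp (f : V -> R) (a : R) (b : V) :
  continuous f -> continuous (fun x => f (a *: x + b)).
Proof.
move=> cf x; apply: (@cvg_comp _ _ _ (fun l : V => a *: l + b) f); last exact: cf.
by apply: cvgD; [apply: cvgZr; exact: cvg_id|exact: cvg_cst].
Qed.

Lemma continuous_translation (b : V) : continuous (fun x : V => x + b).
Proof. by move=> x; apply: cvgD; [exact: cvg_id|exact: cvg_cst]. Qed.

End Continuity.

Section ContDiff.
Variables (R : realType) (n : nat).
Local Notation S := (sumzero R n).
Implicit Types (f g : S -> R) (l v : S).

Definition smooth f := forall k, cont_diff k f.

Lemma cont_diff_le k f : cont_diff k.+1 f -> cont_diff k f.
Proof.
elim: k f => [f [cf _]//|k IH f [cf h]]; split => // v.
by have [df cd] := h v; split => //; exact: IH.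
Qed.

Lemma smooth_continuous f : smooth f -> continuous f.
Proof. by move=> /(_ 0) []. Qed.

Lemma smooth_derivable f l v : smooth f -> derivable f l v.
Proof. by move=> /(_ 1) [_ /(_ v) []]. Qed.

Lemma smoothD f v : smooth f -> smooth (fun l => 'D_v f l).
Proof. by move=> sf k; have [_ /(_ v) []] := sf k.+1. Qed.

(** Coinduction for smoothness: exhibiting a family stable under directional derivatives replaces
    the computation of iterated derivatives. It serves for explicit expressions and for
    convolutions. *)
Lemma smooth_coind (A : set (S -> R)) :
  (forall f, A f -> continuous f /\
     forall v, exists2 g, A g & forall l, is_derive l v f (g l)) ->
  forall f, A f -> smooth f.
Proof.
move=> hA f Af k; elim: k f Af => [f /hA[]//|k IH f /hA[cf h]]; split => // v.
have [g Ag dg] := h v; split => [l|]; first by case: (dg l).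
suff -> : (fun l => 'D_v f l) = g by exact: IH.
by apply/funext => l; case: (dg l).
Qed.

Lemma cont_diff_cst k (c : R) : cont_diff k (fun _ : S => c).
Proof.
elim: k c => [c|k IH c]; first by split => //; exact: cst_continuous.
split => [|v]; first exact: cst_continuous.
split => [l|]; first exact: derivable_cst.
rewrite (_ : (fun l : S => 'D_v _ l) = (fun _ => 0)); first exact: IH.
by apply/funext => l; rewrite derive_cst.
Qed.

Lemma cont_diffD k f g :
  cont_diff k f -> cont_diff k g -> cont_diff k (fun l => f l + g l).
Proof.
elim: k f g => [|k IH] f g [cf hf] [cg hg].
  by split => //; exact: continuous_add.
split => [|v]; first exact: continuous_add.
have [df ddf] := hf v; have [dg ddg] := hg v; split => [l|].
  exact: derivableD.
rewrite (_ : (fun l : S => 'D_v _ l) = (fun l => 'D_v f l + 'D_v g l)); first exact: IH.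
by apply/funext => l; rewrite [LHS]deriveD.
Qed.

Lemma cont_diffM k f g :
  cont_diff k f -> cont_diff k g -> cont_diff k (fun l => f l * g l).
Proof.
elim: k f g => [|k IH] f g cdf cdg; have [cf hf] := cdf; have [cg hg] := cdg.
  by split => //; exact: continuous_mul.
split => [|v]; first exact: continuous_mul.
have [df ddf] := hf v; have [dg ddg] := hg v; split => [l|].
  exact: derivableM.
rewrite (_ : (fun l : S => 'D_v _ l) = (fun l => f l * 'D_v g l + g l * 'D_v f l)).
  by apply: cont_diffD; apply: IH => //; exact: cont_diff_le.
by apply/funext => l; rewrite [LHS]deriveM.
Qed.

Lemma is_derive_affine f (a : R) (b l v : S) : derivable f (a *: l + b) v ->
  is_derive l v (fun l => f (a *: l + b)) (a * 'D_v f (a *: l + b)).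
Proof.
move=> df; apply/is_derive_line.
rewrite (_ : (fun h : R => _) = (fun h => f (h *: v + (a *: l + b))) \o ( *%R a)).
  rewrite mulrC; apply: (@is_derive_comp R R^o).
    by rewrite mulr0; apply: (iffLR (is_derive_line _ _ _ _)); exact: derivableP.
  have -> : *%R a = (fun h : R => a * h) by [].
  by apply: is_derive_eq; rewrite ?scaler0 ?addr0 [LHS]mulr1.
by apply/funext => h /=; rewrite scalerDr scalerA addrA.
Qed.

Lemma cont_diff_affine k f (a : R) (b : S) :
  cont_diff k f -> cont_diff k (fun l => f (a *: l + b)).
Proof.
elim: k f => [|k IH] f [cf hf]; first by split => //; exact: continuous_affine_comp.
split => [|v]; first exact: continuous_affine_comp.
have [df ddf] := hf v; split => [l|].
  by case: (is_derive_affine (df (a *: l + b))).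
rewrite (_ : (fun l : S => 'D_v _ l) = (fun l => (fun _ => a) l * 'D_v f (a *: l + b))).
  by apply: cont_diffM; [exact: cont_diff_cst|exact: (IH _ ddf)].
by apply/funext => l; case: (is_derive_affine (df (a *: l + b))).
Qed.

Lemma coord_is_derive (i : 'Z_n) l v :
  is_derive l v (fun l : S => val l 0 i) (val v 0 i).
Proof.
apply/is_derive_line.
rewrite (_ : (fun h : R => _) = (fun h => h * val v 0 i + val l 0 i)); last first.
  by apply/funext => h; rewrite szcoordD szcoordZ.
by apply: is_derive_eq; rewrite /GRing.scale/=; ring.
Qed.

Lemma smooth_cst (c : R) : smooth (fun _ : S => c).
Proof. by move=> k; exact: cont_diff_cst. Qed.

Lemma smooth_add f g : smooth f -> smooth g -> smooth (fun l => f l + g l).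
Proof. by move=> sf sg k; exact: cont_diffD. Qed.

Lemma smooth_mul f g : smooth f -> smooth g -> smooth (fun l => f l * g l).
Proof. by move=> sf sg k; exact: cont_diffM. Qed.

Lemma smooth_scale (c : R) f : smooth f -> smooth (fun l => c * f l).
Proof. by move=> sf; apply: smooth_mul => //; exact: smooth_cst. Qed.

Lemma smooth_affine f (a : R) (b : S) : smooth f -> smooth (fun l => f (a *: l + b)).
Proof. by move=> sf k; exact: cont_diff_affine. Qed.

End ContDiff.

(** * A flat function on the line *)

Section FlatExponential.
Variable R : realType.

(* [flat_exp k] is [s^-k exp(-1/s)] extended by 0; its derivative is a combination
   of [flat_exp k.+1] and [flat_exp k.+2]. *)
Definition flat_exp (k : nat) (s : R) : R :=
  if 0 < s then s^-1 ^+ k * expR (- s^-1) else 0.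

Lemma flat_exp_ge0 k s : 0 <= flat_exp k s.
Proof.
rewrite /flat_exp; case: ifP => // s0.
by rewrite mulr_ge0 ?expR_ge0// exprn_ge0// invr_ge0 ltW.
Qed.

(** Apply [expR u >= u^(k+2) / (k+2)!] at [u = s^-1]. The two spare powers of [s] make the
    derivative at the origin vanish. *)
Lemma flat_exp_le k s : 0 <= s -> flat_exp k s <= (k.+2)`!%:R * s ^+ 2.
Proof.
move=> s0; rewrite /flat_exp; case: ifP => [{}s0|_]; last first.
  by rewrite mulr_ge0// sqr_ge0.
have u0 : 0 < s^-1 by rewrite invr_gt0.
have := @expR_ge1Dxn R s^-1 k.+1 (ltW u0); set e := expR s^-1 => h.
have e0 : 0 < e by exact: expR_gt0.
rewrite expRN -/e ler_pdivrMr//.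
have F0 : 0 < (k.+2)`!%:R :> R by rewrite ltr0n fact_gt0.
have : s^-1 ^+ k.+2 <= (k.+2)`!%:R * e.
  rewrite mulrC -ler_pdivrMr//; apply: le_trans h; by rewrite lerDr.
move=> h2; rewrite mulrAC -ler_pdivrMr ?exprn_gt0//.
by rewrite -exprVn -exprD addn2.
Qed.

Lemma quadratic_is_derive0 (g : R -> R) (C : R) :
  (forall h, `|g h| <= C * h ^+ 2) -> is_derive (0 : R) (1 : R) g 0.
Proof.
move=> hg; have g0 : g 0 = 0.
  by apply/eqP; rewrite -normr_le0 (le_trans (hg _))// expr2 !mulr0.
have cv : h^-1 *: ((g \o shift 0) (h *: 1) - g 0) @[h --> (0 : R)^'] --> (0 : R).
  apply/cvgr0Pnorm_le => e e0; near=> h.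
  have h0 : h != 0 by near: h; exact: nbhs_dnbhs_neq.
  rewrite /= addr0 g0 subr0 [_%:A]mulr1 [_ *: _]/GRing.scale/= normrM normfV.
  rewrite ler_pdivrMl ?normr_gt0//; apply: le_trans (hg _) _.
  rewrite -(real_normK (num_real h)) expr2 mulrA mulrC ler_pM2l ?normr_gt0//.
  have C0 : 0 < `|C| + 1 by rewrite ltr_wpDl.
  apply: (@le_trans _ _ ((`|C| + 1) * `|h|)).
    by rewrite ler_wpM2r// (le_trans (ler_norm _))// lerDl.
  rewrite -ler_pdivlMl//; near: h.
  by apply: dnbhs0_le; rewrite mulr_gt0// invr_gt0.
by split; [exact: cvgP cv|exact: cvg_lim cv].
Unshelve. all: by end_near. Qed.

Lemma flat_exp_is_derive k s :
  is_derive s (1 : R) (flat_exp k)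
    (- k%:R * flat_exp k.+1 s + flat_exp k.+2 s).
Proof.
have [s0|s0|s0] := ltgtP s 0.
- rewrite /flat_exp ltNge (ltW s0)/= mulr0 addr0.
  have d0 := @is_derive_cst R R^o R^o 0 s 1.
  apply: (near_eq_is_derive _ d0).
  near=> x; rewrite ifF//; apply/negbTE; rewrite -leNgt; apply/ltW.
  by near: x; exact: lt_nbhsl.
- have -> : - k%:R * flat_exp k.+1 s + flat_exp k.+2 s =
     k%:R * s^-1 ^+ k.-1 * (- s ^- 2) * expR (- s^-1)
     + s^-1 ^+ k * (expR (- s^-1) * (s ^- 2)).
    rewrite /flat_exp s0; case: k => [|k] /=.
      by rewrite !exprS expr0; field; rewrite gt_eqF.
    by rewrite !exprS; field; rewrite gt_eqF.
  apply: (@near_eq_is_derive _ R^o R^o (fun s => s^-1 ^+ k * expR (- s^-1))).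
    near=> x; rewrite /flat_exp ifT//.
    by near: x; exact: lt_nbhsr.
  (* Regrouped as the derivative of [u ^+ k * expR (- u)] at [u = s^-1] times that of the
     inverse. *)
  have -> : k%:R * s^-1 ^+ k.-1 * - s ^- 2 * expR (- s^-1) +
      s^-1 ^+ k * (expR (- s^-1) * s ^- 2) =
      (k%:R * s^-1 ^+ k.-1 * expR (- s^-1) + s^-1 ^+ k * - expR (- s^-1)) * - s ^- 2.
    by ring.
  apply: (@is_derive_comp R R^o (fun u => u ^+ k * expR (- u)) (fun x => x^-1)).
    have de : is_derive s^-1 (1 : R) (fun u : R => expR (- u)) (- expR (- s^-1)).
      rewrite -mulrN1; apply: (@is_derive_comp R R^o expR (fun u => - u)).
    have dX := @is_deriveX R R^o id k s^-1 1 1 (@is_derive_id _ _ _ _).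
    rewrite exprfctE in dX; have dM := @is_deriveM R R^o _ _ _ _ _ _ dX de.
    apply: (is_derive_eq dM); rewrite /GRing.scale/=; ring.
  have sn0 : s != 0 by rewrite gt_eqF.
  have d1 := @derivableV R R^o (fun x => x) s 1 sn0 (@derivable_id _ _ _ _).
  split; first exact: d1.
  by rewrite [LHS](@deriveV R R^o (fun x => x) s 1 sn0 (@derivable_id _ _ _ _)) derive_id [LHS]mulr1.
- subst s.
  rewrite {2 3}/flat_exp ltxx mulr0 addr0.
  apply: (@quadratic_is_derive0 _ (k.+2)`!%:R) => h.
  rewrite ger0_norm ?flat_exp_ge0//.
  have [h0|h0] := leP 0 h; first exact: flat_exp_le.
  by rewrite /flat_exp ltNge (ltW h0)/= mulr_ge0// sqr_ge0.
Unshelve. all: by end_near. Qed.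

End FlatExponential.

(** * Test functions and their uniform Taylor bounds *)

Section TestFunctions.
Variables (R : realType) (n : nat).
Local Notation S := (sumzero R n).
Implicit Types (f g : S -> R) (l v w : S).

Definition bounded_support f := exists2 r : R, 0 < r & forall l, r < `|l| -> f l = 0.

(** Since closed balls are compact, compact support means vanishing outside some ball, a form that
    passes easily to sums, products, affine changes of variable and convolutions. *)
Lemma test_functionP f : test_function f <-> smooth f /\ bounded_support f.
Proof.
split=> -[sf]; last first.
  move=> [r r0 fr]; split => //.
  apply: (@subclosed_compact _ _ [set l : S | `|l| <= r]).
  - exact: closed_closure.
  - exact: closed_ball_compact.
  rewrite closureE => x; apply; split.
    rewrite (_ : [set l : S | _] = Num.norm @^-1` [set x : R | x <= r])//.
    apply: closed_comp; last exact: closed_le.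
    by move=> y _; exact: norm_continuous.
  by move=> l /= /eqP fl; rewrite leNgt; apply/negP => /fr.
move=> cf; split => //.
have [M [Mr hM]] := compact_bounded cf.
exists (`|M| + 1); first by rewrite ltr_wpDl.
move=> l lM; apply/eqP/negP => /negP fl.
have M1 : M < `|M| + 1 by rewrite (le_lt_trans (ler_norm _)) ?ltrDl.
have lc : closure [set l | f l != 0] l by apply: subset_closure.
by have := hM _ M1 l lc; rewrite /= leNgt lM.
Qed.

Lemma test_smooth f : test_function f -> smooth f.
Proof. by case. Qed.

Lemma test_derivable f l v : test_function f -> derivable f l v.
Proof. by move=> [sf _]; exact: smooth_derivable. Qed.

Lemma bounded_support_common f g : bounded_support f -> bounded_support g ->
  exists r : R, [/\ 0 < r, forall l, r < `|l| -> f l = 0 & forall l, r < `|l| -> g l = 0].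
Proof.
move=> [r r0 fr] [s s0 gs]; exists (Num.max r s); split; first by rewrite lt_max r0.
  by move=> l; rewrite gt_max => /andP[/fr].
by move=> l; rewrite gt_max => /andP[_ /gs].
Qed.

Lemma test_add f g : test_function f -> test_function g ->
  test_function (fun l => f l + g l).
Proof.
move=> /test_functionP[sf bf] /test_functionP[sg bg]; apply/test_functionP.
split; first exact: smooth_add.
have [r [r0 fr gr]] := bounded_support_common bf bg.
by exists r => // l lr; rewrite fr// gr// addr0.
Qed.

Lemma test_mul f g : smooth f -> test_function g ->
  test_function (fun l => f l * g l).
Proof.
move=> sf /test_functionP[sg [r r0 gr]]; apply/test_functionP.
split; first exact: smooth_mul.
by exists r => // l lr; rewrite gr// mulr0.
Qed.

Lemma test_scale (c : R) f : test_function f -> test_function (fun l => c * f l).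
Proof. by move=> tf; apply: test_mul => //; exact: smooth_cst. Qed.

Lemma test_cst0 : test_function (fun _ : S => 0).
Proof. by apply/test_functionP; split; [exact: smooth_cst|exists 1]. Qed.

Lemma test_affine f (a : R) (b : S) : a != 0 -> test_function f ->
  test_function (fun l => f (a *: l + b)).
Proof.
move=> a0 /test_functionP[sf [r r0 fr]]; apply/test_functionP.
split; first exact: smooth_affine.
have na : 0 < `|a| by rewrite normr_gt0.
exists ((r + `|b|) / `|a|); first by rewrite divr_gt0// ltr_pwDl.
move=> l; rewrite ltr_pdivrMr// mulrC -normrZ => h; apply: fr.
by rewrite -(ltrD2r `|b|) (lt_le_trans h)// -[X in `|X| <= _](addrK b) ler_normB.
Qed.

Lemma test_translation f (b : S) : test_function f -> test_function (fun l => f (l + b)).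
Proof.
move=> tf; have -> : (fun l => f (l + b)) = (fun l => f (1 *: l + b)).
  by apply/funext => l; rewrite scale1r.
exact: test_affine (oner_neq0 _) tf.
Qed.

Lemma derive_vanish f (r : R) l v :
  (forall l, r < `|l| -> f l = 0) -> r < `|l| -> 'D_v f l = 0.
Proof.
move=> fr rl; rewrite (@near_eq_derive _ _ _ f (cst 0))// ?derive_cst//.
near=> x; apply: fr; near: x.
apply: (@cvgr_norm_gt _ S _ (nbhs l) _ id l) => //.
Unshelve. all: by end_near. Qed.

Lemma test_derive f v : test_function f -> test_function (fun l => 'D_v f l).
Proof.
move=> /test_functionP[sf [r r0 fr]]; apply/test_functionP.
split; first exact: smoothD.
by exists r => // l lr; rewrite (derive_vanish _ fr).
Qed.

Lemma test_bounded f : test_function f -> exists2 M : R, 0 < M & forall l, `|f l| <= M.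
Proof.
move=> /test_functionP[sf [r r0 fr]].
have cB := @closed_ball_compact R n r.
have cfB : compact (f @` [set l : S | `|l| <= r]).
  apply: continuous_compact => //; apply: continuous_subspaceT.
  exact: smooth_continuous.
have [M [Mr hM]] := compact_bounded cfB.
exists (`|M| + 1) => [|l]; first by rewrite ltr_wpDl.
have [lr|/fr ->] := leP `|l| r; last by rewrite normr0 addr_ge0.
by apply: (hM (`|M| + 1)); [rewrite (le_lt_trans (ler_norm _)) ?ltrDl|exists l].
Qed.

Lemma test_taylor1 f v : test_function f ->
  exists2 M : R, 0 < M & forall l h, `|f (l + h *: v) - f l| <= M * `|h|.
Proof.
move=> tf; have [M M0 hM] := test_bounded (test_derive v tf).
exists M => // l h.
have [c _ ->] := line_MVT0 l h (fun x => @test_derivable f x v tf).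
by rewrite normrM mulrC ler_wpM2r.
Qed.

(** The mean value theorem is used for [f] and again for its derivative. Uniformity in the base
    point is what later allows the expansion to be integrated. *)
Lemma test_taylor2 f v : test_function f ->
  exists2 M : R, 0 < M &
    forall l h, `|f (l + h *: v) - f l - h * 'D_v f l| <= M * h ^+ 2.
Proof.
move=> tf; have [M M0 hM] := test_taylor1 v (test_derive v tf).
exists M => // l h.
have [c ch ->] := line_MVT0 l h (fun x => @test_derivable f x v tf).
rewrite -mulrBr normrM -(real_normK (num_real h)) expr2 mulrCA ler_wpM2l//.
by apply: le_trans (hM _ _) _; rewrite ler_wpM2l// ltW.
Qed.

(** Move from [y] to [x] along one drift at a time, the step lengths being the coordinates of
    [x - y], and add the one-directional bounds. *)
Lemma test_lipschitz f : test_function f ->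
  exists2 M : R, 0 < M & forall x y, `|f x - f y| <= M * `|x - y|.
Proof.
move=> tf.
have hi i : {M : R | forall l h, `|f (l + h *: drift R i) - f l| <= M * `|h|}.
  by apply: cid; have [M _ hM] := test_taylor1 (drift R i) tf; exists M.
pose M i := projT1 (hi i).
have hM i l h : `|f (l + h *: drift R i) - f l| <= M i * `|h| := projT2 (hi i) l h.
have M0 i : 0 <= M i by have := hM i 0 1; rewrite normr1 mulr1; exact: le_trans.
have sumM : 0 <= \sum_i M i by apply: sumr_ge0.
exists (\sum_i M i + 1) => [|x y]; first by rewrite ltr_wpDl.
suff h (r : seq 'Z_n) (w l : S) :
    `|f (l + \sum_(i <- r) val w 0 i *: drift R i) - f l| <=
    (\sum_(i <- r) M i) * `|w|.
  have := h (index_enum _) (x - y) y.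
  rewrite sz_drift_sum (addrC y) subrK => /le_trans; apply.
  by rewrite ler_wpM2r// lerDl.
elim: r l => [|i r IH] l; first by rewrite !big_nil addr0 subrr normr0 mul0r.
rewrite !big_cons mulrDl addrA.
rewrite -(subrK (f (l + val w 0 i *: drift R i)) (f (_ + \sum_(j <- r) _))) -addrA.
rewrite addrC (le_trans (ler_normD _ _))// lerD//.
by apply: le_trans (hM _ _ _) _; rewrite ler_wpM2l// coord_le_norm.
Qed.

(** Two quadratic expansions of the same increment are compared at step [e]; after division by [e]
    the discrepancy is at most [M * e]. *)
Lemma test_deriveDv f l v w : test_function f ->
  'D_(v + w) f l = 'D_v f l + 'D_w f l.
Proof.
move=> tf.
have [M1 M10 h1] := test_taylor2 v tf.
have [M2 M20 h2] := test_taylor2 w tf.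
have [M3 M30 h3] := test_taylor2 (v + w) tf.
have [M4 M40 h4] := test_taylor1 v (test_derive w tf).
set M := M1 + M2 + M3 + M4.
apply/eqP; rewrite -subr_eq0; set d := _ - _.
suff h (e : R) : 0 < e -> `|d| <= M * e.
  have M0 : 0 < M by rewrite !addr_gt0.
  rewrite -normr_le0; apply/ler_addgt0Pr => e e0; rewrite add0r.
  by apply: le_trans (h (e / M) (divr_gt0 e0 M0)) _; rewrite mulrC divfK// gt_eqF.
move=> e0; rewrite -(ler_pM2l e0) -{1}(gtr0_norm e0) -normrM.
(* The point [l + e (v + w)] is reached by way of [l + e v] and also directly; the last summand
   moves the base point of the derivative along [w] back to [l]. *)
have -> : e * d =
    (f (l + e *: v) - f l - e * 'D_v f l)
  + (f (l + e *: v + e *: w) - f (l + e *: v) - e * 'D_w f (l + e *: v))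
  - (f (l + e *: (v + w)) - f l - e * 'D_(v + w) f l)
  + e * ('D_w f (l + e *: v) - 'D_w f l).
  by rewrite scalerDr (addrA l) /d; ring.
have -> : e * (M * e) = M1 * e ^+ 2 + M2 * e ^+ 2 + M3 * e ^+ 2 + e * (M4 * `|e|).
  by rewrite /M gtr0_norm//; ring.
rewrite (le_trans (ler_normD _ _))// lerD//; last first.
  by rewrite normrM gtr0_norm// ler_pM2l//; apply: le_trans (h4 _ _) _; rewrite gtr0_norm.
by rewrite (le_trans (ler_normB _ _))// lerD// (le_trans (ler_normD _ _))// lerD.
Qed.

Lemma test_derive_drift_sum0 f l : test_function f ->
  \sum_(i : 'Z_n) 'D_(drift R i) f l = 0.
Proof.
move=> tf; transitivity ('D_(\sum_(i : 'Z_n) drift R i) f l); last first.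
  by rewrite drift_sum0 derive0.
elim: (index_enum _) => [|i r IH]; first by rewrite !big_nil derive0.
by rewrite !big_cons test_deriveDv// IH.
Qed.

End TestFunctions.

(** * Explicit smooth functions: energy, Gibbs density, bump *)

Section ElementaryFunctions.
Variables (R : realType) (n : nat).
Local Notation S := (sumzero R n).
Local Notation N := (Zp_trunc n).+2.
Implicit Types (f g : S -> R) (l v w : S).

(** A syntactic class stable under directional derivatives, so that one induction proves all its
    members smooth. [flat_exp] enters with every index because differentiation raises the index. *)
Inductive elementary : (S -> R) -> Prop :=
| elem_cst c : elementary (fun _ => c)
| elem_coord i : elementary (fun l => val l 0 i)
| elem_add f g : elementary f -> elementary g -> elementary (fun l => f l + g l)
| elem_mul f g : elementary f -> elementary g -> elementary (fun l => f l * g l)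
| elem_flat k f : elementary f -> elementary (fun l => flat_exp k (f l))
| elem_exp f : elementary f -> elementary (fun l => expR (f l)).

Lemma flat_exp_continuous k : continuous (@flat_exp R k).
Proof.
move=> s; apply/differentiable_continuous/derivable1_diffP.
by case: (flat_exp_is_derive k s).
Qed.

Lemma elementary_smooth f : elementary f -> smooth f.
Proof.
move: f; apply: smooth_coind => f; elim => {f}.
- move=> c; split => [|v]; first exact: cst_continuous.
  by exists (fun _ => 0); [exact: elem_cst|move=> l; exact: is_derive_cst].
- move=> i; split => [|v]; first exact: coord_continuous.
  by exists (fun _ => val v 0 i); [exact: elem_cst|move=> l; exact: coord_is_derive].
- move=> f g ef [cf hf] eg [cg hg]; split => [|v]; first exact: continuous_add.
  have [df edf hdf] := hf v; have [dg edg hdg] := hg v.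
  exists (fun l => df l + dg l); first exact: elem_add.
  by move=> l; exact: is_deriveD.
- move=> f g ef [cf hf] eg [cg hg]; split => [|v]; first exact: continuous_mul.
  have [df edf hdf] := hf v; have [dg edg hdg] := hg v.
  exists (fun l => f l * dg l + g l * df l); first by apply: elem_add; exact: elem_mul.
  by move=> l; exact: is_deriveM.
- move=> k f ef [cf hf]; split => [x|v].
    by apply: (@continuous_comp _ _ _ f (flat_exp k)); [exact: cf|exact: flat_exp_continuous].
  have [df edf hdf] := hf v.
  exists (fun l => (- k%:R * flat_exp k.+1 (f l) + flat_exp k.+2 (f l)) * df l).
    by do ?[exact: elem_cst|exact: elem_flat|apply: elem_add|apply: elem_mul].
  by move=> l; apply: is_derive_comp (hdf l); exact: flat_exp_is_derive.
- move=> f ef [cf hf]; split => [x|v].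
    by apply: (@continuous_comp _ _ _ f expR); [exact: cf|exact: continuous_expR].
  have [df edf hdf] := hf v.
  exists (fun l => expR (f l) * df l); first by apply: elem_mul => //; exact: elem_exp.
  by move=> l; apply: is_derive_comp (hdf l); exact: is_derive_exp.
Qed.

Lemma elem_sum (I : Type) (r : seq I) (F : I -> S -> R) :
  (forall i, elementary (F i)) -> elementary (fun l => \sum_(i <- r) F i l).
Proof.
move=> h; elim: r => [|i r IH].
  by under eq_fun do rewrite big_nil; exact: elem_cst.
by under eq_fun do rewrite big_cons; apply: elem_add.
Qed.

Lemma elem_prod (I : Type) (r : seq I) (F : I -> S -> R) :
  (forall i, elementary (F i)) -> elementary (fun l => \prod_(i <- r) F i l).
Proof.
move=> h; elim: r => [|i r IH].
  by under eq_fun do rewrite big_nil; exact: elem_cst.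
by under eq_fun do rewrite big_cons; apply: elem_mul.
Qed.

Lemma elem_opp f : elementary f -> elementary (fun l => - f l).
Proof.
by move=> ef; under eq_fun do rewrite -mulN1r; apply: elem_mul => //; exact: elem_cst.
Qed.

Lemma elem_diffR (i : 'Z_n) : elementary (fun l => diffR l i).
Proof. by apply: elem_add; [|apply: elem_opp]; exact: elem_coord. Qed.

Lemma elem_energy : elementary (@energy R n).
Proof.
apply: elem_mul; first exact: elem_cst.
apply: elem_sum => i; under eq_fun do rewrite expr2.
by apply: elem_mul; exact: elem_diffR.
Qed.

Lemma elem_laplacian (i : 'Z_n) : elementary (fun l => laplacian l i).
Proof.
apply: elem_add; last exact: elem_coord.
apply: elem_add; first exact: elem_coord.
by apply/elem_opp/elem_mul; [exact: elem_cst|exact: elem_coord].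
Qed.

Definition gibbs_density l := expR (- energy l).

Lemma elem_gibbs_density : elementary gibbs_density.
Proof. by apply/elem_exp/elem_opp; exact: elem_energy. Qed.

Lemma gibbs_density_gt0 l : 0 < gibbs_density l.
Proof. exact: expR_gt0. Qed.

Lemma energy_ge0 l : 0 <= energy l.
Proof. by rewrite mulr_ge0// sumr_ge0// => i _; exact: sqr_ge0. Qed.

Lemma gibbs_density_le1 l : gibbs_density l <= 1.
Proof. by rewrite /gibbs_density expR_le1 oppr_le0 energy_ge0. Qed.

Lemma laplacian_is_derive (i : 'Z_n) l v :
  is_derive l v (fun l => laplacian l i) (laplacian v i).
Proof.
have d j := coord_is_derive j l v.
apply: is_derive_eq; rewrite /laplacian /GRing.scale/=; ring.
Qed.

Lemma diffR_is_derive (i : 'Z_n) l v :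
  is_derive l v (fun l => diffR l i) (diffR v i).
Proof. by have d j := coord_is_derive j l v; exact: is_deriveB. Qed.

Lemma energy_is_derive l (i : 'Z_n) :
  is_derive l (drift R i) (@energy R n) (- laplacian l i).
Proof.
have d j := diffR_is_derive j l (drift R i).
have -> : @energy R n = (fun l => 2^-1 * (\sum_(j < N) (fun l => diffR l j ^+ 2)) l).
  by apply/funext => x; rewrite /energy fct_sumE.
have d2 : forall j : 'I_N, is_derive l (drift R i) (fun l => diffR l j ^+ 2)
    (2 * diffR l j * diffR (drift R i) j).
  by move=> j; have := @is_deriveX R S (fun l => diffR l j) 2 l (drift R i) _ (d j);
     rewrite exprfctE /GRing.scale/= expr1.
have := is_derive_sum d2.
move=> ds; apply: is_derive_eq; rewrite /GRing.scale/=.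
under eq_bigr do rewrite -mulrA.
rewrite -mulr_sumr mulKf ?pnatr_eq0//.
(* The constant part of the drift cancels in differences; the two remaining indicators extract the
   second difference of [l]. *)
have e j : diffR (drift R i) j = (j == i - 1)%:R - (j == i)%:R.
  by rewrite /diffR !drift_coord (can2_eq (addrK 1) (subrK 1)); ring.
under eq_bigr do rewrite e mulrBr.
rewrite big_split/= sumrN (bigD1 (i - 1))//= eqxx mulr1 big1; last first.
  by move=> j /negPf ->; rewrite mulr0.
rewrite (bigD1 i)//= eqxx mulr1 big1; last first.
  by move=> j /negPf ->; rewrite mulr0.
by rewrite /diffR /laplacian subrK; ring.
Qed.

Lemma gibbs_density_is_derive l (i : 'Z_n) :
  is_derive l (drift R i) gibbs_density (gibbs_density l * laplacian l i).
Proof.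
have := energy_is_derive l i => d.
apply: (@is_derive_comp R S expR (fun l => - energy l)).
by rewrite -[laplacian l i]opprK; exact: is_deriveN.
Qed.

(** A product over coordinates instead of a radial profile suits the sup norm: it is positive
    exactly on the open unit ball. *)
Definition bump l := \prod_(i : 'Z_n) flat_exp 0 (1 - val l 0 i * val l 0 i).

Lemma elem_bump : elementary bump.
Proof.
apply: elem_prod => i; apply: elem_flat; apply: elem_add; first exact: elem_cst.
by apply/elem_opp/elem_mul; exact: elem_coord.
Qed.

Lemma bump_ge0 l : 0 <= bump l.
Proof. by apply: prodr_ge0 => i _; exact: flat_exp_ge0. Qed.

Lemma bump_gt0 l : `|l| < 1 -> 0 < bump l.
Proof.
move=> l1; apply: prodr_gt0 => i _; rewrite /flat_exp ifT.
  by rewrite mulr_gt0 ?expR_gt0.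
rewrite subr_gt0 -expr2 -(real_normK (num_real _)) expr_lt1//.
by rewrite (le_lt_trans (coord_le_norm _ _)).
Qed.

Lemma bump_eq0 l : 1 < `|l| -> bump l = 0.
Proof.
move=> l1; apply/eqP; apply: contraTT l1 => l0; rewrite -leNgt.
apply: norm_le_coord => // i; rewrite leNgt; apply: contra l0 => li.
rewrite /bump (bigD1 i)//= /flat_exp ifF ?mul0r//; apply/negbTE.
rewrite -leNgt subr_le0 -expr2 -(real_normK (num_real _)).
by rewrite expr_ge1// ltW.
Qed.

Lemma bumpN l : bump (- l) = bump l.
Proof. by apply: eq_bigr => i _; rewrite szcoordN mulrNN. Qed.

Lemma test_bump : test_function bump.
Proof.
apply/test_functionP; split; first exact/elementary_smooth/elem_bump.
by exists 1 => // l; exact: bump_eq0.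
Qed.

End ElementaryFunctions.

(** * Square integrals *)

Section IntegralTools.
Context d (T : measurableType d) (R : realType).
Variable mu : {measure set T -> \bar R}.
Implicit Types (f g : T -> R).

(** The integral of a nonnegative function is a supremum over the simple functions below it, so
    comparison holds for arbitrary functions. The estimates on the walk semigroup rest on this. *)
Lemma ge0_integral_mono (f g : T -> \bar R) : (forall x, 0 <= f x)%E ->
  (forall x, f x <= g x)%E -> (\int[mu]_x f x <= \int[mu]_x g x)%E.
Proof.
move=> f0 fg; have g0 x : (0 <= g x)%E by exact: le_trans (fg x).
rewrite !ge0_integralTE//; apply: le_ereal_sup => _ [h hf <-]; exists h => // x.
exact: le_trans (fg x).
Qed.

Import HBNNSimple.

(** The density formula on level sets gives it for simple functions, and monotone convergence on
    both sides gives the rest. *)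
Lemma ge0_integral_density (nu : {measure set T -> \bar R}) (w : T -> R) :
  measurable_fun setT w -> (forall x, 0 <= w x) ->
  (forall A, measurable A -> nu A = \int[mu]_(x in A) (w x)%:E)%E ->
  forall f : T -> \bar R, measurable_fun setT f -> (forall x, 0 <= f x)%E ->
  (\int[nu]_x f x = \int[mu]_x (f x * (w x)%:E))%E.
Proof.
move=> mw w0 nuE f mf f0.
pose f_ := nnsfun_approx measurableT mf.
have f_cvg x : EFin \o f_ ^~ x @ \oo --> f x by exact: cvg_nnsfun_approx.
have f_nd x : {homo (fun k => (f_ k x)%:E) : a b / (a <= b)%N >-> (a <= b)%E}.
  by move=> a b ab; rewrite lee_fin; exact/lefP/nd_nnsfun_approx.
transitivity (limn (fun k => \int[nu]_x (f_ k x)%:E)%E).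
  rewrite -monotone_convergence//.
  - by apply: eq_integral => x _; apply/esym/cvg_lim => //; exact: f_cvg.
  - by move=> k; exact/measurable_EFinP.
  - by move=> k x _; rewrite lee_fin.
transitivity (limn (fun k => \int[mu]_x ((f_ k x)%:E * (w x)%:E))%E); last first.
  rewrite -monotone_convergence//.
  - apply: eq_integral => x _; apply/cvg_lim => //.
    by apply: cvgeZr => //; exact: f_cvg.
  - by move=> k; apply: emeasurable_funM; exact/measurable_EFinP.
  - by move=> k x _; rewrite mule_ge0// lee_fin.
  - by move=> x _ a b ab; rewrite lee_wpmul2r ?lee_fin//; exact/f_nd.
congr (limn _); apply/funext => k.
rewrite integralT_nnsfun sintegralE.
have fE x : ((f_ k x)%:E * (w x)%:E =
    \sum_(r \in range (f_ k)) ((r * \1_(f_ k @^-1` [set r]) x)%:E * (w x)%:E))%E.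
  rewrite fimfunE -fsumEFin// ge0_mule_fsuml// => r.
  exact: nnfun_muleindic_ge0.
under [RHS]eq_integral do rewrite fE.
rewrite ge0_integral_fsum//; last 2 first.
- by move=> r; apply: emeasurable_funM; apply/measurable_EFinP => //; exact: measurable_funM.
- by move=> r x _; rewrite mule_ge0 ?lee_fin//; exact: nnfun_muleindic_ge0.
apply: eq_fsbigr => r _.
have mA : measurable (f_ k @^-1` [set r]) by [].
have [r0|r0] := leP 0 r; last first.
  rewrite preimage_nnfun0// measure0 mule0 integral0_eq// => x _.
  by rewrite indic0 mulr0 mul0e.
have mwA : measurable_fun setT ((EFin \o w) \_ (f_ k @^-1` [set r])).
  by apply/(measurable_restrictT _ _).1 => //; apply: measurable_funTS; exact/measurable_EFinP.
rewrite nuE// (integral_mkcond (f_ k @^-1` [set r])).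
rewrite -ge0_integralZl//; last first.
  by move=> x _; apply: erestrict_ge0 => y _; rewrite lee_fin.
apply: eq_integral => x _; rewrite /patch indicE.
by case: ifPn => _; rewrite ?mulr1 ?mulr0 ?mule0 ?mul0e.
Qed.

(** The square of [norm2], with values in the extended reals: estimates combine without square roots
    and can be stated before square integrability is known. *)
Definition sqint f : \bar R := (\int[mu]_x ((f x) ^+ 2)%:E)%E.

Lemma sqint_ge0 f : (0 <= sqint f)%E.
Proof. by apply: integral_ge0 => x _; rewrite lee_fin sqr_ge0. Qed.

Lemma norm2E f : norm2 mu f = poweR (sqint f) 2^-1.
Proof.
rewrite /norm2 unlock /Lnorm; congr poweR; apply: eq_integral => x _ /=.
by rewrite powR_mulrn// -normrX ger0_norm// sqr_ge0.
Qed.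

Lemma norm2_lt f (e : R) : 0 < e -> (sqint f < (e ^+ 2)%:E)%E ->
  (norm2 mu f < e%:E)%E.
Proof.
move=> e0; rewrite norm2E.
move: (sqint_ge0 f); case: (sqint f) => [r| |]//=; rewrite lee_fin !lte_fin => r0 re.
have -> : e = (e ^+ 2) `^ 2^-1.
  by rewrite -powR_mulrn ?ltW// -powRrM mulfV ?pnatr_eq0// powRr1// ltW.
by apply: gt0_ltr_powR; rewrite ?invr_gt0// ?nnegrE// ?exprn_ge0// ltW.
Qed.

Lemma norm2_le f (e : R) : 0 <= e -> (sqint f <= (e ^+ 2)%:E)%E ->
  (norm2 mu f <= e%:E)%E.
Proof.
move=> e0; rewrite norm2E.
move: (sqint_ge0 f); case: (sqint f) => [r| |]//=; rewrite !lee_fin => r0 re.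
have -> : e = (e ^+ 2) `^ 2^-1.
  by rewrite -powR_mulrn// -powRrM mulfV ?pnatr_eq0// powRr1.
by apply: ge0_ler_powR; rewrite ?nnegrE// ?exprn_ge0// invr_ge0.
Qed.

Lemma sqint_norm2_lt f (e : R) : 0 < e -> (norm2 mu f < e%:E)%E ->
  (sqint f < (e ^+ 2)%:E)%E.
Proof.
move=> e0; rewrite norm2E.
move: (sqint_ge0 f); case: (sqint f) => [r| |]//=; rewrite ?lee_fin ?lte_fin => r0; last first.
  by rewrite invr_eq0 pnatr_eq0.
rewrite ?lte_fin => re.
have -> : r = (r `^ 2^-1) ^+ 2.
  by rewrite -powR_mulrn ?powR_ge0// -powRrM mulVf ?pnatr_eq0// powRr1.
by rewrite ltr_pXn2r// ?nnegrE ?powR_ge0// ltW.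
Qed.

Lemma L2P f : L2 mu f <-> measurable_fun setT f /\ (sqint f < +oo)%E.
Proof.
have h : (sqint f < +oo)%E <-> finite_norm mu 2%:E f.
  rewrite /finite_norm -/(norm2 mu f) norm2E.
  move: (sqint_ge0 f); case: (sqint f) => [r| |]//= _; first by rewrite !ltry.
  by rewrite invr_eq0 pnatr_eq0.
rewrite /L2 /= inE; split.
  by move=> /andP[/[!inE]/= mf /h ff].
by move=> [mf /h ff]; apply/andP; split; rewrite inE.
Qed.

Lemma measurable_sq f : measurable_fun setT f ->
  measurable_fun setT (fun x => (f x ^+ 2)%:E).
Proof. by move=> mf; apply/measurable_EFinP; exact: measurable_funX. Qed.

Lemma sqint_le f g : (forall x, `|f x| <= `|g x|) -> (sqint f <= sqint g)%E.
Proof.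
move=> fg; apply: ge0_integral_mono => x; first by rewrite lee_fin sqr_ge0.
by rewrite lee_fin -(real_normK (num_real (f x))) -(real_normK (num_real (g x))) lerXn2r ?nnegrE.
Qed.

Lemma sqint_scale_le (c : R) f g : measurable_fun setT g ->
  (forall x, `|f x| <= c * `|g x|) -> (sqint f <= (c ^+ 2)%:E * sqint g)%E.
Proof.
move=> mg fg; rewrite /sqint -ge0_integralZl//; first last.
- by rewrite lee_fin sqr_ge0.
- by move=> x _; rewrite lee_fin sqr_ge0.
- exact: measurable_sq.
apply: ge0_integral_mono => x; first by rewrite lee_fin sqr_ge0.
rewrite -EFinM lee_fin -(real_normK (num_real (f x))) -(real_normK (num_real (g x))).
by rewrite -exprMn lerXn2r ?nnegrE// (le_trans _ (fg x)).
Qed.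

Lemma sqint_add f g : measurable_fun setT f -> measurable_fun setT g ->
  (sqint (fun x => (f x + g x)%R) <= 2%:E * sqint f + 2%:E * sqint g)%E.
Proof.
move=> mf mg; rewrite /sqint -!ge0_integralZl//; first last.
- by move=> x _; rewrite lee_fin sqr_ge0.
- exact: measurable_sq.
- by move=> x _; rewrite lee_fin sqr_ge0.
- exact: measurable_sq.
rewrite -ge0_integralD//; first last.
- by apply: measurable_funeM; exact: measurable_sq.
- by move=> x _; rewrite mule_ge0// lee_fin sqr_ge0.
- by apply: measurable_funeM; exact: measurable_sq.
- by move=> x _; rewrite mule_ge0// lee_fin sqr_ge0.
apply: ge0_integral_mono => x; first by rewrite lee_fin sqr_ge0.
rewrite -!EFinM -EFinD lee_fin -subr_ge0.
by rewrite (_ : _ - _ = (f x - g x) ^+ 2) ?sqr_ge0//; ring.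
Qed.

(** Each summand costs a factor 2 in [sqint_add], so error budgets are split into quarters from here
    on. *)
Lemma sqint_add_lt f g (e : R) : measurable_fun setT f -> measurable_fun setT g ->
  (sqint f < (e / 4)%:E)%E -> (sqint g < (e / 4)%:E)%E ->
  (sqint (fun x => (f x + g x)%R) < e%:E)%E.
Proof.
move=> mf mg; move: (sqint_add mf mg) (sqint_ge0 f) (sqint_ge0 g).
case: (sqint f) => [r| |]//; case: (sqint g) => [s| |]// h _ _.
rewrite !lte_fin => re se; apply: le_lt_trans h _.
rewrite -!EFinM -EFinD lte_fin; lra.
Qed.

Lemma L2_measurable f : L2 mu f -> measurable_fun setT f.
Proof. by move=> /L2P[]. Qed.

Lemma L2_add f g : L2 mu f -> L2 mu g -> L2 mu (fun x => f x + g x).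
Proof.
move=> /L2P[mf ff] /L2P[mg fg]; apply/L2P; split; first exact: measurable_funD.
apply: le_lt_trans (sqint_add mf mg) _.
by rewrite lte_add_pinfty// lte_mul_pinfty.
Qed.

Lemma L2_bounded_mul (c : R) f g : measurable_fun setT f ->
  (forall x, `|f x| <= c) -> L2 mu g -> L2 mu (fun x => f x * g x).
Proof.
move=> mf fc /L2P[mg fg]; apply/L2P; split; first exact: measurable_funM.
apply: (@le_lt_trans _ _ ((c ^+ 2)%:E * sqint g)%E).
  by apply: sqint_scale_le => // x; rewrite normrM ler_wpM2r.
by rewrite lte_mul_pinfty// lee_fin sqr_ge0.
Qed.

Lemma L2_scale (c : R) f : L2 mu f -> L2 mu (fun x => c * f x).
Proof. exact: (@L2_bounded_mul `|c| (fun _ => c)). Qed.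

Lemma L2_sum (I : Type) (r : seq I) (F : I -> T -> R) :
  (forall i, L2 mu (F i)) -> L2 mu (fun x => \sum_(i <- r) F i x).
Proof.
move=> h; elim: r => [|i r IH].
  under eq_fun do rewrite big_nil; apply/L2P; split => //.
  by rewrite /sqint expr0n/= integral0.
by under eq_fun do rewrite big_cons; exact: L2_add.
Qed.

Lemma integrable_addR f g : mu.-integrable setT (EFin \o f) ->
  mu.-integrable setT (EFin \o g) -> mu.-integrable setT (EFin \o (fun x => f x + g x)).
Proof. by move=> i j; have := integrableD measurableT i j. Qed.

Lemma integrable_subR f g : mu.-integrable setT (EFin \o f) ->
  mu.-integrable setT (EFin \o g) -> mu.-integrable setT (EFin \o (fun x => f x - g x)).
Proof. by move=> i j; have := integrableB measurableT i j. Qed.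

Lemma integrable_scaleR (c : R) f : mu.-integrable setT (EFin \o f) ->
  mu.-integrable setT (EFin \o (fun x => c * f x)).
Proof. by move=> i; have := integrableZl measurableT c i. Qed.

Lemma L2_mul_integrable f g : L2 mu f -> L2 mu g ->
  mu.-integrable setT (EFin \o (fun x => f x * g x)).
Proof.
move=> /L2P[mf ff] /L2P[mg fg].
have i h : measurable_fun setT h -> (sqint h < +oo)%E ->
    mu.-integrable setT (EFin \o (fun x => h x ^+ 2)).
  move=> mh fh; apply/integrableP; split; first exact: measurable_sq.
  by under eq_integral do rewrite /= ger0_norm ?sqr_ge0//.
apply: (@le_integrable _ _ _ mu setT measurableT _
    (fun x => (EFin \o (fun x => (f x ^+ 2)%R)) x + (EFin \o (fun x => (g x ^+ 2)%R)) x)%E) => //.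
- by apply/measurable_EFinP; exact: measurable_funM.
- move=> x _ /=; rewrite lee_fin (ger0_norm (addr_ge0 (sqr_ge0 _) (sqr_ge0 _))).
  rewrite normrM -(real_normK (num_real (f x))) -(real_normK (num_real (g x))).
  have := sqr_ge0 (`|f x| - `|g x|); have := sqr_ge0 (`|f x| + `|g x|); nra.
- by apply: integrableD => //; exact: i.
Qed.

Lemma sqint_cvg_dominated (f_ : nat -> T -> R) (g : T -> R) :
  (forall k, measurable_fun setT (f_ k)) ->
  (forall x, f_ k x @[k --> \oo] --> (0 : R)) ->
  L2 mu g -> (forall k x, `|f_ k x| <= g x) ->
  sqint (f_ k) @[k --> \oo] --> 0%E.
Proof.
move=> mf f0 Lg fg.
have := @dominated_convergence _ _ _ mu setT measurableT
  (fun k x => (f_ k x ^+ 2)%:E) (cst 0%E) (EFin \o (fun x => g x * g x)).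
case => //.
- by move=> k; exact: measurable_sq.
- apply/aeW => x _; apply/fine_cvgP; split; first exact: nearW.
  rewrite /= -(mulr0 (0 : R)).
  by under eq_fun do rewrite /= expr2; apply: cvgM; exact: f0.
- exact: L2_mul_integrable.
- apply/aeW => x k _ /=; rewrite lee_fin ger0_norm ?sqr_ge0// -expr2.
  by rewrite -(real_normK (num_real (f_ k x))) lerXn2r// nnegrE (le_trans _ (fg k x)).
by move=> _ _; rewrite integral0.
Qed.

Lemma near_sqint_lt (u : nat -> \bar R) (e : R) : 0 < e ->
  u k @[k --> \oo] --> 0%E -> (forall k, 0 <= u k)%E ->
  \forall k \near \oo, (u k < e%:E)%E.
Proof.
move=> e0 u0 up.
have : \forall x \near (0 : \bar R)%E, (x < e%:E)%E.
  exists e => //= x; rewrite /= sub0r normrN => /ltr_normlW xe.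
  by rewrite lte_fin.
exact: u0.
Qed.

End IntegralTools.

(** * Haar measure *)

Section HaarMeasure.
Variables (R : realType) (n : nat).
Local Notation S := (sumzero R n).
Local Notation N := (Zp_trunc n).+2.
Variable lambda : {measure set S -> \bar R}.
Hypothesis hlambda : is_haar lambda.
Implicit Types (f g : S -> R) (l v w : S).

Local Notation B r := [set l : S | `|l| <= r].

Lemma continuous_measurable f : continuous f -> measurable_fun setT f.
Proof.
move=> cf mD; apply: (measurability _ (RGenOpens.measurableE R)) => //.
move=> _ [_ [a [b ->] <-]]; rewrite setTI; apply: sub_sigma_algebra.
by move/continuousP: cf; apply; exact: interval_open.
Qed.

Lemma smooth_measurable f : smooth f -> measurable_fun setT f.
Proof. by move=> /smooth_continuous; exact: continuous_measurable. Qed.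

Lemma test_measurable f : test_function f -> measurable_fun setT f.
Proof. by move=> /test_smooth; exact: smooth_measurable. Qed.

Lemma measurable_norm_sz : measurable_fun setT (fun l : S => `|l|).
Proof. by apply: continuous_measurable => x; exact: norm_continuous. Qed.

Lemma measurable_sz_ball r : measurable (B r).
Proof.
have := measurable_norm_sz measurableT (measurable_itv `]-oo, r]).
by rewrite setTI.
Qed.

Lemma haar_ball_lty r : (lambda (B r) < +oo)%E.
Proof. by case: hlambda => _ + _; apply; exact: closed_ball_compact. Qed.

Lemma bounded_support_integrable f (M r : R) : measurable_fun setT f ->
  (forall l, `|f l| <= M) -> (forall l, r < `|l| -> f l = 0) ->
  lambda.-integrable setT (EFin \o f).
Proof.
move=> mf fM fr.
have -> : EFin \o f = (EFin \o f) \_ (B r).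
  apply/funext => l; rewrite patchE; case: ifPn => //.
  by rewrite notin_setE /= => /negP; rewrite -ltNge => /fr ->.
apply/(integrable_mkcond _ (measurable_sz_ball r)).
apply: measurable_bounded_integrable => //; first exact: measurable_sz_ball.
- exact: haar_ball_lty.
- exact: measurable_funTS.
- exists M; split; first exact: num_real.
  by move=> y My l _ /=; rewrite (le_trans (fM l))// ltW.
Qed.

Lemma test_integrable f : test_function f -> lambda.-integrable setT (EFin \o f).
Proof.
move=> tf; have [M _ fM] := test_bounded tf.
have /test_functionP[_ [r _ fr]] := tf.
exact: (bounded_support_integrable (test_measurable tf) fM fr).
Qed.

Lemma measurable_translation v : measurable_fun setT (fun l : S => l + v).
Proof.
move=> mD; apply: (@measurability _ _ _ _ setT (fun l : S => l + v) (@open S)) => //.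
move=> _ [A oA <-]; rewrite setTI; apply: sub_sigma_algebra.
by have /continuousP := @continuous_translation R S v; apply.
Qed.

Lemma ge0_integral_translation v (F : S -> \bar R) : measurable_fun setT F ->
  (forall l, 0 <= F l)%E -> (\int[lambda]_l F (l + v)%R = \int[lambda]_l F l)%E.
Proof.
move=> mF F0; have h := ge0_integral_pushforward (measurable_translation v) lambda
  measurableT mF (fun x _ => F0 x).
rewrite preimage_setT in h; rewrite -[LHS]h.
apply: eq_measure_integral; first exact: measurable_translation.
by move=> mv A mA _; have [hv _ _] := hlambda; exact: hv.
Qed.

Lemma integral_translation v f : lambda.-integrable setT (EFin \o f) ->
  \int[lambda]_l f (l + v) = \int[lambda]_l f l.
Proof.
move=> /integrableP[mf _]; rewrite /Rintegral; congr fine.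
rewrite [LHS]integralE [RHS]integralE; congr (_ - _)%E.
  have h := ge0_integral_translation v (measurable_funepos mf) (fun l => funepos_ge0 _ l).
  by rewrite -h; apply: eq_integral => l _; rewrite !unlock.
have h := ge0_integral_translation v (measurable_funeneg mf) (fun l => funeneg_ge0 _ l).
by rewrite -h; apply: eq_integral => l _; rewrite !unlock.
Qed.

Lemma haar_translated_ball r v : lambda [set l : S | `|l - v| <= r] = lambda (B r).
Proof. by case: hlambda => + _ _; move=> /(_ (- v) _ (measurable_sz_ball r)). Qed.

Lemma haar_sigma_finite : sigma_finite setT lambda.
Proof.
exists (fun k => B k%:R) => [|k].
  apply/esym; rewrite -subTset => l _; exists (Num.truncn `|l|).+1 => //=.
  by apply/ltW/real_truncnS_gt; exact: num_real.
by split; [exact: measurable_sz_ball|exact: haar_ball_lty].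
Qed.

(** By translation invariance, the Taylor remainder at step [e] integrates to [- e] times the
    integral of the derivative. That remainder is at most [M * e ^+ 2] on a ball that does not
    depend on [e <= 1], so dividing by [e] and letting it tend to zero gives the claim. *)
Lemma integral_derive_test f v : test_function f -> \int[lambda]_l 'D_v f l = 0.
Proof.
move=> tf; have [M M0 hM] := test_taylor2 v tf.
have /test_functionP[_ [r r0 fr]] := tf.
have tD := test_derive v tf; have iD := test_integrable tD.
(* This radius contains the support of [f] and of all its translates by [e *: v] with [e <= 1]. *)
pose s := r + `|v|.
have [m mE] : exists m, lambda (B s) = m%:E.
  by exists (fine (lambda (B s))); rewrite fineK// ge0_fin_numE// haar_ball_lty.
have m0 : 0 <= m by rewrite -lee_fin -mE.
suff h (e : R) : 0 < e -> e <= 1 -> `|\int[lambda]_l 'D_v f l| <= M * m * e.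
  apply/eqP; rewrite -normr_le0; apply/ler_addgt0Pr => e e0; rewrite add0r.
  have K0 : 0 < M * m + 1 by rewrite ltr_wpDl// mulr_ge0// ltW.
  pose e' := Num.min 1 (e / (M * m + 1)).
  have e'0 : 0 < e' by rewrite lt_min ltr01 divr_gt0.
  apply: le_trans (h e' e'0 _) _; first by rewrite ge_min lexx.
  apply: (@le_trans _ _ ((M * m + 1) * (e / (M * m + 1)))).
    rewrite ler_pM ?mulr_ge0//; [exact: ltW|exact: ltW|by rewrite lerDl|].
    by rewrite ge_min lexx orbT.
  by rewrite mulrC divfK// gt_eqF.
move=> e0 e1.
have tt := test_translation (e *: v) tf.
pose g l := f (l + e *: v) - f l - e * 'D_v f l.
have ig : lambda.-integrable setT (EFin \o g).
  apply: (@test_integrable g); apply: test_add.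
    by apply: test_add => //; under eq_fun do rewrite -mulN1r; exact: test_scale.
  by under eq_fun do rewrite -mulNr; exact: test_scale.
have intg : \int[lambda]_l g l = - (e * \int[lambda]_l 'D_v f l).
  rewrite /g RintegralB//=; last 2 first.
  - apply: (@test_integrable (fun l => f (l + e *: v) - f l)).
    by apply: test_add => //; under eq_fun do rewrite -mulN1r; exact: test_scale.
  - by apply: (@test_integrable (fun l => e * 'D_v f l)); exact: test_scale.
  rewrite RintegralB//=; [|exact: test_integrable|exact: test_integrable].
  rewrite integral_translation; last exact: test_integrable.
  by rewrite subrr sub0r RintegralZl.
have := le_normr_Rintegral measurableT ig; rewrite intg normrN normrM gtr0_norm//.
move=> h; rewrite -(ler_pM2l e0); apply: (le_trans h).
have g0 l : s < `|l| -> g l = 0.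
  move=> sl; have rl : r < `|l| by rewrite (le_lt_trans _ sl)// lerDl.
  have rl2 : r < `|l + e *: v|.
    rewrite -(ltrD2r `|v|) (lt_le_trans sl)//.
    rewrite -{1}(addrK (e *: v) l) (le_trans (ler_normB _ _))// lerD2l.
    by rewrite normrZ gtr0_norm// ler_piMl.
  by rewrite /g (fr _ rl) (fr _ rl2) (derive_vanish _ fr rl) mulr0 !subr0.
have -> : e * (M * m * e) = M * e ^+ 2 * m by ring.
have -> : m = fine (lambda (B s)) by rewrite mE.
rewrite -Rintegral_cst; last exact: measurable_sz_ball.
rewrite [leRHS]Rintegral_mkcond; apply: le_Rintegral => //.
- by have := integrable_norm ig.
- apply: (@bounded_support_integrable _ (M * e ^+ 2) s).
  + apply/(measurable_restrictT _ _).1 => //; exact: measurable_sz_ball.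
  + have c0 : 0 <= M * e ^+ 2 by rewrite mulr_ge0 ?sqr_ge0// ltW.
    by move=> l; rewrite patchE; case: ifP => _; rewrite ?normr0// ger0_norm.
  + by move=> l sl; rewrite patchE memNset//= leNgt sl.
- move=> l _; rewrite patchE; case: ifPn => [_|]; first exact: hM.
  by rewrite notin_setE /= => /negP; rewrite -ltNge => /g0 ->; rewrite normr0.
Qed.

(** Doubling with a constant independent of [r]: a grid scaled with [r] yields the same number of
    translated balls at every scale, and translates have equal measure. *)
Lemma haar_cover_ball : exists m : nat, forall r : R, 0 < r ->
  (lambda (B (2 * r)%R) <= m%:R%:E * lambda (B r))%E.
Proof.
(* In units of [delta] the coordinates lie between [- 4 N] and [4 N]; shifted by [4 N], their
   integer parts take [8 N + 1] values. *)
pose K := (8 * N).+1.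
exists #|{ffun 'Z_n -> 'I_K}| => r r0.
(* Rounding each of the [N] coordinates moves the point by at most [delta] times the norm 2 of a
   drift, hence by at most [r] in total. *)
pose delta := r / (2 * N%:R).
have N0 : 0 < N%:R :> R by rewrite ltr0n.
have d0 : 0 < delta by rewrite divr_gt0// mulr_gt0.
pose c (k : {ffun 'Z_n -> 'I_K}) : S :=
  \sum_i (delta * ((k i)%:R - 4 * N%:R)) *: drift R i.
pose A k := [set l : S | `|l - c k| <= r].
have mA k : measurable (A k).
  have := measurable_translation (- c k) measurableT (measurable_sz_ball r).
  by rewrite setTI.
have cover : B (2 * r) `<=` \big[setU/set0]_(k : {ffun 'Z_n -> 'I_K}) A k.
  move=> l /= l2r.
  have bl i : 0 <= val l 0 i / delta + 4 * N%:R <= 8 * N%:R.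
    have dE : 4 * N%:R * delta = 2 * r by rewrite /delta; field; rewrite gt_eqF.
    have := le_trans (coord_le_norm l i) l2r; rewrite -dE -ler_pdivrMr//.
    have -> : `|val l 0 i| / delta = `|val l 0 i / delta|.
      by rewrite normrM normfV (gtr0_norm d0).
    rewrite ler_norml => /andP[h1 h2]; apply/andP; split; lra.
  have kl i : (Num.truncn (val l 0 i / delta + 4 * N%:R)%R < K)%N.
    have /andP[h0 h8] := bl i; rewrite Num.Theory.truncn_lt_nat//.
    by rewrite (le_lt_trans h8)// -natrM ltr_nat.
  pose k : {ffun 'Z_n -> 'I_K} := [ffun i => Ordinal (kl i)].
  rewrite -bigcup_seq/=; exists k => /=; first by rewrite mem_index_enum.
  rewrite /A/= [l in l - _]sz_drift_decomp -sumrB.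
  apply: le_trans (ler_norm_sum _ _ _) _.
  apply: (@le_trans _ _ (\sum_(i : 'Z_n) (delta * 2))); last first.
    rewrite sumr_const card_ord -mulr_natl le_eqVlt; apply/orP; left; apply/eqP.
    by rewrite /delta; field; rewrite gt_eqF.
  apply: ler_sum => i _; rewrite -scalerBl normrZ ler_pM// ?drift_norm//.
  rewrite ffunE/=; have /andP[h0 h8] := bl i.
  have /andP[t1] := truncn_itv h0; rewrite -[(Num.truncn _).+1%:R]natr1 => t2.
  set t := (Num.truncn _)%:R in t1 t2 *.
  have -> : val l 0 i - delta * (t - 4 * N%:R) =
      delta * (val l 0 i / delta + 4 * N%:R - t) by field; rewrite gt_eqF.
  rewrite normrM gtr0_norm// ger0_norm ?subr_ge0//.
  by apply: ler_piMr; [exact: ltW|rewrite lerBlDl; exact: ltW].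
apply: (@le_trans _ _ (lambda (\big[setU/set0]_(k : {ffun 'Z_n -> 'I_K}) A k))).
  apply: le_measure => //; rewrite inE; first exact: measurable_sz_ball.
  exact: bigsetU_measurable.
have -> : #|{ffun 'Z_n -> 'I_K}| = size (index_enum {ffun 'Z_n -> 'I_K}).
  by rewrite cardT enumT.
have m0 : (0 <= lambda (B r))%E by [].
elim: (index_enum _) => [|k s IH]; first by rewrite big_nil measure0 mule_ge0.
rewrite big_cons /= -natr1 EFinD ge0_muleDl ?lee_fin// mul1e addeC.
apply: (@le_trans _ _ (lambda (A k) + lambda (\big[setU/set0]_(j <- s) A j))%E).
  by apply: measureU2 => //; exact: bigsetU_measurable.
by apply: leeD => //; rewrite haar_translated_ball.
Qed.

(** If one ball were null, doubling would make all its dilates null, hence the whole space. *)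
Lemma haar_ball_gt0 r : 0 < r -> (0 < lambda (B r))%E.
Proof.
move=> r0; rewrite lt_neqAle measure_ge0 andbT; apply/negP => /eqP/esym b0.
have [m hm] := haar_cover_ball.
have z k : lambda (B (2 ^+ k * r)) = 0%E.
  elim: k => [|k IH]; first by rewrite mul1r.
  apply/eqP; rewrite eq_le measure_ge0 andbT exprS -mulrA.
  by rewrite (le_trans (hm _ _))// ?mulr_gt0 ?exprn_gt0// IH mule0.
case: hlambda => _ _; apply/negP; rewrite -leNgt.
have -> : [set: S] = \bigcup_k B (2 ^+ k * r).
  apply/esym; rewrite -subTset => l _; exists (Num.truncn (`|l| / r)).+1 => //=.
  rewrite -ler_pdivrMr// (le_trans (ltW (real_truncnS_gt _)))// ?num_real//.
  rewrite -natrX ler_nat; exact/ltnW/ltn_expl.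
have mB k : measurable (B (2 ^+ k * r)) by exact: measurable_sz_ball.
apply: (@le_trans _ _ (\sum_(k <oo) lambda (B (2 ^+ k * r)%R))%E).
  by apply: measure_sigma_subadditive => //; exact: bigcup_measurable.
by rewrite eseries0// => k _ _; exact: z.
Qed.

End HaarMeasure.

(** * The Gaussian measure *)

Section DensityIntegral.
Context d (T : measurableType d) (R : realType).
Variables (mu nu : {measure set T -> \bar R}) (w : T -> R).
Hypotheses (mw : measurable_fun setT w) (w0 : forall x, 0 <= w x).
Hypothesis nuE : forall A, measurable A -> (nu A = \int[mu]_(x in A) (w x)%:E)%E.

Lemma integral_density (f : T -> R) : measurable_fun setT f ->
  (\int[nu]_x (f x)%:E = \int[mu]_x (f x * w x)%:E)%E.
Proof.
move=> mf; have mEf : measurable_fun setT (EFin \o f) by exact/measurable_EFinP.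
rewrite [LHS]integralE [RHS]integralE.
rewrite (ge0_integral_density mw w0 nuE (measurable_funepos mEf) (fun x => funepos_ge0 _ x)).
rewrite (ge0_integral_density mw w0 nuE (measurable_funeneg mEf) (fun x => funeneg_ge0 _ x)).
congr (_ - _)%E; apply: eq_integral => x _.
  by rewrite !funeposE/= maxe_pMl ?mul0e// ?lee_fin.
by rewrite !funenegE/= maxe_pMl ?mul0e ?lee_fin//= -EFinM mulNr.
Qed.

Lemma Rintegral_density (f : T -> R) : measurable_fun setT f ->
  \int[nu]_x f x = \int[mu]_x (f x * w x).
Proof. by move=> mf; rewrite /Rintegral integral_density. Qed.

Lemma sqint_density (f : T -> R) : measurable_fun setT f ->
  (sqint nu f = \int[mu]_x (f x ^+ 2 * w x)%:E)%E.
Proof. by move=> mf; rewrite /sqint integral_density//; exact: measurable_funX. Qed.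

End DensityIntegral.

Section GaussianMass.
Variables (R : realType) (n : nat).
Local Notation S := (sumzero R n).
Local Notation N := (Zp_trunc n).+2.
Variable lambda : {measure set S -> \bar R}.
Hypothesis hlambda : is_haar lambda.
Implicit Types (f g : S -> R) (l v w : S).
Local Notation B r := [set l : S | `|l| <= r].

(** Every neighbouring difference is at most the square root of twice the energy. Two sites are
    joined by at most [N] steps, and zero mean turns differences into coordinates. *)
Lemma poincare l : `|l| ^+ 2 <= 2 * N%:R ^+ 2 * energy l.
Proof.
set E := energy l; have E0 : 0 <= E := energy_ge0 l.
have dE i : `|diffR l i| <= Num.sqrt (2 * E).
  rewrite -sqrtr_sqr ler_wsqrtr// /E /energy mulrA mulfV ?pnatr_eq0// mul1r.
  by rewrite (bigD1 i)//= lerDl sumr_ge0// => j _; exact: sqr_ge0.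
set D := Num.sqrt (2 * E) in dE; have D0 : 0 <= D := sqrtr_ge0 _.
have step (i : 'Z_n) (k : nat) : `|val l 0 (i + k%:R) - val l 0 i| <= k%:R * D.
  elim: k => [|k IH]; first by rewrite addr0 subrr normr0 mul0r.
  have -> : val l 0 (i + k.+1%:R) - val l 0 i =
      (val l 0 (i + k%:R) - val l 0 i) + diffR l (i + k%:R).
    by rewrite /diffR -(addrA i) natr1; ring.
  by rewrite -[k.+1%:R]natr1 mulrDl mul1r (le_trans (ler_normD _ _))// lerD.
have diff i j : `|val l 0 i - val l 0 j| <= N%:R * D.
  have := step j (val (i - j)); rewrite natr_Zp (addrC j) subrK => /le_trans; apply.
  by rewrite ler_wpM2r// ler_nat; exact/ltnW/ltn_ord.
have coord i : `|val l 0 i| <= N%:R * D.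
  have N0 : 0 < N%:R :> R by rewrite ltr0n.
  rewrite -(ler_pM2l N0) -{1}(gtr0_norm N0) -normrM.
  (* The subtracted coordinates sum to zero. *)
  have -> : N%:R * val l 0 i = \sum_j (val l 0 i - val l 0 j).
    by rewrite sumrB sz_sum0 subr0 sumr_const card_ord mulr_natl.
  apply: le_trans (ler_norm_sum _ _ _) _.
  apply: (@le_trans _ _ (\sum_(j < N) (N%:R * D))); first exact: ler_sum.
  by rewrite sumr_const card_ord [leRHS]mulr_natl.
have := norm_le_coord (mulr_ge0 (ler0n _ _) D0) coord.
have DD : D ^+ 2 = 2 * E by rewrite sqr_sqrtr// mulr_ge0.
move=> h; apply: (@le_trans _ _ ((N%:R * D) ^+ 2)).
  by rewrite lerXn2r// nnegrE// mulr_ge0.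
by rewrite exprMn DD le_eqVlt; apply/orP; left; apply/eqP; ring.
Qed.

(** Dyadic shells: by doubling, the measure of the ball of radius [2 ^+ k] grows at most like
    [m ^+ k], while by [poincare] the density on the next shell decays faster than any such power,
    so the contributions are dominated by a geometric series. *)
Lemma gibbs_setT_lty : (gibbs lambda setT < +oo)%E.
Proof.
have [m [m0 hm]] : exists m : nat, (0 < m)%N /\ forall r : R, 0 < r ->
    (lambda (B (2 * r)%R) <= m%:R%:E * lambda (B r))%E.
  have [m hm] := haar_cover_ball hlambda; exists m.+1; split => // r r0.
  by apply: le_trans (hm r r0) _; rewrite lee_wpmul2r// lee_fin ler_nat.
have N0 : 0 < N%:R :> R by rewrite ltr0n.
pose c : R := (2 * N%:R ^+ 2)^-1.
have c0 : 0 < c by rewrite invr_gt0 mulr_gt0// exprn_gt0.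
(* Chosen so that [4 ^+ p >= 2 * m]: the decay [(c * 4 ^+ k) ^- p] then beats [m ^+ k] with a spare
   factor [2 ^- k]. *)
pose p := (2 * m).+1.
pose b0 := fine (lambda (B 1)).
have b0E : lambda (B 1) = b0%:E.
  by rewrite fineK// ge0_fin_numE// (haar_ball_lty hlambda).
have b00 : 0 <= b0 by rewrite fine_ge0.
have bk k : (lambda (B (2 ^+ k)%R) <= (m%:R ^+ k * b0)%:E)%E.
  elim: k => [|k IH]; first by rewrite !expr0 b0E mul1r.
  rewrite exprS; apply: le_trans (hm _ _) _; first by rewrite exprn_gt0.
  by rewrite exprS -mulrA EFinM lee_wpmul2l// lee_fin.
pose K : R := p`!%:R * c^-1 ^+ p * m%:R.
have K0 : 0 <= K by rewrite !mulr_ge0 ?ler0n// exprn_ge0// invr_ge0 ltW.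
have rho_shell k l : 2 ^+ k < `|l| -> gibbs_density l * m%:R ^+ k.+1 <= K * 2^-1 ^+ k.
  move=> kl.
  have le : c * 4 ^+ k <= energy l.
    rewrite /c mulrC ler_pdivrMr ?mulr_gt0 ?exprn_gt0// mulrC.
    apply: le_trans (poincare l); rewrite (_ : 4 = 2 ^+ 2 :> R); last by rewrite -natrX.
    by rewrite exprAC ler_pXn2r// ?nnegrE ?exprn_ge0// ltW.
  have y0 : 0 < c * 4 ^+ k by rewrite mulr_gt0// exprn_gt0.
  have := expR_ge1Dxn (2 * m) (ltW y0) => h.
  have rho_le : gibbs_density l <= p`!%:R / (c * 4 ^+ k) ^+ p.
    rewrite /gibbs_density expRN invf_ple ?posrE ?expR_gt0//; last first.
      by rewrite divr_gt0 ?exprn_gt0// ltr0n fact_gt0.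
    rewrite invf_div; apply: (@le_trans _ _ (expR (c * 4 ^+ k))).
      by apply: le_trans h; rewrite lerDr.
    by rewrite ler_expR.
  have two_m : 2 * m%:R <= 4 ^+ p :> R.
    by rewrite -natrM -natrX ler_nat ltnW// (leq_trans (ltnSn _))// ltnW// ltn_expl.
  apply: (@le_trans _ _ (p`!%:R / (c * 4 ^+ k) ^+ p * m%:R ^+ k.+1)).
    by rewrite ler_wpM2r// exprn_ge0.
  rewrite exprMn invfM -exprVn exprS /K -!mulrA; do 2 rewrite ler_wpM2l ?ler0n ?exprn_ge0 ?invr_ge0 ?(ltW c0)//.
  rewrite mulrCA ler_wpM2l ?ler0n// mulrC ler_pdivrMr ?exprn_gt0//.
  rewrite mulrC exprAC exprVn ler_pdivlMr ?exprn_gt0// -exprMn mulrC.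
  by rewrite lerXn2r// nnegrE ?mulr_ge0 ?exprn_ge0.
have mrho : measurable_fun setT (EFin \o @gibbs_density R n).
  apply/measurable_EFinP; apply: smooth_measurable; apply: elementary_smooth.
  exact: elem_gibbs_density.
have mB r : measurable (B r) := measurable_sz_ball r.
pose a k := (\int[lambda]_(l in B (2 ^+ k)%R) (gibbs_density l)%:E)%E.
(* The last factor is the partial sum of [2 ^- j] over [j < k]. *)
have ak k : (a k <= (b0 + K * b0 * (2 - 2 * 2^-1 ^+ k))%:E)%E.
  elim: k => [|k IH].
    rewrite expr0 mulr1 subrr mulr0 addr0 -b0E /a expr0.
    rewrite -[leRHS]mul1e -integral_cst//; apply: ge0_le_integral => //.
    - by move=> l _; rewrite lee_fin ltW// gibbs_density_gt0.
    - exact: measurable_funTS.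
    - by move=> l _; rewrite lee_fin gibbs_density_le1.
  have incl : B (2 ^+ k) `<=` B (2 ^+ k.+1).
    by move=> l /= /le_trans; apply; rewrite exprS ler_peMl ?exprn_ge0// ler1n.
  have -> : a k.+1 = (a k + \int[lambda]_(l in B (2 ^+ k.+1)%R `\` B (2 ^+ k)%R) (gibbs_density l)%:E)%E.
    rewrite /a -ge0_integral_setU//=.
    - by rewrite setDUK.
    - exact: measurableD.
    - exact: measurable_funTS.
    - by move=> l _; rewrite lee_fin ltW// gibbs_density_gt0.
    - by apply/disj_setPS => l [h1 []].
  have -> : b0 + K * b0 * (2 - 2 * 2^-1 ^+ k.+1) =
      b0 + K * b0 * (2 - 2 * 2^-1 ^+ k) + K * b0 * 2^-1 ^+ k.
    by rewrite exprS; field.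
  rewrite EFinD; apply: leeD => //.
  have mm : 0 < m%:R ^+ k.+1 :> R by rewrite exprn_gt0// ltr0n.
  apply: (@le_trans _ _ (\int[lambda]_(l in B (2 ^+ k.+1)%R `\` B (2 ^+ k)%R)
      (K * 2^-1 ^+ k / m%:R ^+ k.+1)%:E)%E).
    apply: ge0_le_integral => //.
    - exact: measurableD.
    - by move=> l _; rewrite lee_fin ltW// gibbs_density_gt0.
    - exact: measurable_funTS.
    - move=> l [_ /negP]; rewrite -ltNge => h.
      by rewrite lee_fin ler_pdivlMr// rho_shell.
  rewrite integral_cst; last exact: measurableD.
  apply: (@le_trans _ _ ((K * 2^-1 ^+ k / m%:R ^+ k.+1)%:E * (m%:R ^+ k.+1 * b0)%:E)%E).
    apply: lee_wpmul2l; first by rewrite lee_fin divr_ge0 ?mulr_ge0 ?exprn_ge0 ?invr_ge0 ?ler0n.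
    apply: (le_trans _ (bk k.+1)); apply: le_measure.
    - by rewrite inE; exact: measurableD.
    - by rewrite inE; exact: mB.
    - exact: subDsetl.
  by rewrite -EFinM lee_fin le_eqVlt; apply/orP; left; apply/eqP; field; rewrite gt_eqF// ltr0n.
have cvga : a k @[k --> \oo] --> (\int[lambda]_(l in \bigcup_k B (2 ^+ k)%R) (gibbs_density l)%:E)%E.
  apply: ge0_nondecreasing_set_cvg_integral => //.
  - move=> i j ij; apply/subsetPset => l /= /le_trans; apply.
    by rewrite ler_weXn2l// ler1n.
  - by move=> k; exact: measurable_funTS.
  - by move=> k l _; rewrite lee_fin ltW// gibbs_density_gt0.
rewrite /gibbs; have -> : [set: S] = \bigcup_k B (2 ^+ k).
  apply/esym; rewrite -subTset => l _; exists (Num.truncn `|l|).+1 => //=.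
  rewrite (le_trans (ltW (real_truncnS_gt _)))// ?num_real//.
  rewrite -natrX ler_nat; exact/ltnW/ltn_expl.
apply: (@le_lt_trans _ _ (b0 + K * b0 * 2)%:E); last by rewrite ltry.
apply: (cvge_le _ cvga); apply: nearW => k; apply: le_trans (ak k) _.
rewrite lee_fin lerD2l; apply: ler_wpM2l; first exact: mulr_ge0.
by rewrite lerBlDr lerDl mulr_ge0// exprn_ge0// invr_ge0.
Qed.

Definition gauss_mass : R := fine (gibbs lambda setT).

Lemma gibbs_setTE : gibbs lambda setT = gauss_mass%:E.
Proof. by rewrite fineK// ge0_fin_numE// gibbs_setT_lty. Qed.

Lemma smooth_gibbs_density : smooth (@gibbs_density R n).
Proof. by apply: elementary_smooth; exact: elem_gibbs_density. Qed.

Lemma measurable_gibbs_density : measurable_fun setT (@gibbs_density R n).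
Proof. by apply: smooth_measurable; exact: smooth_gibbs_density. Qed.

(** A zero integral would force the positive Gibbs density to vanish almost everywhere, making
    [lambda] null. *)
Lemma gauss_mass_gt0 : 0 < gauss_mass.
Proof.
rewrite -lte_fin -gibbs_setTE lt_neqAle measure_ge0 andbT eq_sym.
apply/eqP => h0; have [_ _] := hlambda; apply/negP; rewrite -leNgt.
have h : (\int[lambda]_l `|(gibbs_density l)%:E| = 0)%E.
  rewrite -[RHS]h0; apply: eq_integral => l _.
  by rewrite gee0_abs// lee_fin ltW// gibbs_density_gt0.
have mE : measurable_fun setT (EFin \o @gibbs_density R n).
  by apply/measurable_EFinP; exact: measurable_gibbs_density.
have [A [mA A0 hA]] := (ae_eq_integral_abs lambda measurableT mE).1 h.
rewrite -A0; apply: le_measure; rewrite ?inE//.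
apply: subset_trans hA => l _ /= /(_ I) /eqP.
by rewrite eqe gt_eqF// gibbs_density_gt0.
Qed.

Definition gauss_density l : R := gauss_mass^-1 * gibbs_density l.

Lemma gauss_density_gt0 l : 0 < gauss_density l.
Proof. by rewrite mulr_gt0 ?invr_gt0 ?gauss_mass_gt0 ?gibbs_density_gt0. Qed.

Lemma gauss_density_ge0 l : 0 <= gauss_density l.
Proof. exact/ltW/gauss_density_gt0. Qed.

Lemma smooth_gauss_density : smooth gauss_density.
Proof. by apply: smooth_scale; exact: smooth_gibbs_density. Qed.

Lemma measurable_gauss_density : measurable_fun setT gauss_density.
Proof. by apply: smooth_measurable; exact: smooth_gauss_density. Qed.

Lemma gauss_density_le l : gauss_density l <= gauss_mass^-1.
Proof.
by rewrite /gauss_density ler_piMr ?invr_ge0 ?(ltW gauss_mass_gt0)// gibbs_density_le1.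
Qed.

(** Finite positive mass rules out the junk branch of [mnormalize]. *)
Lemma gaussianE (A : set S) : measurable A ->
  (gaussian lambda A = \int[lambda]_(l in A) (gauss_density l)%:E)%E.
Proof.
move=> mA.
transitivity (if (gibbs lambda setT == 0%E) || (gibbs lambda setT == +oo%E)
  then \d_(0 : S) A else (gibbs lambda A * (fine (gibbs lambda setT))^-1%:E)%E).
  by rewrite /gaussian /= /mnormalize; case: ifPn.
rewrite gibbs_setTE eqe gt_eqF ?gauss_mass_gt0//=.
rewrite /gibbs muleC -ge0_integralZl//; last first.
  by rewrite lee_fin invr_ge0 ltW// gauss_mass_gt0.
by apply: measurable_funTS; apply/measurable_EFinP; exact: measurable_gibbs_density.
Qed.

Local Notation mu := (gaussian lambda).

Lemma Rintegral_gaussian f : measurable_fun setT f ->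
  \int[mu]_x f x = \int[lambda]_x (f x * gauss_density x).
Proof.
exact: (Rintegral_density measurable_gauss_density gauss_density_ge0 gaussianE).
Qed.

Lemma sqint_gaussian f : measurable_fun setT f ->
  (sqint mu f = \int[lambda]_x (f x ^+ 2 * gauss_density x)%:E)%E.
Proof.
exact: (sqint_density measurable_gauss_density gauss_density_ge0 gaussianE).
Qed.

Lemma sqint_gaussian_le f : measurable_fun setT f ->
  (sqint mu f <= gauss_mass^-1%:E * sqint lambda f)%E.
Proof.
move=> mf; rewrite sqint_gaussian// -ge0_integralZl//.
- apply: ge0_integral_mono => x; first by rewrite lee_fin mulr_ge0 ?sqr_ge0 ?gauss_density_ge0.
  by rewrite -EFinM lee_fin mulrC ler_wpM2r ?sqr_ge0 ?gauss_density_le.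
- exact: measurable_sq.
- by move=> x _; rewrite lee_fin sqr_ge0.
- by rewrite lee_fin invr_ge0 ltW// gauss_mass_gt0.
Qed.

Lemma sqint_gaussian_eq0 f : measurable_fun setT f -> sqint lambda f = 0%E ->
  sqint mu f = 0%E.
Proof.
move=> mf f0; apply/eqP; rewrite eq_le sqint_ge0 andbT.
by apply: le_trans (sqint_gaussian_le mf) _; rewrite f0 mule0.
Qed.

Lemma gauss_density_ball_gt r : exists2 c : R, 0 < c &
  forall l, `|l| <= r -> c <= gauss_density l.
Proof.
exists (gauss_mass^-1 * expR (- (2^-1 * \sum_(i < N) (2 * r) ^+ 2))) => [|l lr].
  by rewrite mulr_gt0 ?invr_gt0 ?gauss_mass_gt0 ?expR_gt0.
rewrite ler_wpM2l ?invr_ge0 ?(ltW gauss_mass_gt0)// ler_expR lerN2.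
rewrite ler_wpM2l// ?invr_ge0//; apply: ler_sum => i _.
rewrite -(real_normK (num_real (diffR l i))).
have r0 : 0 <= r by exact: le_trans lr.
rewrite lerXn2r// ?nnegrE ?mulr_ge0// mulr_natl mulr2n.
by rewrite (le_trans (ler_normB _ _))// lerD// (le_trans (coord_le_norm _ _)).
Qed.

(** Together with [sqint_gaussian_le] this makes the two L^2 norms equivalent on functions supported
    in a fixed ball; the constant degenerates as the ball grows. *)
Lemma sqint_lambda_le_gaussian (r : R) : exists2 c : R, 0 < c & forall f,
  measurable_fun setT f -> (forall l, r < `|l| -> f l = 0) ->
  (sqint lambda f <= c%:E * sqint mu f)%E.
Proof.
have [c c0 hc] := gauss_density_ball_gt r.
exists c^-1 => [|g mg gr]; first by rewrite invr_gt0.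
rewrite (sqint_gaussian mg) -ge0_integralZl//.
- apply: ge0_integral_mono => x; first by rewrite lee_fin sqr_ge0.
  rewrite -EFinM lee_fin mulrCA.
  have [xr|/gr ->] := leP `|x| r; last by rewrite expr0n/= mul0r.
  by rewrite ler_peMr ?sqr_ge0// ler_pdivlMl// mulr1 hc.
- apply/measurable_EFinP; apply: measurable_funM; last exact: measurable_gauss_density.
  exact: measurable_funX.
- by move=> x _; rewrite lee_fin mulr_ge0 ?sqr_ge0 ?gauss_density_ge0.
- by rewrite lee_fin invr_ge0 ltW.
Qed.

End GaussianMass.

Section Clamp.
Variable R : realType.

Lemma ler_dist_max (a b c d : R) :
  `|Num.max a b - Num.max c d| <= `|a - c| + `|b - d|.
Proof.
have h1 := ler_norm (a - c); have h2 := ler_norm (b - d).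
have h3 := ler_norm (c - a); have h4 := ler_norm (d - b).
rewrite distrC in h3; rewrite distrC in h4.
rewrite ler_norml; have [ab|ab] := leP a b; have [cd|cd] := leP c d;
  apply/andP; split; lra.
Qed.

(** Truncation to the unit interval, written with maxima only so that its Lipschitz bound is
    [ler_dist_max] applied twice. *)
Definition clamp01 (t : R) : R := Num.max 0 (- Num.max (- 1) (- t)).

Lemma clamp01_itv t : 0 <= clamp01 t <= 1.
Proof. by rewrite /clamp01 le_max lexx/= ge_max ler01/= lerNl le_max lexx. Qed.

Lemma clamp01_le0 t : t <= 0 -> clamp01 t = 0.
Proof.
move=> t0; apply: max_idPl; rewrite oppr_le0 le_max; apply/orP; right.
by rewrite oppr_ge0.
Qed.

Lemma clamp01_ge1 t : 1 <= t -> clamp01 t = 1.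
Proof.
move=> t1; have h : - t <= - 1 by rewrite lerN2.
by rewrite /clamp01 (max_idPl h) opprK (max_idPr ler01).
Qed.

Lemma clamp01_dist s t : `|clamp01 s - clamp01 t| <= `|s - t|.
Proof.
apply: (le_trans (ler_dist_max _ _ _ _)); rewrite subrr normr0 add0r.
rewrite -opprD normrN; apply: (le_trans (ler_dist_max _ _ _ _)).
by rewrite subrr normr0 add0r -opprD normrN.
Qed.

End Clamp.

(** * Density of bounded Lipschitz functions in L^2 of a probability *)

Section LipschitzDensity.
Variables (R : realType) (n : nat).
Local Notation S := (sumzero R n).
Variable mu : probability S R.
Implicit Types (f g h : S -> R) (A : set S).

Definition bounded_lipschitz h := exists2 M : R, 0 <= M &
  (forall x, `|h x| <= M) /\ (forall x y, `|h x - h y| <= M * `|x - y|).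

Lemma bounded_lipschitz_measurable h : bounded_lipschitz h -> measurable_fun setT h.
Proof.
by move=> [M _ [_ hM]]; apply: continuous_measurable; exact: lipschitz_continuous hM.
Qed.

(** The L^2 closure of the bounded Lipschitz functions. It is enlarged below from open sets to Borel
    sets, simple functions and finally all of L^2. *)
Definition approximable f := measurable_fun setT f /\
  forall e : R, 0 < e -> exists2 h, bounded_lipschitz h &
    (sqint mu (fun x => (f x - h x)%R) < e%:E)%E.

Lemma approximable_lipschitz h : bounded_lipschitz h -> approximable h.
Proof.
move=> hh; split; first exact: bounded_lipschitz_measurable.
move=> e e0; exists h => //; rewrite /sqint.
by under eq_integral do rewrite subrr expr0n/=; rewrite integral0 lte_fin.
Qed.

Lemma bounded_lipschitz_cst (c : R) : bounded_lipschitz (fun _ => c).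
Proof.
by exists `|c| => //; split => // x y; rewrite subrr normr0 mulr_ge0.
Qed.

Lemma bounded_lipschitz_add f g : bounded_lipschitz f -> bounded_lipschitz g ->
  bounded_lipschitz (fun x => f x + g x).
Proof.
move=> [M M0 [fM fL]] [K K0 [gK gL]]; exists (M + K); first exact: addr_ge0.
split=> [x|x y]; first by rewrite (le_trans (ler_normD _ _))// lerD.
rewrite opprD addrACA mulrDl (le_trans (ler_normD _ _))// lerD//.
Qed.

Lemma bounded_lipschitz_scale (c : R) f : bounded_lipschitz f ->
  bounded_lipschitz (fun x => c * f x).
Proof.
move=> [M M0 [fM fL]]; exists (`|c| * M); first exact: mulr_ge0.
by split=> [x|x y]; rewrite -?mulrBr normrM -?mulrA ler_wpM2l.
Qed.

Lemma bounded_lipschitz_mul f g : bounded_lipschitz f -> bounded_lipschitz g ->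
  bounded_lipschitz (fun x => f x * g x).
Proof.
move=> [M M0 [fM fL]] [K K0 [gK gL]].
exists (2 * M * K); first by rewrite !mulr_ge0.
split=> [x|x y].
  rewrite normrM (@le_trans _ _ (M * K))//; first by rewrite ler_pM.
  by rewrite ler_wpM2r// ler_peMl// ler1n.
have -> : f x * g x - f y * g y = f x * (g x - g y) + (f x - f y) * g y by ring.
have -> : 2 * M * K * `|x - y| = M * (K * `|x - y|) + M * `|x - y| * K by ring.
by rewrite (le_trans (ler_normD _ _))// !normrM lerD// ler_pM.
Qed.

Lemma bounded_lipschitz_max f g : bounded_lipschitz f -> bounded_lipschitz g ->
  bounded_lipschitz (fun x => Num.max (f x) (g x)).
Proof.
move=> [M M0 [fM fL]] [K K0 [gK gL]]; exists (M + K); first exact: addr_ge0.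
split=> [x|x y]; last first.
  by rewrite mulrDl (le_trans (ler_dist_max _ _ _ _))// lerD.
have := ler_dist_max (f x) (g x) 0 0; rewrite maxxx !subr0 => /le_trans; apply.
by rewrite lerD.
Qed.

Lemma approximable_limit f : measurable_fun setT f ->
  (forall e : R, 0 < e -> exists2 g, approximable g &
     (sqint mu (fun x => (f x - g x)%R) < e%:E)%E) -> approximable f.
Proof.
move=> mf hf; split => // e e0.
have e4 : 0 < e / 4 by rewrite divr_gt0.
have [g [mg hg] fg] := hf _ e4; have [h hh gh] := hg _ e4.
exists h => //.
have -> : (fun x => f x - h x) = (fun x => (f x - g x) + (g x - h x)).
  by apply/funext => x; ring.
apply: sqint_add_lt => //; apply: measurable_funB => //.
exact: bounded_lipschitz_measurable.
Qed.

Lemma approximable_add f g : approximable f -> approximable g ->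
  approximable (fun x => f x + g x).
Proof.
move=> [mf hf] [mg hg]; split; first exact: measurable_funD.
move=> e e0; have e4 : 0 < e / 4 by rewrite divr_gt0.
have [h1 hh1 f1] := hf _ e4; have [h2 hh2 f2] := hg _ e4.
exists (fun x => h1 x + h2 x); first exact: bounded_lipschitz_add.
have -> : (fun x => f x + g x - (h1 x + h2 x)) =
    (fun x => (f x - h1 x) + (g x - h2 x)) by apply/funext => x; ring.
by apply: sqint_add_lt => //; apply: measurable_funB => //;
  exact: bounded_lipschitz_measurable.
Qed.

Lemma approximable_scale (c : R) f : approximable f -> approximable (fun x => c * f x).
Proof.
move=> [mf hf]; split; first exact: measurable_funM.
move=> e e0; have c0 : 0 < c ^+ 2 + 1 by rewrite ltr_wpDl// sqr_ge0.
have [h hh fh] := hf _ (divr_gt0 e0 c0).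
exists (fun x => c * h x); first exact: bounded_lipschitz_scale.
have mfh : measurable_fun setT (fun x => f x - h x).
  by apply: measurable_funB => //; exact: bounded_lipschitz_measurable.
have hle : (sqint mu (fun x => (c * f x - c * h x)%R) <=
    (`|c| ^+ 2)%:E * sqint mu (fun x => (f x - h x)%R))%E.
  by apply: sqint_scale_le => // x; rewrite -mulrBr normrM.
apply: le_lt_trans hle _.
move: fh (sqint_ge0 mu (fun x => f x - h x)).
case: (sqint _ _) => [r| |]//; rewrite lte_fin lee_fin -EFinM lte_fin real_normK ?num_real//.
rewrite ltr_pdivlMr// => fh r0; apply: le_lt_trans fh.
by rewrite mulrC ler_wpM2l// lerDl.
Qed.

Lemma approximable_max f g : approximable f -> approximable g ->
  approximable (fun x => Num.max (f x) (g x)).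
Proof.
move=> [mf hf] [mg hg]; split; first exact: measurable_maxr.
move=> e e0; have e4 : 0 < e / 4 by rewrite divr_gt0.
have [h1 hh1 f1] := hf _ e4; have [h2 hh2 f2] := hg _ e4.
have mh1 := bounded_lipschitz_measurable hh1.
have mh2 := bounded_lipschitz_measurable hh2.
exists (fun x => Num.max (h1 x) (h2 x)); first exact: bounded_lipschitz_max.
apply: (@le_lt_trans _ _ (sqint mu (fun x => (`|f x - h1 x| + `|g x - h2 x|)%R))).
  apply: sqint_le => x; rewrite [leRHS]ger0_norm ?addr_ge0//.
  exact: ler_dist_max.
apply: sqint_add_lt; try (by apply: measurableT_comp => //; exact: measurable_funB).
- by apply: le_lt_trans f1; apply: sqint_le => x; rewrite normr_id.
- by apply: le_lt_trans f2; apply: sqint_le => x; rewrite normr_id.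
Qed.

Lemma L2_bounded f (M : R) : measurable_fun setT f -> (forall x, `|f x| <= M) ->
  L2 mu f.
Proof.
move=> mf fM; apply/L2P; split => //.
apply: (@le_lt_trans _ _ ((M ^+ 2)%:E)); last by rewrite ltry.
apply: (@le_trans _ _ (\int[mu]_x (M ^+ 2)%:E)%E).
  apply: ge0_integral_mono => x; first by rewrite lee_fin sqr_ge0.
  rewrite lee_fin -(real_normK (num_real (f x))) lerXn2r ?nnegrE//.
  exact: le_trans (fM x).
by rewrite integral_cst//= probability_setT mule1.
Qed.

Lemma approximable_cvg (f_ : nat -> S -> R) f (g : S -> R) :
  (forall k, approximable (f_ k)) -> measurable_fun setT f ->
  (forall x, f_ k x @[k --> \oo] --> f x) ->
  L2 mu g -> (forall k x, `|f x - f_ k x| <= g x) -> approximable f.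
Proof.
move=> hf mf fc Lg fg; apply: approximable_limit => // e e0.
have h : sqint mu (fun x => f x - f_ k x) @[k --> \oo] --> 0%E.
  apply: (@sqint_cvg_dominated _ _ _ mu (fun k x => f x - f_ k x) g) => //.
    by move=> k; apply: measurable_funB => //; case: (hf k).
  by move=> x; rewrite -(subrr (f x)); apply: cvgB; [exact: cvg_cst|exact: fc].
have [k _ /(_ k (leqnn k)) hk] := near_sqint_lt e0 h (fun k => sqint_ge0 _ _).
by exists (f_ k).
Qed.

(** The truncations of [k] times the distance to the complement are Lipschitz and converge to the
    indicator as [k] grows. *)
Lemma approximable_open A : open A -> approximable (\1_A).
Proof.
(* The full set is treated apart, since the distance to an empty complement would be
   [inf set0 = 0]. *)
move=> oA; have [->|[x0 Ax0]] : A = setT \/ exists x, ~ A x.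
  have [h|/existsNP[x hx]] := pselect (forall x, A x); last by right; exists x.
  by left; apply/seteqP; split.
- by rewrite indicT; apply: approximable_lipschitz; exact: bounded_lipschitz_cst.
pose E x : set R := [set `|x - y| | y in ~` A].
have lE x : has_lbound (E x) by exists 0 => _ [y _ <-].
have nE x : nonempty (E x) by exists `|x - x0|, x0.
pose dist x := inf (E x).
have d0 x : 0 <= dist x by apply: lb_le_inf => // _ [y _ <-].
have dL x x' : dist x <= dist x' + `|x - x'|.
  rewrite -lerBlDr; apply: lb_le_inf => // _ [y Ay <-].
  rewrite lerBlDr; apply: (@le_trans _ _ `|x - y|).
    by apply: (ge_inf (lE x)); exists y.
  by rewrite (addrC `|x' - y|) -[x - y](subrKA x') ler_normD.
have dA x : ~ A x -> dist x = 0.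
  move=> Ax; apply/eqP; rewrite eq_le d0 andbT; apply: (ge_inf (lE x)).
  by exists x; rewrite ?subrr ?normr0.
have dpos x : A x -> 0 < dist x.
  move=> Ax; have /nbhs_ballP[e /= e0 he] : nbhs x A by apply: open_nbhs_nbhs.
  apply: (lt_le_trans e0); apply: lb_le_inf => // _ [y Ay <-].
  rewrite leNgt; apply/negP => xy; apply: Ay; apply: he.
  by rewrite -ball_normE.
have ddist x y : `|dist x - dist y| <= `|x - y|.
  rewrite ler_norml; apply/andP; split; last by rewrite lerBlDl dL.
  by rewrite lerNl opprB lerBlDl distrC dL.
pose h (k : nat) x := clamp01 (k%:R * dist x).
have h01 k x : 0 <= h k x <= 1 by exact: clamp01_itv.
have hlip k : bounded_lipschitz (h k).
  exists (k%:R + 1); first by rewrite addr_ge0.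
  split=> [x|x y].
    by have /andP[h0 h1] := h01 k x; rewrite ger0_norm// (le_trans h1)// lerDr.
  apply: (le_trans (clamp01_dist _ _)).
  rewrite -mulrBr normrM normr_nat mulrDl mul1r.
  by rewrite ler_wpDr//; apply: ler_wpM2l.
apply: (@approximable_cvg h _ (fun _ => 1)).
- by move=> k; exact: approximable_lipschitz.
- by apply: measurable_indic; exact: sub_sigma_algebra.
- move=> x; have [Ax|Ax] := pselect (A x); last first.
    rewrite indicE memNset//; apply: cvg_near_cst; apply: nearW => k.
    by rewrite /h dA// mulr0 clamp01_le0.
  rewrite indicE mem_set//; apply: cvg_near_cst.
  exists (Num.truncn (dist x)^-1).+1 => //= k ik.
  rewrite /h clamp01_ge1//.
  rewrite -ler_pdivrMr ?dpos// mul1r (le_trans (ltW (real_truncnS_gt _))) ?num_real//.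
  by rewrite ler_nat.
- by apply: (@L2_bounded _ 1) => // x; rewrite normr1.
- move=> k x; have /andP[h0 h1] := h01 k x; rewrite ler_norml indicE.
  by case: (_ \in _) => /=; apply/andP; split; lra.
Qed.

(** The sets with approximable indicator form a sigma-algebra containing the open sets. Stability of
    [approximable] under maxima gives finite unions. *)
Lemma approximable_measurable A : measurable A -> approximable (\1_A).
Proof.
pose K := [set A | measurable A /\ approximable (\1_A : S -> R)].
suff : @measurable _ S `<=` K by move=> /(_ A) + /[dup] mA => /[apply] -[].
have KC B : K B -> K (~` B).
  move=> [mB aB]; split; first exact: measurableC.
  have -> : \1_(~` B) = (fun x => (fun _ => 1) x + (- 1) * \1_B x) :> (S -> R).
    by apply/funext => x; rewrite !indicE in_setC; case: (_ \in _) => /=; ring.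
  apply: approximable_add; last exact: approximable_scale.
  by apply: approximable_lipschitz; exact: bounded_lipschitz_cst.
have K0 : K set0.
  split => //; rewrite indic0; apply: approximable_lipschitz.
  exact: bounded_lipschitz_cst.
have KU B C : K B -> K C -> K (B `|` C).
  move=> [mB aB] [mC aC]; split; first exact: measurableU.
  have -> : \1_(B `|` C) = (fun x => Num.max (\1_B x) (\1_C x)) :> (S -> R).
    apply/funext => x; rewrite !indicE in_setU.
    by case: (x \in B) => /=; case: (x \in C) => /=; rewrite ?maxxx ?(max_idPl ler01) ?(max_idPr ler01).
  exact: approximable_max.
apply: smallest_sub; last first.
  by move=> B oB; split; [exact: sub_sigma_algebra|exact: approximable_open].
split => // [B|B KB].
  by rewrite setTD; exact: KC.
have mB k : measurable (B k) by case: (KB k).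
have mU : measurable (\bigcup_k B k) by exact: bigcup_measurable.
split => //.
(* Indicators of the increasing finite unions converge pointwise to that of the countable union,
   dominated by the constant 1. *)
pose U k := \big[setU/set0]_(i < k) B i.
have KUk k : K (U k).
  elim: k => [|k IH]; first by rewrite /U big_ord0.
  by rewrite /U big_ord_recr/=; exact: KU.
have UE k x : U k x <-> exists2 i, (i < k)%N & B i x.
  by rewrite /U -bigcup_mkord; split => -[i /= ik Bi]; exists i.
apply: (@approximable_cvg (fun k => \1_(U k)) _ (fun _ => 1)).
- by move=> k; case: (KUk k).
- exact: measurable_indic.
- move=> x; rewrite [X in _ --> X]indicE.
  have [[i _ Bi]|nB] := pselect ((\bigcup_k B k) x); last first.
    rewrite memNset//; apply: cvg_near_cst; apply: nearW => k.
    rewrite indicE memNset// => /UE[i _ Bi]; apply: nB; by exists i.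
  rewrite mem_set; last by exists i.
  apply: cvg_near_cst; exists i.+1 => //= k ik.
  by rewrite indicE mem_set//; apply/UE; exists i.
- by apply: (@L2_bounded _ 1) => // x; rewrite normr1.
- move=> k x; rewrite ler_norml !indicE.
  by case: (_ \in _); case: (_ \in _) => /=; apply/andP; split; lra.
Qed.

Import HBNNSimple.

Lemma approximable_nnsfun (f : {nnsfun S >-> R}) : approximable f.
Proof.
have -> : (f : S -> R) = (fun x => \sum_(y <- finmap.enum_fset (fset_set (range f)))
    (y * \1_(f @^-1` [set y]) x)).
  by apply/funext => x; rewrite fimfunE fsbig_finite.
elim: (finmap.enum_fset _) => [|i r IH].
  under eq_fun do rewrite big_nil; apply: approximable_lipschitz.
  exact: bounded_lipschitz_cst.
under eq_fun do rewrite big_cons; apply: approximable_add => //.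
by apply: approximable_scale; exact: approximable_measurable.
Qed.

Lemma approximable_ge0 f : L2 mu f -> (forall x, 0 <= f x) -> approximable f.
Proof.
move=> Lf f0; have mf := L2_measurable Lf.
have mEf : measurable_fun setT (EFin \o f) by exact/measurable_EFinP.
pose f_ := nnsfun_approx measurableT mEf.
have cf x : f_ k x @[k --> \oo] --> f x.
  have := @cvg_nnsfun_approx _ _ _ _ measurableT _ mEf (fun x _ => f0 x) x I.
  by move=> /fine_cvgP[].
have f_le k x : f_ k x <= f x.
  have nd : nondecreasing_seq (f_ ^~ x).
    by move=> i j ij; exact/lefP/nd_nnsfun_approx.
  by have := nondecreasing_cvgn_le nd (cvgP _ (cf x)) k; rewrite (cvg_lim _ (cf x)).
apply: (@approximable_cvg f_ _ f) => //.
- by move=> k; exact: approximable_nnsfun.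
- move=> k x; rewrite ger0_norm ?subr_ge0// lerBlDr lerDl.
  exact: fun_ge0.
Qed.

Lemma approximable_L2 f : L2 mu f -> approximable f.
Proof.
move=> Lf; have mf := L2_measurable Lf.
have La : L2 mu (fun x => `|f x|).
  apply/L2P; split; first exact: measurableT_comp.
  have /L2P[_] := Lf; apply: le_lt_trans.
  by apply: sqint_le => x; rewrite normr_id.
have -> : f = (fun x => (2^-1 * (`|f x| + f x)) + (- 1) * (2^-1 * (`|f x| + (- 1) * f x))).
  by apply/funext => x; field.
apply: approximable_add; last (apply: approximable_scale).
- apply: approximable_ge0; first by apply: L2_scale; exact: L2_add.
  by move=> x; rewrite mulr_ge0// -lerBlDr sub0r -normrN ler_norm.
- apply: approximable_ge0; first by apply/L2_scale/L2_add => //; exact: L2_scale.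
  by move=> x; rewrite mulr_ge0// mulN1r subr_ge0 ler_norm.
Qed.

End LipschitzDensity.

(** * Convolution and mollification *)

Section Tonelli.
Context d (T : measurableType d) (R : realType).
Variable m : {measure set T -> \bar R}.
Hypothesis sf : sigma_finite setT m.
Variable f : T * T -> \bar R.
Hypotheses (mf : measurable_fun setT f) (f0 : forall z, (0 <= f z)%E).

(** [m] carries only a measure structure, so its sigma-finiteness is packed into a new structure
    [m'] that is then identified with [m]. *)
Lemma sigma_finite_tonelli :
  (\int[m]_x \int[m]_y f (x, y) = \int[m]_y \int[m]_x f (x, y))%E.
Proof.
pose H1 := isSFinite.Build _ _ _ (Measure.sort m) (sfinite_measure_sigma_finite sf).
pose H2 := isSigmaFinite.Build _ _ _ (Measure.sort m) sf.
pose m' := HB.pack_for (SigmaFiniteMeasure.type T R) (Measure.sort m) H1 H2.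
have mE : m = m' :> {measure set T -> \bar R} by exact: eq_measure.
by rewrite mE; have := @fubini_tonelli _ _ _ _ _ m' m' f mf f0.
Qed.

Lemma sigma_finite_measurable_integral :
  measurable_fun setT (fun x => \int[m]_y f (x, y))%E.
Proof.
pose H1 := isSFinite.Build _ _ _ (Measure.sort m) (sfinite_measure_sigma_finite sf).
pose H2 := isSigmaFinite.Build _ _ _ (Measure.sort m) sf.
pose m' := HB.pack_for (SigmaFiniteMeasure.type T R) (Measure.sort m) H1 H2.
have mE : m = m' :> {measure set T -> \bar R} by exact: eq_measure.
by rewrite mE; have := @measurable_fun_fubini_tonelli_F _ _ _ _ _ m' f mf f0.
Qed.

End Tonelli.

Section Convolution.
Variables (R : realType) (n : nat).
Local Notation S := (sumzero R n).
Local Notation N := (Zp_trunc n).+2.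
Variable lambda : {measure set S -> \bar R}.
Hypothesis hlambda : is_haar lambda.
Implicit Types (f g phi : S -> R) (l v w x y : S).
Local Notation B r := [set l : S | `|l| <= r].

Lemma quadratic_is_derive f l v (a C : R) :
  (forall h : R, `|f (l + h *: v) - f l - h * a| <= C * h ^+ 2) -> is_derive l v f a.
Proof.
move=> hf; apply/is_derive_line.
pose g (h : R) := f (l + h *: v) - f l - h * a.
have dg : is_derive (0 : R) (1 : R) g 0 by apply: quadratic_is_derive0; exact: hf.
have -> : (fun h : R => f (h *: v + l)) = (fun h => g h + (f l + h * a)).
  by apply/funext => h; rewrite /g (addrC l); ring.
by apply: is_derive_eq; rewrite /GRing.scale/=; ring.
Qed.

Lemma integrable_mul_bounded g phi (M : R) : lambda.-integrable setT (EFin \o g) ->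
  measurable_fun setT phi -> (forall x, `|phi x| <= M) ->
  lambda.-integrable setT (EFin \o (fun x => g x * phi x)).
Proof.
move=> ig mphi phiM.
apply: (@le_integrable _ _ _ lambda setT measurableT _ (fun x => M%:E * (EFin \o g) x)%E).
- apply/measurable_EFinP; apply: measurable_funM => //.
  by apply/measurable_EFinP; exact: measurable_int ig.
- move=> x _ /=; rewrite lee_fin !normrM mulrC ler_wpM2r//.
  by rewrite (le_trans (phiM x))// ler_norm.
- exact: integrableZl.
Qed.

Lemma le_norm_integral_mul g phi (M : R) : lambda.-integrable setT (EFin \o g) ->
  measurable_fun setT phi -> (forall x, `|phi x| <= M) ->
  `|\int[lambda]_x (g x * phi x)| <= M * \int[lambda]_x `|g x|.
Proof.
move=> ig mphi phiM; have igp := integrable_mul_bounded ig mphi phiM.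
apply: (le_trans (le_normr_Rintegral measurableT igp)).
rewrite -RintegralZl//; last exact: integrable_norm ig.
apply: le_Rintegral => //.
- exact: integrable_norm igp.
- by have := integrableZl measurableT M (integrable_norm ig).
- by move=> x _; rewrite normrM mulrC ler_wpM2r.
Qed.

Lemma test_reflect phi x : test_function phi -> test_function (fun y => phi (x - y)).
Proof.
move=> tp; have h : (-1 : R) != 0 by rewrite oppr_eq0 oner_eq0.
have := test_affine x h tp.
by under eq_fun do rewrite scaleN1r addrC.
Qed.

Lemma derive_reflect phi x v y : test_function phi ->
  'D_v (fun y => phi (x - y)) y = - 'D_v phi (x - y).
Proof.
move=> tp.
have := is_derive_affine (f := phi) (a := -1) (b := x) (l := y) (v := v)
  (@test_derivable _ _ phi _ _ tp).
have -> : (fun l => phi (-1 *: l + x)) = (fun y => phi (x - y)).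
  by apply/funext => z; rewrite scaleN1r addrC.
by move=> [_ ->]; rewrite mulN1r scaleN1r addrC.
Qed.

Definition conv g phi x : R := \int[lambda]_y (g y * phi (x - y)).

Lemma conv_integrable g phi x : lambda.-integrable setT (EFin \o g) ->
  test_function phi -> lambda.-integrable setT (EFin \o (fun y => g y * phi (x - y))).
Proof.
move=> ig tp; have tr := test_reflect x tp; have [M _ hM] := test_bounded tr.
exact: (integrable_mul_bounded ig (test_measurable tr) hM).
Qed.

Lemma conv_lipschitz g phi : lambda.-integrable setT (EFin \o g) ->
  test_function phi -> exists M, forall x x', `|conv g phi x - conv g phi x'| <= M * `|x - x'|.
Proof.
move=> ig tp; have [M M0 hM] := test_lipschitz tp.
exists (M * \int[lambda]_y `|g y|) => x x'.
rewrite /conv -RintegralB//; [|exact: conv_integrable|exact: conv_integrable].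
under eq_Rintegral do rewrite -mulrBr.
rewrite mulrAC; apply: le_norm_integral_mul => //.
  by apply: measurable_funB; exact: test_measurable (test_reflect _ tp).
by move=> y; apply: le_trans (hM _ _) _; rewrite opprB addrA subrK.
Qed.

(** Differentiation under the integral sign: the Taylor remainder of [phi] is uniform, so that of
    the convolution is at most its constant times the L^1 norm of [g] times [h ^+ 2]. *)
Lemma conv_is_derive g phi x v : lambda.-integrable setT (EFin \o g) ->
  test_function phi -> is_derive x v (conv g phi) (conv g (fun l => 'D_v phi l) x).
Proof.
move=> ig tp; have [M M0 hM] := test_taylor2 v tp; have tD := test_derive v tp.
apply: (@quadratic_is_derive _ _ _ _ (M * \int[lambda]_y `|g y|)) => h.
rewrite /conv -RintegralB//; [|exact: conv_integrable|exact: conv_integrable].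
have i1 : lambda.-integrable setT
    (EFin \o (fun y => g y * phi (x + h *: v - y) - g y * phi (x - y))).
  exact: (integrable_subR (conv_integrable (x + h *: v) ig tp) (conv_integrable x ig tp)).
have i2 : lambda.-integrable setT (EFin \o (fun y => h * (g y * 'D_v phi (x - y)))).
  exact: (integrable_scaleR h (conv_integrable x ig tD)).
rewrite -(RintegralZl h measurableT (conv_integrable x ig tD)).
rewrite -(RintegralB measurableT i1 i2).
have -> : \int[lambda]_y (g y * phi (x + h *: v - y) - g y * phi (x - y) -
      h * (g y * 'D_v phi (x - y))) =
    \int[lambda]_y (g y * (phi (x - y + h *: v) - phi (x - y) - h * 'D_v phi (x - y))).
  by apply: eq_Rintegral => y _; rewrite (addrAC x); ring.
rewrite mulrAC; apply: le_norm_integral_mul => //.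
apply: measurable_funB.
  apply: measurable_funB; last exact: test_measurable (test_reflect _ tp).
  have := test_measurable (test_reflect (x + h *: v) tp).
  by under eq_fun do rewrite addrAC.
by apply: measurable_funM => //; exact: test_measurable (test_reflect _ tD).
Qed.

Lemma conv_smooth g phi : lambda.-integrable setT (EFin \o g) ->
  test_function phi -> smooth (conv g phi).
Proof.
move=> ig tp.
apply: (@smooth_coind _ _ [set f | exists2 psi, test_function psi & f = conv g psi]);
  last by exists phi.
move=> _ [psi tpsi ->]; split => [|v].
  by have [M hM] := conv_lipschitz ig tpsi; exact: lipschitz_continuous hM.
exists (conv g (fun l => 'D_v psi l)).
  by exists (fun l => 'D_v psi l) => //; exact: test_derive.
by move=> l; exact: conv_is_derive.
Qed.

Lemma conv_vanish g phi (r s : R) x : (forall y, r < `|y| -> g y = 0) ->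
  (forall y, s < `|y| -> phi y = 0) -> r + s < `|x| -> conv g phi x = 0.
Proof.
move=> gr ps rsx; transitivity (\int[lambda]_(y in setT) (0 : R)); last by rewrite Rintegral_cst// mul0r.
apply: eq_Rintegral => y _; have [yr|/gr ->] := leP `|y| r; last by rewrite mul0r.
rewrite ps ?mulr0// ltNge; apply/negP => h; move: rsx; rewrite ltNge => /negP; apply.
by rewrite -(subrK y x) (le_trans (ler_normD _ _))// addrC lerD.
Qed.

Lemma conv_test g phi : lambda.-integrable setT (EFin \o g) ->
  bounded_support g -> test_function phi -> test_function (conv g phi).
Proof.
move=> ig [r r0 gr] tp; apply/test_functionP; split; first exact: conv_smooth.
have /test_functionP[_ [s s0 ps]] := tp.
exists (r + s); first exact: addr_gt0.
by move=> x; exact: conv_vanish.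
Qed.

Lemma derive_conv g phi x v : lambda.-integrable setT (EFin \o g) ->
  test_function phi -> 'D_v (conv g phi) x = conv g (fun l => 'D_v phi l) x.
Proof. by move=> ig tp; case: (conv_is_derive x v ig tp). Qed.

(** The weak derivative is tested against the reflected function [phi (x - y)]; the sign produced by
    the reflection cancels the sign in the definition. *)
Lemma derive_conv_weak f g phi x v : lambda.-integrable setT (EFin \o f) ->
  weak_derivative lambda v f g -> test_function phi ->
  'D_v (conv f phi) x = conv g phi x.
Proof.
move=> if_ wfg tp; rewrite derive_conv// /conv.
have := wfg _ (test_reflect x tp).
under eq_Rintegral do rewrite derive_reflect// mulrN.
move=> h; apply: oppr_inj; rewrite -h -mulN1r -RintegralZl//.
- by apply: eq_Rintegral => y _; rewrite mulN1r.
- exact: (conv_integrable x if_ (test_derive v tp)).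
Qed.

End Convolution.

(** * Mollifiers and their convergence in L^2(lambda) *)

Section Mollifier.
Variables (R : realType) (n : nat).
Local Notation S := (sumzero R n).
Local Notation N := (Zp_trunc n).+2.
Variable lambda : {measure set S -> \bar R}.
Hypothesis hlambda : is_haar lambda.
Implicit Types (f g h : S -> R) (l v w x y : S).
Local Notation B r := [set l : S | `|l| <= r].

(** The normalisation at scale [e] stays an integral, because no scaling law for [lambda] under
    dilations has been established. *)
Definition bump_mass (e : R) : R := \int[lambda]_y bump (e^-1 *: y).

Definition mollifier (e : R) (x : S) : R := (bump_mass e)^-1 * bump (e^-1 *: x).

Lemma test_bump_scale (e : R) : 0 < e -> test_function (fun x : S => bump (e^-1 *: x)).
Proof.
move=> e0; have e1 : e^-1 != 0 by rewrite invr_eq0 gt_eqF.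
have := test_affine 0 e1 (@test_bump R n).
by under eq_fun do rewrite addr0.
Qed.

Lemma test_mollifier e : 0 < e -> test_function (mollifier e).
Proof. by move=> e0; apply: test_scale; exact: test_bump_scale. Qed.

Lemma bump_mass_gt0 e : 0 < e -> 0 < bump_mass e.
Proof.
move=> e0; have tb := test_bump_scale e0.
have ib := test_integrable hlambda tb.
rewrite lt_neqAle Rintegral_ge0 ?andbT; last by move=> y _; exact: bump_ge0.
apply/negP => /eqP/esym m0.
have e2 : 0 < e / 2 by rewrite divr_gt0.
have := haar_ball_gt0 hlambda e2; apply/negP; rewrite -leNgt.
have h : (\int[lambda]_y `|(bump (e^-1 *: y))%:E| = 0)%E.
  transitivity ((bump_mass e)%:E); last by rewrite m0.
  rewrite fineK; last exact: (integrable_fin_num measurableT ib).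
  by apply: eq_integral => y _; rewrite gee0_abs// lee_fin bump_ge0.
have mE : measurable_fun setT (EFin \o (fun y : S => bump (e^-1 *: y))).
  by apply/measurable_EFinP; exact: test_measurable.
have [A [mA A0 hA]] := (ae_eq_integral_abs lambda measurableT mE).1 h.
rewrite -A0; apply: le_measure; rewrite ?inE//; first exact: measurable_sz_ball.
apply: subset_trans hA => y /= ye /(_ I) /eqP.
rewrite eqe gt_eqF// bump_gt0// normrZ gtr0_norm ?invr_gt0//.
rewrite ltr_pdivrMl// mulr1 (le_lt_trans ye)// ltr_pdivrMr//; lra.
Qed.

Lemma mollifier_ge0 e x : 0 < e -> 0 <= mollifier e x.
Proof.
by move=> e0; rewrite mulr_ge0 ?bump_ge0// invr_ge0 ltW// bump_mass_gt0.
Qed.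

Lemma mollifier_eq0 e x : 0 < e -> e < `|x| -> mollifier e x = 0.
Proof.
move=> e0 ex; rewrite /mollifier bump_eq0 ?mulr0// normrZ gtr0_norm ?invr_gt0//.
by rewrite ltr_pdivlMl// mulr1.
Qed.

Lemma mollifierN e x : mollifier e (- x) = mollifier e x.
Proof. by rewrite /mollifier scalerN bumpN. Qed.

Lemma integral_mollifier e : 0 < e -> \int[lambda]_y mollifier e y = 1.
Proof.
move=> e0; rewrite RintegralZl//; last exact/(test_integrable hlambda)/test_bump_scale.
by rewrite mulVf// gt_eqF// bump_mass_gt0.
Qed.

Lemma integral_mollifier_l e y : 0 < e -> \int[lambda]_x mollifier e (x - y) = 1.
Proof.
move=> e0; rewrite -(integral_mollifier e0).
by apply: integral_translation => //; exact/(test_integrable hlambda)/test_mollifier.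
Qed.

Lemma integral_mollifier_r e x : 0 < e -> \int[lambda]_y mollifier e (x - y) = 1.
Proof.
move=> e0; rewrite -(integral_mollifier_l x e0); apply: eq_Rintegral => y _.
by rewrite -mollifierN opprB.
Qed.

Lemma ge0_integral_test f : test_function f -> (forall x, 0 <= f x) ->
  (\int[lambda]_x (f x)%:E = (\int[lambda]_x f x)%:E)%E.
Proof.
move=> tf f0; rewrite fineK//; exact: (integrable_fin_num measurableT (test_integrable hlambda tf)).
Qed.

(** Tonelli asks for measurability with respect to the product sigma-algebra, so the function is
    rewritten through the coordinates of both points. *)
Lemma measurable_mollifier_sub e :
  measurable_fun setT (fun z : S * S => mollifier e (z.1 - z.2)).
Proof.
have -> : (fun z : S * S => mollifier e (z.1 - z.2)) = (fun z => (bump_mass e)^-1 *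
  \prod_(i : 'Z_n) flat_exp 0 (1 - (e^-1 * (val z.1 0 i - val z.2 0 i)) *
    (e^-1 * (val z.1 0 i - val z.2 0 i)))).
  apply/funext => z; rewrite /mollifier /bump; congr (_ * _).
  by apply: eq_bigr => i _; rewrite !szcoordZ !szcoordB.
apply: measurable_funM => //.
elim: (index_enum _) => [|i r IH].
  by under eq_fun do rewrite big_nil; exact: measurable_cst.
under eq_fun do rewrite big_cons; apply: measurable_funM => //.
have mc : measurable_fun setT (fun z : S * S => e^-1 * (val z.1 0 i - val z.2 0 i)).
  apply: measurable_funM => //; apply: measurable_funB.
    exact: (measurableT_comp (measurable_sumzero_coord i) measurable_fst).
  exact: (measurableT_comp (measurable_sumzero_coord i) measurable_snd).
apply: (@measurableT_comp _ _ _ _ _ _ (@flat_exp R 0)).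
  by apply: continuous_measurable_fun; exact: flat_exp_continuous.
by apply: measurable_funB => //; exact: measurable_funM.
Qed.

Section SquareIntegrable.
Variables (g : S -> R) (r : R).
Hypothesis Lg : L2 lambda g.
Hypothesis gr : forall x, r < `|x| -> g x = 0.

Let mg : measurable_fun setT g := L2_measurable Lg.

Lemma L2_haar_indic s : L2 lambda (\1_(B s)).
Proof.
have mB := measurable_sz_ball s.
apply/L2P; split; first exact: measurable_indic.
rewrite /sqint (_ : (\int[lambda]_x _ = \int[lambda]_x (\1_(B s) x)%:E)%E).
  by rewrite integral_indic// setIT haar_ball_lty.
by apply: eq_integral => x _; rewrite indicE; case: (_ \in _); rewrite ?expr1n ?expr0n.
Qed.

Lemma L2_support_integrable : lambda.-integrable setT (EFin \o g).
Proof.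
have := L2_mul_integrable Lg (L2_haar_indic r).
congr (_.-integrable _ _); apply/funext => x /=; congr EFin; rewrite indicE.
have [xr|/gr ->] := leP `|x| r; last by rewrite mul0r.
by rewrite mem_set// mulr1.
Qed.

(** The second moment of [g] about [t] under the probability density [mollifier e (x - y)], whose
    mean is the convolution. Expanding the square makes it a quadratic polynomial in [t]. *)
Lemma conv_variance e x (t : R) : 0 < e ->
  (\int[lambda]_y ((g y - t) ^+ 2 * mollifier e (x - y))%:E =
   (\int[lambda]_y (g y ^+ 2 * mollifier e (x - y)) -
    2 * t * conv lambda g (mollifier e) x + t ^+ 2)%:E)%E.
Proof.
move=> e0; have ig := L2_support_integrable.
have ig2 : lambda.-integrable setT (EFin \o (fun y => g y ^+ 2)).
  by have := L2_mul_integrable Lg Lg.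
have tm := test_mollifier e0.
have i1 := conv_integrable x ig tm.
have i2 := conv_integrable x ig2 tm.
have i0 := test_integrable hlambda (test_reflect x tm).
have i3 := integrable_scaleR (2 * t) i1.
have i4 := integrable_scaleR (t ^+ 2) i0.
have i5 := integrable_addR (integrable_subR i2 i3) i4.
have E y : (g y - t) ^+ 2 * mollifier e (x - y) =
    g y ^+ 2 * mollifier e (x - y) - 2 * t * (g y * mollifier e (x - y)) +
    t ^+ 2 * mollifier e (x - y) by ring.
under eq_integral do rewrite E.
rewrite -[LHS]fineK; last exact: (integrable_fin_num measurableT i5).
congr EFin; rewrite -/(Rintegral _ _ _).
rewrite (RintegralD measurableT (integrable_subR i2 i3) i4).
rewrite (RintegralB measurableT i2 i3).
rewrite (RintegralZl _ measurableT i1) (RintegralZl _ measurableT i0).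
by rewrite integral_mollifier_r// mulr1.
Qed.

(** Jensen's inequality: the second moment about [g x] exceeds the squared distance from the mean to
    [g x] by the variance, which is nonnegative. *)
Lemma sqr_conv_sub_le e x : 0 < e ->
  (((conv lambda g (mollifier e) x - g x) ^+ 2)%:E <=
   \int[lambda]_y ((g y - g x) ^+ 2 * mollifier e (x - y))%:E)%E.
Proof.
move=> e0; rewrite conv_variance// lee_fin.
set c := conv _ _ _ _; have := @conv_variance e x c e0; rewrite -/c => h.
have : (0 <= \int[lambda]_y ((g y - c) ^+ 2 * mollifier e (x - y))%:E)%E.
  by apply: integral_ge0 => y _; rewrite lee_fin mulr_ge0 ?sqr_ge0 ?mollifier_ge0.
rewrite h lee_fin; set I := Rintegral _ _ _ => h0.
rewrite -subr_ge0 (_ : _ - _ = I - 2 * c * c + c ^+ 2)//; ring.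
Qed.

(** Split [g y - g x] through a Lipschitz approximation [h]. The two terms in [g - h] each
    contribute three times its squared norm, one of them by Tonelli; the increment of [h] is at most
    [L * e] over the reach of the mollifier. *)
Lemma sqint_conv_sub_le e h (L s : R) : 0 < e -> e <= 1 -> 0 <= L ->
  measurable_fun setT h -> (forall x y, `|h x - h y| <= L * `|x - y|) ->
  (forall x, s < `|x| -> h x = 0) ->
  (sqint lambda (fun x => (conv lambda g (mollifier e) x - g x)%R) <=
   6%:E * sqint lambda (fun x => (g x - h x)%R) +
   (3 * (L * e) ^+ 2)%:E * lambda (B (s + 1)%R))%E.
Proof.
move=> e0 e1 L0 mh hL hs.
set D := sqint lambda (fun x => (g x - h x)%R).
have mgh : measurable_fun setT (fun x => g x - h x) by exact: measurable_funB.
have mB := measurable_sz_ball (s + 1).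
pose F1 x := (\int[lambda]_y ((g y - h y) ^+ 2 * mollifier e (x - y))%:E)%E.
(* The increment of [h] matters only on the ball of radius [s + 1], because [h] vanishes beyond [s]
   and the mollifier reaches at most [e <= 1]. *)
pose F2 x : R := 3 * (L * e) ^+ 2 * \1_(B (s + 1)) x + 3 * (g x - h x) ^+ 2.
have I0 x : 0 <= \1_(B (s + 1)) x :> R by rewrite indicE ler0n.
have F20 x : 0 <= F2 x by apply: addr_ge0; apply: mulr_ge0; rewrite ?I0 ?sqr_ge0// mulr_ge0 ?sqr_ge0.
have mmol (x : S) : measurable_fun setT (fun y => mollifier e (x - y)).
  by apply: test_measurable; apply: test_reflect; exact: test_mollifier.
have joint : measurable_fun setT
    (fun z : S * S => ((g z.2 - h z.2) ^+ 2 * mollifier e (z.1 - z.2))%:E).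
  apply/measurable_EFinP; apply: measurable_funM; last exact: measurable_mollifier_sub.
  by apply: measurable_funX; exact: (measurableT_comp mgh measurable_snd).
have joint0 (z : S * S) : (0 <= ((g z.2 - h z.2) ^+ 2 * mollifier e (z.1 - z.2))%:E)%E.
  by rewrite lee_fin mulr_ge0 ?sqr_ge0 ?mollifier_ge0.
have mF1 : measurable_fun setT F1.
  exact: (sigma_finite_measurable_integral (haar_sigma_finite hlambda) joint joint0).
have F10 x : (0 <= F1 x)%E.
  by apply: integral_ge0 => y _; exact: (joint0 (x, y)).
have intF1 : (\int[lambda]_x F1 x = D)%E.
  have := sigma_finite_tonelli (haar_sigma_finite hlambda) joint joint0 => /= ->.
  apply: eq_integral => y _.
  under eq_integral do rewrite EFinM.
  rewrite ge0_integralZl_EFin ?sqr_ge0//; last 2 first.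
  - by move=> x _; rewrite lee_fin mollifier_ge0.
  - apply/measurable_EFinP; have := measurableT_comp (test_measurable (test_mollifier e0))
      (measurable_translation (- y)); exact.
  rewrite -[RHS]mule1; congr (_ * _)%E.
  have tr := test_translation (- y) (test_mollifier e0).
  by rewrite ge0_integral_test// ?integral_mollifier_l// => x; exact: mollifier_ge0.
have ptw x y : (g y - g x) ^+ 2 * mollifier e (x - y) <=
    3 * ((g y - h y) ^+ 2 * mollifier e (x - y)) + F2 x * mollifier e (x - y).
  have m0 := mollifier_ge0 (x - y) e0.
  have [xy|xy] := leP `|x - y| e; last by rewrite mollifier_eq0// !mulr0 addr0.
  rewrite mulrA -mulrDl ler_wpM2r//.
  have hxy : (h y - h x) ^+ 2 <= (L * e) ^+ 2 * \1_(B (s + 1)) x.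
    rewrite indicE; have [xs|xs] := leP `|x| (s + 1).
      rewrite mem_set// mulr1 -(real_normK (num_real (h y - h x))) distrC.
      have hLe : `|h x - h y| <= L * e by apply: le_trans (hL x y) _; rewrite ler_wpM2l.
      by rewrite lerXn2r ?nnegrE// (le_trans _ hLe).
    rewrite memNset/=; last by rewrite leNgt xs.
    rewrite mulr0 !hs ?subrr ?expr0n//; first by rewrite (le_lt_trans _ xs)// lerDl.
    rewrite ltNge; apply/negP => ys; move: xs; rewrite ltNge => /negP; apply.
    by rewrite -(subrK y x) (le_trans (ler_normD _ _))// addrC lerD// (le_trans xy).
  rewrite /F2; move: hxy; set I := \1_ _ _ => hxy.
  have := sqr_ge0 ((g y - h y) - (h y - h x)).
  have := sqr_ge0 ((g y - h y) + (g x - h x)).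
  have := sqr_ge0 ((h y - h x) + (g x - h x)).
  nra.
have step x : (((conv lambda g (mollifier e) x - g x) ^+ 2)%:E <=
    3%:E * F1 x + (F2 x)%:E)%E.
  apply: le_trans (sqr_conv_sub_le x e0) _.
  have m1 : measurable_fun setT (fun y => ((g y - h y) ^+ 2 * mollifier e (x - y))%:E).
    by apply/measurable_EFinP; apply: measurable_funM => //; exact: measurable_funX.
  have m2 : measurable_fun setT (fun y => (mollifier e (x - y))%:E).
    exact/measurable_EFinP.
  apply: (@le_trans _ _ (\int[lambda]_y (3%:E * ((g y - h y) ^+ 2 * mollifier e (x - y))%:E +
      (F2 x)%:E * (mollifier e (x - y))%:E))%E).
    apply: ge0_integral_mono => y.
      by rewrite lee_fin mulr_ge0 ?sqr_ge0 ?mollifier_ge0.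
    by rewrite -!EFinM -EFinD lee_fin ptw.
  rewrite ge0_integralD//; last 4 first.
  - by move=> y _; rewrite mule_ge0 ?lee_fin// mulr_ge0 ?sqr_ge0 ?mollifier_ge0.
  - exact: measurable_funeM.
  - by move=> y _; rewrite mule_ge0 ?lee_fin ?mollifier_ge0.
  - exact: measurable_funeM.
  rewrite !ge0_integralZl_EFin//; last first.
  - by move=> y _; rewrite lee_fin mulr_ge0 ?sqr_ge0 ?mollifier_ge0.
  - by move=> y _; rewrite lee_fin mollifier_ge0.
  rewrite [X in (_ + _ * X)%E](ge0_integral_test (test_reflect x (test_mollifier e0))).
    by rewrite integral_mollifier_r// mule1.
  by move=> y; exact: mollifier_ge0.
apply: (@le_trans _ _ (\int[lambda]_x (3%:E * F1 x + (F2 x)%:E))%E).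
  by apply: ge0_integral_mono => x; first by rewrite lee_fin sqr_ge0.
have mF2 : measurable_fun setT (EFin \o F2).
  apply/measurable_EFinP; apply: measurable_funD; apply: measurable_funM => //.
  exact: measurable_funX.
rewrite ge0_integralD//; last 3 first.
- by move=> x _; rewrite mule_ge0.
- exact: measurable_funeM.
- by move=> x _; rewrite lee_fin.
rewrite ge0_integralZl_EFin// intF1.
have -> : (\int[lambda]_x (F2 x)%:E = (3 * (L * e) ^+ 2)%:E * lambda (B (s + 1)%R) + 3%:E * D)%E.
  under eq_integral do rewrite EFinD.
  rewrite ge0_integralD//; last 4 first.
  - by move=> x _; rewrite lee_fin mulr_ge0 ?I0// mulr_ge0 ?sqr_ge0.
  - by apply/measurable_EFinP; apply: measurable_funM.
  - by move=> x _; rewrite lee_fin mulr_ge0 ?sqr_ge0.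
  - by apply/measurable_EFinP; apply: measurable_funM => //; exact: measurable_funX.
  congr (_ + _)%E.
    under eq_integral do rewrite EFinM.
    rewrite ge0_integralZl_EFin//; last 2 first.
    - exact/measurable_EFinP.
    - by rewrite mulr_ge0 ?sqr_ge0.
    by rewrite integral_indic// setIT.
  under eq_integral do rewrite EFinM.
  rewrite ge0_integralZl_EFin//.
  - by move=> x _; rewrite lee_fin sqr_ge0.
  - exact: measurable_sq.
rewrite addeCA addeC.
have -> : (6%:E * D = 3%:E * D + 3%:E * D)%E.
  rewrite -ge0_muleDl ?lee_fin// -EFinD; congr (_%:E * _)%E; ring.
by rewrite addeC.
Qed.

End SquareIntegrable.

(** Lipschitz density is available for the probability [gaussian lambda]. A Lipschitz cutoff
    confines the approximation to a ball, on which the norm of L^2(lambda) is controlled by that of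
    L^2(mu). *)
Lemma haar_lipschitz_dense g (r : R) : L2 lambda g ->
  (forall x, r < `|x| -> g x = 0) -> forall e : R, 0 < e ->
  exists h, [/\ bounded_lipschitz h, forall x, r + 1 < `|x| -> h x = 0 &
    (sqint lambda (fun x => (g x - h x)%R) < e%:E)%E].
Proof.
move=> Lg gr e e0; have mg := L2_measurable Lg.
have Lmu : L2 (gaussian lambda) g.
  apply/L2P; split => //; have /L2P[_ g2] := Lg.
  apply: le_lt_trans (sqint_gaussian_le hlambda mg) _.
  by rewrite lte_mul_pinfty// lee_fin invr_ge0 ltW// gauss_mass_gt0.
have [c c0 hc] := sqint_lambda_le_gaussian hlambda (r + 1).
have [_ /(_ _ (divr_gt0 e0 c0))[h0 hh0 gh0]] := approximable_L2 Lmu.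
pose th (x : S) : R := clamp01 (r + 1 - `|x|).
have th01 x : 0 <= th x <= 1 by exact: clamp01_itv.
have hth : bounded_lipschitz th.
  exists 1 => //; split => [x|x y].
    by have /andP[t0 t1] := th01 x; rewrite ger0_norm.
  apply: (le_trans (clamp01_dist _ _)); rewrite mul1r opprB addrC addrA subrK.
  by rewrite distrC (le_trans (ler_dist_dist _ _)).
have th0 x : r + 1 < `|x| -> th x = 0.
  by move=> xr; rewrite /th clamp01_le0// subr_le0 ltW.
have th1 x : `|x| <= r -> th x = 1.
  by move=> xr; rewrite /th clamp01_ge1// lerBrDr addrC lerD2r.
have mh0 := bounded_lipschitz_measurable hh0.
have mth := bounded_lipschitz_measurable hth.
exists (fun x => th x * h0 x); split.
- exact: bounded_lipschitz_mul.
- by move=> x /th0 ->; rewrite mul0r.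
have E x : g x - th x * h0 x = th x * (g x - h0 x).
  by have [/th1 ->|/gr ->] := leP `|x| r; ring.
have mgh : measurable_fun setT (fun x => g x - th x * h0 x).
  by apply: measurable_funB => //; exact: measurable_funM.
apply: le_lt_trans (hc _ mgh _) _.
  by move=> x xr; rewrite E th0 ?mul0r.
have hle : (sqint (gaussian lambda) (fun x => (g x - th x * h0 x)%R) <=
    sqint (gaussian lambda) (fun x => (g x - h0 x)%R))%E.
  apply: sqint_le => x; rewrite E normrM; have /andP[t0 t1] := th01 x.
  by rewrite ger0_norm// ler_piMl.
apply: (@le_lt_trans _ _ (c%:E * sqint (gaussian lambda) (fun x => (g x - h0 x)%R))%E).
  by rewrite lee_wpmul2l// lee_fin ltW.
move: gh0 (sqint_ge0 (gaussian lambda) (fun x => g x - h0 x)).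
case: (sqint _ _) => [q| |]//; rewrite lte_fin lee_fin => qe q0.
by rewrite -EFinM lte_fin mulrC -ltr_pdivlMr.
Qed.

Lemma mollifier_cvg g (r : R) : L2 lambda g -> (forall x, r < `|x| -> g x = 0) ->
  forall e : R, 0 < e -> exists2 d : R, 0 < d & forall t, 0 < t -> t <= d ->
  (sqint lambda (fun x => (conv lambda g (mollifier t) x - g x)%R) < e%:E)%E.
Proof.
move=> Lg gr e e0.
(* Six times this is [e / 2]; the other half of [e] pays for the Lipschitz term, bounded by
   [K * t]. *)
have e12 : 0 < e / 12 by rewrite divr_gt0.
have [h [[L L0 [hM hL]] hs gh]] := haar_lipschitz_dense Lg gr e12.
have mh : measurable_fun setT h.
  by apply: continuous_measurable; exact: lipschitz_continuous hL.
pose b := fine (lambda (B (r + 1 + 1))).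
have bE : lambda (B (r + 1 + 1)) = b%:E.
  by rewrite fineK// ge0_fin_numE// haar_ball_lty.
have b0 : 0 <= b by rewrite fine_ge0.
pose K := 3 * L ^+ 2 * b + 1.
have K0 : 0 < K by rewrite ltr_wpDl// !mulr_ge0// sqr_ge0.
exists (Num.min 1 (e / (2 * K))).
  by rewrite lt_min ltr01 divr_gt0// mulr_gt0.
move=> t t0; rewrite le_min => /andP[t1 tK].
apply: le_lt_trans (sqint_conv_sub_le Lg gr t0 t1 L0 mh hL hs) _.
move: gh (sqint_ge0 lambda (fun x => g x - h x)).
case: (sqint _ _) => [q| |]//; rewrite lte_fin lee_fin => qe q0.
rewrite bE -!EFinM -EFinD lte_fin.
have h1 : 3 * (L * t) ^+ 2 * b <= K * t.
  have -> : 3 * (L * t) ^+ 2 * b = (3 * L ^+ 2 * b) * t * t by ring.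
  apply: (@le_trans _ _ (3 * L ^+ 2 * b * t)).
    by rewrite ler_piMr// !mulr_ge0 ?sqr_ge0// ltW.
  by apply: ler_wpM2r; [exact: ltW|rewrite /K lerDl].
have h2 : K * t <= e / 2.
  rewrite mulrC -ler_pdivlMr//; apply: le_trans tK _.
  by rewrite le_eqVlt; apply/orP; left; apply/eqP; field; rewrite gt_eqF.
lra.
Qed.

End Mollifier.

(** * Weak derivatives *)

Section AlmostEverywhere.
Context d (T : measurableType d) (R : realType).
Variable mu : {measure set T -> \bar R}.
Implicit Types u v : T -> R.

Lemma sqint0_ae u : measurable_fun setT u -> sqint mu u = 0%E ->
  {ae mu, forall x, u x = 0}.
Proof.
move=> mu_ h; have := (ae_eq_integral_abs mu measurableT (measurable_sq mu_)).1.
have -> : (\int[mu]_x `|(u x ^+ 2)%:E| = 0)%E.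
  by rewrite -[RHS]h; apply: eq_integral => x _; rewrite gee0_abs// lee_fin sqr_ge0.
move=> /(_ erefl); apply: filterS => x /(_ I) /= [] /eqP.
by rewrite sqrf_eq0 => /eqP.
Qed.

Lemma sqint_ae_eq u v : measurable_fun setT u -> measurable_fun setT v ->
  {ae mu, forall x, u x = v x} -> sqint mu u = sqint mu v.
Proof.
move=> mu_ mv uv; apply: ae_eq_integral => //; try exact: measurable_sq.
by apply: filterS uv => x -> _.
Qed.

Lemma Rintegral_ae_eq u v : measurable_fun setT u -> measurable_fun setT v ->
  {ae mu, forall x, u x = v x} -> \int[mu]_x u x = \int[mu]_x v x.
Proof.
move=> mu_ mv uv; congr fine; apply: ae_eq_integral => //; try exact/measurable_EFinP.
by apply: filterS uv => x -> _.
Qed.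

Lemma sqint_lt0 u : (forall e : R, 0 < e -> (sqint mu u < e%:E)%E) -> sqint mu u = 0%E.
Proof.
move=> h; apply/eqP; rewrite eq_le sqint_ge0 andbT; apply/lee_addgt0Pr => e e0.
by rewrite add0e ltW// h.
Qed.

Lemma ae_forall_fin (I : finType) (P : I -> T -> Prop) :
  (forall i, {ae mu, forall x, P i x}) -> {ae mu, forall x, forall i, P i x}.
Proof.
move=> h.
have {}h (r : seq I) : {ae mu, forall x, forall i, i \in r -> P i x}.
  elim: r => [|i r IH]; first by apply: aeW.
  have := h i; apply: filterS2 IH => x Hr Hi j.
  by rewrite inE => /predU1P[->//|]; exact: Hr.
by apply: filterS (h (enum I)) => x hx i; apply: hx; rewrite mem_enum.
Qed.

End AlmostEverywhere.

Section WeakDerivatives.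
Variables (R : realType) (n : nat).
Local Notation S := (sumzero R n).
Local Notation N := (Zp_trunc n).+2.
Variable lambda : {measure set S -> \bar R}.
Hypothesis hlambda : is_haar lambda.
Local Notation mu := (gaussian lambda).
Implicit Types (f g h phi chi : S -> R) (l v w x y : S).
Local Notation B r := [set l : S | `|l| <= r].

(** A general element of L^2(mu) can only be convolved after localisation, which puts it in
    L^2(lambda). *)
Lemma L2_localize chi f : test_function chi -> L2 mu f ->
  L2 lambda (fun x => chi x * f x).
Proof.
move=> tc Lf; have mf := L2_measurable Lf; have mc := test_measurable tc.
have [M _ hM] := test_bounded tc; have /test_functionP[_ [r _ cr]] := tc.
have [c c0 hc] := sqint_lambda_le_gaussian hlambda r.
have mcf : measurable_fun setT (fun x => chi x * f x) by exact: measurable_funM.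
have /L2P[_ fin] := L2_bounded_mul mc hM Lf.
apply/L2P; split => //; apply: le_lt_trans (hc _ mcf _) _.
  by move=> x /cr ->; rewrite mul0r.
by rewrite lte_mul_pinfty// lee_fin ltW.
Qed.

Lemma local_integrable f phi : L2 mu f -> test_function phi ->
  lambda.-integrable setT (EFin \o (fun x => f x * phi x)).
Proof.
move=> Lf tp; have /test_functionP[_ [r _ pr]] := tp.
under eq_fun do rewrite mulrC.
apply: (L2_support_integrable hlambda (L2_localize tp Lf) (r := r)) => x /pr ->.
by rewrite mul0r.
Qed.

Lemma test_L2 phi : test_function phi -> L2 mu phi.
Proof.
move=> tp; have [M _ hM] := test_bounded tp.
exact: (@L2_bounded _ _ (gaussian lambda) _ M (test_measurable tp) hM).
Qed.

Lemma deriveM_smooth f g l v : smooth f -> smooth g ->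
  'D_v (fun l => f l * g l) l = f l * 'D_v g l + g l * 'D_v f l.
Proof. by move=> sf sg; rewrite [LHS]deriveM//; exact: smooth_derivable. Qed.

Lemma weak_derivative_test phi v : test_function phi ->
  weak_derivative lambda v phi (fun l => 'D_v phi l).
Proof.
move=> tp psi tpsi; apply/eqP; rewrite -subr_eq0 opprK.
have tD := test_derive v tp; have tDp := test_derive v tpsi.
rewrite -RintegralD//; last 2 first.
- by apply: (test_integrable hlambda); apply: test_mul => //; exact: test_smooth.
- by apply: (test_integrable hlambda); apply: test_mul => //; exact: test_smooth.
apply/eqP; rewrite -[RHS](integral_derive_test hlambda v (test_mul (test_smooth tp) tpsi)).
apply: eq_Rintegral => l _; rewrite deriveM_smooth; [|exact: test_smooth..].
by rewrite (mulrC (psi l)).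
Qed.

(** Test the weak derivative of [f] against [chi * phi], again a test function, and apply the
    product rule. *)
Lemma weak_derivative_mul chi f g v : test_function chi ->
  L2 mu f -> L2 mu g -> weak_derivative lambda v f g ->
  weak_derivative lambda v (fun l => chi l * f l)
    (fun l => chi l * g l + 'D_v chi l * f l).
Proof.
move=> tc Lf Lg wfg phi tp.
have tcp : test_function (fun l => chi l * phi l) by exact: test_mul (test_smooth tc) tp.
have tDcp : test_function (fun l => 'D_v chi l * phi l).
  by apply: test_mul => //; apply: test_smooth; exact: test_derive.
have tcDp : test_function (fun l => chi l * 'D_v phi l).
  by apply: test_mul; [exact: test_smooth|exact: test_derive].
have i1 := local_integrable Lf tcDp.
have i2 := local_integrable Lf tDcp.
have i3 := local_integrable Lg tcp.
have -> : \int[lambda]_l (chi l * f l * 'D_v phi l) =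
          \int[lambda]_l (f l * (chi l * 'D_v phi l)).
  by apply: eq_Rintegral => l _; ring.
have -> : \int[lambda]_l ((chi l * g l + 'D_v chi l * f l) * phi l) =
    \int[lambda]_l (g l * (chi l * phi l)) + \int[lambda]_l (f l * ('D_v chi l * phi l)).
  by rewrite -RintegralD//; apply: eq_Rintegral => l _; ring.
have := wfg _ tcp.
have -> : \int[lambda]_l (f l * 'D_v (fun l => chi l * phi l) l) =
    \int[lambda]_l (f l * (chi l * 'D_v phi l)) +
    \int[lambda]_l (f l * ('D_v chi l * phi l)).
  rewrite -RintegralD//; apply: eq_Rintegral => l _.
  by rewrite deriveM_smooth; [ring|exact: test_smooth..].
by move=> h; rewrite opprD -h; ring.
Qed.

(** A dilated bump normalised at the origin. It is not equal to 1 on a large ball, but its distance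
    to 1 is of order [|l| / (k + 1)], which gives pointwise convergence. *)
Definition cutoff (k : nat) l : R := (bump (0 : S))^-1 * bump (k.+1%:R^-1 *: l).

Lemma bump00_gt0 : 0 < bump (0 : S).
Proof. by rewrite bump_gt0// normr0. Qed.

Lemma test_cutoff k : test_function (cutoff k).
Proof. by apply: test_scale; apply: test_bump_scale; rewrite ltr0n. Qed.

Lemma cutoff_eq0 k l : k.+1%:R < `|l| -> cutoff k l = 0.
Proof.
move=> kl; rewrite /cutoff (@bump_eq0 _ _ (k.+1%:R^-1 *: l)) ?mulr0// normrZ gtr0_norm ?invr_gt0//.
by rewrite ltr_pdivlMl// mulr1.
Qed.

Lemma harmonic_squeeze (u : nat -> R) (C : R) :
  (forall k, `|u k| <= C * k.+1%:R^-1) -> u k @[k --> \oo] --> (0 : R).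
Proof.
move=> hu; have h : C * k.+1%:R^-1 @[k --> \oo] --> (0 : R).
  by rewrite -(mulr0 C); apply: cvgMr; exact: cvg_harmonic.
apply/cvgr0Pnorm_le => e e0; near=> k; apply: le_trans (hu k) _.
apply: le_trans (ler_norm _) _; near: k.
by move/cvgr0Pnorm_le: h; apply.
Unshelve. all: by end_near. Qed.

Lemma derive_scaled f (c a : R) l v : test_function f ->
  'D_v (fun l => c * f (a *: l)) l = c * (a * 'D_v f (a *: l)).
Proof.
move=> tf; have df := @test_derivable R n f (a *: l + 0) v tf.
have [d1 d2] := is_derive_affine df.
rewrite addr0 in d2; rewrite -d2.
have -> : (fun l => c * f (a *: l)) = (fun l => c * f (a *: l + 0)).
  by apply/funext => x; rewrite addr0.
exact: (@deriveZ _ _ _ (fun l : S => f (a *: l + 0)) c l v d1).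
Qed.

Lemma laplacian_le l (i : 'Z_n) : `|laplacian l i| <= 4 * `|l|.
Proof.
have h j := coord_le_norm l j.
rewrite /laplacian; have -> : 4 * `|l| = `|l| + 2 * `|l| + `|l| by ring.
rewrite (le_trans (ler_normD _ _))// lerD// (le_trans (ler_normB _ _))// lerD//.
by rewrite normrM ger0_norm// ler_wpM2l.
Qed.

Lemma invS_gt0 (k : nat) : 0 < k.+1%:R^-1 :> R.
Proof. by rewrite invr_gt0 ltr0n. Qed.

Lemma invS_le1 (k : nat) : k.+1%:R^-1 <= 1 :> R.
Proof. by rewrite invf_le1 ?ltr0n// ler1n. Qed.

Lemma derive_cutoff k l v :
  'D_v (cutoff k) l = (bump (0 : S))^-1 * (k.+1%:R^-1 * 'D_v (@bump R n) (k.+1%:R^-1 *: l)).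
Proof. by rewrite [LHS]derive_scaled//; exact: test_bump. Qed.

Lemma derive2_cutoff k l v :
  'D_v (fun l => 'D_v (cutoff k) l) l = (bump (0 : S))^-1 * k.+1%:R^-1 *
    (k.+1%:R^-1 * 'D_v (fun l => 'D_v (@bump R n) l) (k.+1%:R^-1 *: l)).
Proof.
have -> : (fun l => 'D_v (cutoff k) l) = (fun l => (bump (0 : S))^-1 * k.+1%:R^-1 *
    (fun l => 'D_v (@bump R n) l) (k.+1%:R^-1 *: l)).
  by apply/funext => x; rewrite derive_cutoff mulrA.
exact: (derive_scaled _ _ _ _ (test_derive v (@test_bump R n))).
Qed.

(** The last bound is uniform in [k] although the Laplacian is unbounded: its linear growth on the
    support, of radius [k + 1], is compensated by the factor [1 / (k + 1)] of the derivative. *)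
Lemma cutoff_bounds (v : S) : exists2 M : R, 0 < M & forall k l,
  [/\ `|cutoff k l| <= M, `|1 - cutoff k l| <= M * k.+1%:R^-1 * `|l|,
      `|'D_v (cutoff k) l| <= M * k.+1%:R^-1,
      `|'D_v (fun l => 'D_v (cutoff k) l) l| <= M * k.+1%:R^-1
    & forall i, `|laplacian l i * 'D_v (cutoff k) l| <= M].
Proof.
have tb := @test_bump R n; have tDb := test_derive v tb.
have [M0 M00 h0] := test_bounded tb.
have [M1 M10 h1] := test_lipschitz tb.
have [M2 M20 h2] := test_bounded tDb.
have [M3 M30 h3] := test_bounded (test_derive v tDb).
pose b := (bump (0 : S))^-1.
have b0 : 0 < b by rewrite invr_gt0 bump00_gt0.
pose M := b * (M0 + M1 + 4 * M2 + M3).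
have M_gt0 : 0 < M by rewrite mulr_gt0// !addr_gt0// mulr_gt0.
have bM (x : R) : x <= M0 + M1 + 4 * M2 + M3 -> b * x <= M by move=> h; rewrite ler_wpM2l// ltW.
have D1 k l : `|'D_v (cutoff k) l| <= b * M2 * k.+1%:R^-1.
  rewrite derive_cutoff -/b !normrM (gtr0_norm b0) (gtr0_norm (invS_gt0 k)).
  by rewrite -mulrA ler_wpM2l ?(ltW b0)// mulrC ler_wpM2r// ltW// invS_gt0.
exists M => // k l; split.
- rewrite normrM -/b (gtr0_norm b0); apply: bM; apply: le_trans (h0 _) _; lra.
- have -> : 1 - cutoff k l = b * (bump (0 : S) - bump (k.+1%:R^-1 *: l)).
    by rewrite mulrBr mulVf ?gt_eqF// bump00_gt0.
  rewrite normrM (gtr0_norm b0).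
  apply: (@le_trans _ _ (b * (M1 * (k.+1%:R^-1 * `|l|)))).
    rewrite ler_wpM2l ?(ltW b0)//; apply: le_trans (h1 _ _) _.
    by rewrite sub0r normrN normrZ (gtr0_norm (invS_gt0 k)).
  rewrite !mulrA ler_wpM2r// ler_wpM2r// ?(ltW (invS_gt0 k))//; apply: bM; lra.
- apply: le_trans (D1 _ _) _; rewrite ler_wpM2r ?(ltW (invS_gt0 k))//; apply: bM; lra.
- rewrite derive2_cutoff -/b -mulrA !normrM (gtr0_norm b0) (gtr0_norm (invS_gt0 k)).
  apply: (@le_trans _ _ (b * (k.+1%:R^-1 * (1 * M3)))).
    rewrite ler_wpM2l ?(ltW b0)// ler_wpM2l ?(ltW (invS_gt0 k))//.
    by rewrite ler_pM// ?invS_le1// ltW// invS_gt0.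
  rewrite mul1r mulrCA mulrC ler_wpM2r ?(ltW (invS_gt0 k))//; apply: bM; lra.
- move=> i; have [kl|kl] := leP `|l| k.+1%:R; last first.
    rewrite (derive_vanish _ (fun x => @cutoff_eq0 k x) kl) mulr0 normr0 ltW//.
  rewrite normrM; apply: (@le_trans _ _ (4 * k.+1%:R * (b * M2 * k.+1%:R^-1))).
    rewrite ler_pM//; apply: le_trans (laplacian_le _ _) _.
    by rewrite ler_wpM2l.
  have -> : 4 * k.+1%:R * (b * M2 * k.+1%:R^-1) = b * (4 * M2).
    set K := k.+1%:R; have K0 : K != 0 by rewrite pnatr_eq0.
    by field.
  apply: bM; lra.
Qed.

Lemma cutoff_cvg l : cutoff k l @[k --> \oo] --> (1 : R).
Proof.
have [M M0 hM] := cutoff_bounds 0.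
apply/subr_cvg0; apply: (@harmonic_squeeze _ (M * `|l|)) => k.
by have [_ h _ _ _] := hM k l; rewrite distrC mulrAC.
Qed.

(** After a cutoff, the mollified difference at each point is an integral against a test function,
    hence zero. Letting first the mollification scale tend to zero and then the cutoff to 1 shows
    that the difference has zero norm. *)
Lemma weak_unique f g : L2 mu f -> L2 mu g ->
  (forall phi, test_function phi ->
     \int[lambda]_l (f l * phi l) = \int[lambda]_l (g l * phi l)) ->
  {ae mu, forall l, f l = g l}.
Proof.
move=> Lf Lg fg; pose u l := f l - g l.
have Lu : L2 mu u.
  have -> : u = (fun l => f l + (-1) * g l) by apply/funext => l; rewrite mulN1r.
  by apply: L2_add => //; exact: L2_scale.
have u0 phi : test_function phi -> \int[lambda]_l (u l * phi l) = 0.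
  move=> tp; have i1 := local_integrable Lf tp; have i2 := local_integrable Lg tp.
  rewrite -(subrr (\int[lambda]_l (g l * phi l))) -[X in _ = X - _]fg//.
  by rewrite -RintegralB//; apply: eq_Rintegral => l _; rewrite mulrBl.
suff h : sqint mu u = 0%E.
  have := sqint0_ae (L2_measurable Lu) h; apply: filterS => l /eqP.
  by rewrite subr_eq0 => /eqP.
have cut0 k : sqint lambda (fun l => cutoff k l * u l) = 0%E.
  have Lc := L2_localize (test_cutoff k) Lu.
  have cz x : k.+1%:R < `|x| -> cutoff k x * u x = 0.
    by move=> /cutoff_eq0 ->; rewrite mul0r.
  apply: sqint_lt0 => e e0.
  have [d d0 hd] := mollifier_cvg hlambda Lc cz e0.
  have := hd d d0 (lexx d); apply: le_lt_trans.
  have cv0 x : conv lambda (fun l => cutoff k l * u l) (mollifier lambda d) x = 0.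
    rewrite -[RHS](u0 (fun y => cutoff k y * mollifier lambda d (x - y))).
      by apply: eq_Rintegral => y _; ring.
    apply: test_mul; first exact: test_smooth (test_cutoff k).
    by apply: test_reflect; exact: test_mollifier.
  by apply: sqint_le => x; rewrite cv0 sub0r normrN.
have mc k : measurable_fun setT (fun l => cutoff k l * u l).
  apply: measurable_funM; [exact: test_measurable (test_cutoff k)|exact: (L2_measurable Lu)].
have cut_mu k : sqint mu (fun l => cutoff k l * u l) = 0%E.
  by apply: sqint_gaussian_eq0.
have [M M0 hM] := cutoff_bounds 0.
have cv : sqint mu (fun l => u l - cutoff k l * u l) @[k --> \oo] --> 0%E.
  apply: (@sqint_cvg_dominated _ _ _ mu (fun k l => u l - cutoff k l * u l)
    (fun l => (1 + M) * `|u l|)).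
  - by move=> k; apply: measurable_funB => //; exact: (L2_measurable Lu).
  - move=> l; have -> : (fun k => u l - cutoff k l * u l) = (fun k => (1 - cutoff k l) * u l).
      by apply/funext => k; rewrite mulrBl mul1r.
    rewrite -(mul0r (u l)); apply: cvgMl; rewrite -(subrr 1).
    by apply: cvgB; [exact: cvg_cst|exact: cutoff_cvg].
  - apply: L2_scale; have /L2P[mu_ fu] := Lu; apply/L2P; split.
      exact: measurableT_comp.
    by apply: le_lt_trans fu; apply: sqint_le => l; rewrite normr_id.
  - move=> k l; have [h _ _ _ _] := hM k l.
    rewrite -{1}[u l]mul1r -mulrBl normrM ler_wpM2r//.
    by rewrite (le_trans (ler_normB _ _))// normr1 lerD2l.
apply: sqint_lt0 => e e0.
have e4 : 0 < e / 4 by rewrite divr_gt0.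
have [k _ /(_ k (leqnn k)) hk] := near_sqint_lt e4 cv (fun k => sqint_ge0 _ _).
have -> : u = (fun l => (u l - cutoff k l * u l) + cutoff k l * u l).
  by apply/funext => l; rewrite subrK.
apply: sqint_add_lt => //; last by rewrite cut_mu lte_fin.
by apply: measurable_funB => //; exact: (L2_measurable Lu).
Qed.

End WeakDerivatives.

(** * Gaussian integration by parts and the bound on the drift term *)

Section GaussianSobolev.
Variables (R : realType) (n : nat).
Local Notation S := (sumzero R n).
Local Notation N := (Zp_trunc n).+2.
Variable lambda : {measure set S -> \bar R}.
Hypothesis hlambda : is_haar lambda.
Local Notation mu := (gaussian lambda).
Local Notation Z := (gauss_mass lambda).
Local Notation gd := (gauss_density lambda).
Implicit Types (f g h phi chi u : S -> R) (l v w x y : S) (i : 'Z_n).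

Lemma gauss_density_derive l i : 'D_(drift R i) gd l = gd l * laplacian l i.
Proof.
have [d1 d2] := gibbs_density_is_derive l i.
have -> : gd = (fun l => Z^-1 * gibbs_density l) by [].
by rewrite [LHS](@deriveZ _ _ _ _ Z^-1 l _ d1) d2 -mulrA.
Qed.

(** The integrand is the derivative of [gauss_density lambda * F], whose integral vanishes by
    translation invariance. *)
Lemma gaussian_ibp F i : test_function F ->
  \int[lambda]_l (('D_(drift R i) F l + F l * laplacian l i) * gd l) = 0.
Proof.
move=> tF; have sg := smooth_gauss_density lambda.
rewrite -(integral_derive_test hlambda (drift R i) (test_mul sg tF)).
apply: eq_Rintegral => l _.
rewrite deriveM_smooth//; last exact: test_smooth.
by rewrite gauss_density_derive; ring.
Qed.

Lemma smooth_laplacian i : smooth (fun l : S => laplacian l i).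
Proof. by apply: elementary_smooth; exact: elem_laplacian. Qed.

Lemma measurable_laplacian i : measurable_fun setT (fun l : S => laplacian l i).
Proof. by apply: smooth_measurable; exact: smooth_laplacian. Qed.

Lemma sqint_test phi : test_function phi ->
  sqint mu phi = (\int[lambda]_l (phi l ^+ 2 * gd l))%:E.
Proof.
move=> tp; rewrite sqint_gaussian//; last exact: test_measurable.
apply: (@ge0_integral_test _ _ _ hlambda (fun l => phi l ^+ 2 * gd l)).
- have := test_mul (smooth_gauss_density lambda) (test_mul (test_smooth tp) tp).
  by under eq_fun do rewrite mulrC.
- by move=> l; rewrite mulr_ge0 ?sqr_ge0 ?gauss_density_ge0.
Qed.

Lemma test_laplacian_bound i : exists2 C : R, 0 < C & forall phi, test_function phi ->
  (sqint mu (fun l => (laplacian l i * phi l)%R) <=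
   C%:E * (sqint mu phi + sqint mu (fun l => 'D_(drift R i) phi l)))%E.
Proof.
pose kappa := laplacian (drift R i) i.
exists (4 + 2 * `|kappa|) => [|phi tp]; first by rewrite ltr_pwDl// mulr_ge0.
have sL := smooth_laplacian i.
have tL : test_function (fun l => laplacian l i * phi l) by exact: test_mul.
have tD := test_derive (drift R i) tp.
rewrite (sqint_test tL) (sqint_test tp) (sqint_test tD) -EFinD -EFinM lee_fin.
have tF : test_function (fun l => phi l * (laplacian l i * phi l)).
  by apply: test_mul => //; exact: test_smooth.
have := gaussian_ibp i tF.
set F := fun l => phi l * (laplacian l i * phi l).
have sg := smooth_gauss_density lambda.
have isq f : test_function f -> lambda.-integrable setT (EFin \o (fun l => f l ^+ 2 * gd l)).
  move=> tf; apply: (test_integrable hlambda).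
  have := test_mul sg (test_mul (test_smooth tf) tf).
  by under eq_fun do rewrite mulrC.
have iF : lambda.-integrable setT
    (EFin \o (fun l => ('D_(drift R i) F l + F l * laplacian l i) * gd l)).
  apply: (test_integrable hlambda).
  have := test_mul sg (test_add (test_derive (drift R i) tF) (test_mul sL tF)).
  by under eq_fun do rewrite mulrC (mulrC (laplacian _ _)).
have DF l : 'D_(drift R i) F l = phi l ^+ 2 * kappa +
    2 * phi l * laplacian l i * 'D_(drift R i) phi l.
  have Lphi : 'D_(drift R i) (fun l => laplacian l i * phi l) l =
      laplacian l i * 'D_(drift R i) phi l + phi l * kappa.
    rewrite deriveM_smooth//; last exact: test_smooth.
    by have [_ ->] := laplacian_is_derive i l (drift R i).
  by rewrite /F deriveM_smooth; [rewrite Lphi; ring|exact: test_smooth..].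
move=> ibp0.
pose I1 := isq _ tp; pose I2 := isq _ tD; pose I3 := isq _ tL.
have i12 := integrable_scaleR (4 + 2 * `|kappa|) (integrable_addR I1 I2).
have iF2 := integrable_scaleR 2 iF.
rewrite -(RintegralD measurableT I1 I2) -(RintegralZl _ measurableT (integrable_addR I1 I2)).
(* Adding twice the vanishing integral leaves one positive copy of [(w * p) ^+ 2], which with the
   cross term forms [(w * p + 2 * q) ^+ 2]. Hence the 4 in the constant; the remaining part of the
   constant dominates the terms in [kappa]. *)
rewrite -[leRHS]addr0 -[X in _ <= _ + X](mulr0 2) -ibp0 -(RintegralZl _ measurableT iF).
rewrite -(RintegralD measurableT i12 iF2).
apply: le_Rintegral => //; first exact: (integrable_addR i12 iF2).
move=> l _; rewrite DF /F; have k1 := ler_norm kappa; have k2 := ler_norm (- kappa).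
rewrite normrN in k2; have := gauss_density_ge0 hlambda l.
move: (phi l) ('D_(drift R i) phi l) (laplacian l i) (gd l) => p q w z z0.
rewrite -subr_ge0.
have -> : (4 + 2 * `|kappa|) * (p ^+ 2 * z + q ^+ 2 * z) +
    2 * ((p ^+ 2 * kappa + 2 * p * w * q + p * (w * p) * w) * z) - (w * p) ^+ 2 * z =
    z * ((w * p + 2 * q) ^+ 2 + 4 * p ^+ 2 + 2 * `|kappa| * q ^+ 2 +
    2 * (`|kappa| + kappa) * p ^+ 2) by ring.
have k3 : 0 <= `|kappa| + kappa by lra.
by rewrite mulr_ge0// !addr_ge0 ?sqr_ge0// mulr_ge0 ?sqr_ge0// mulr_ge0.
Qed.

Lemma sqint_laplacian_support (u : S -> R) (r : R) i : measurable_fun setT u ->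
  (forall l, r < `|l| -> u l = 0) ->
  (sqint mu (fun l => (laplacian l i * u l)%R) <=
   ((4 * r) ^+ 2 * Z^-1)%:E * sqint lambda u)%E.
Proof.
move=> mu_ ur.
apply: (@le_trans _ _ (((4 * r) ^+ 2)%:E * sqint mu u)%E); last first.
  rewrite (EFinM ((4 * r) ^+ 2)) -muleA; apply: lee_wpmul2l.
    by rewrite lee_fin sqr_ge0.
  exact: sqint_gaussian_le.
apply: sqint_scale_le => // l; rewrite normrM.
have [lr|/ur ->] := leP `|l| r; last by rewrite normr0 !mulr0.
by rewrite ler_wpM2r// (le_trans (laplacian_le _ _))// ler_wpM2l.
Qed.

Lemma L2_sq_real (m : {measure set S -> \bar R}) u : L2 m u ->
  exists2 q : R, 0 <= q & sqint m u = q%:E.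
Proof.
move=> /L2P[_]; move: (sqint_ge0 m u); case: (sqint m u) => [q| |]// q0 _.
by exists q.
Qed.

Lemma L2_haar_gaussian u : L2 lambda u -> L2 mu u.
Proof.
move=> Lu; have mu_ := L2_measurable Lu; apply/L2P; split => //.
have /L2P[_ g2] := Lu; apply: le_lt_trans (sqint_gaussian_le hlambda mu_) _.
by rewrite lte_mul_pinfty// lee_fin invr_ge0 ltW// gauss_mass_gt0.
Qed.

(** Mollification carries the bound over to weak derivatives. The error terms depend on the support
    radius [s] but disappear in the limit, so [C] is the same for all [s]; the later removal of the
    cutoff relies on this. *)
Lemma laplacian_bound_support i : exists2 C : R, 0 < C & forall G Gv (s : R),
  L2 lambda G -> L2 lambda Gv -> 0 < s ->
  (forall l, s < `|l| -> G l = 0) -> (forall l, s < `|l| -> Gv l = 0) ->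
  weak_derivative lambda (drift R i) G Gv ->
  (sqint mu (fun l => (laplacian l i * G l)%R) <= C%:E * (sqint mu G + sqint mu Gv))%E.
Proof.
have [C C0 hC] := test_laplacian_bound i.
exists (4 * C) => [|G Gv s LG LGv s0 Gs Gvs wG]; first by rewrite mulr_gt0.
have mG := L2_measurable LG; have mGv := L2_measurable LGv.
have [a a0 aE] := L2_sq_real (L2_haar_gaussian LG).
have [b b0 bE] := L2_sq_real (L2_haar_gaussian LGv).
have Zi : 0 < Z^-1 by rewrite invr_gt0 gauss_mass_gt0.
(* The total coefficient of the mollification errors in the final estimate, so that errors below
   [e / K] sum to at most [e]. *)
pose K := (8 * C + 2 * (4 * (s + 1)) ^+ 2) * Z^-1.
have K0 : 0 < K by rewrite mulr_gt0// ltr_wpDr ?mulr_gt0// mulr_ge0// sqr_ge0.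
apply/lee_addgt0Pr => e e0.
have eK0 : 0 < e / K by rewrite divr_gt0.
have [d1 d10 h1] := mollifier_cvg hlambda LG Gs eK0.
have [d2 d20 h2] := mollifier_cvg hlambda LGv Gvs eK0.
pose t := Num.min 1 (Num.min d1 d2).
have t0 : 0 < t by rewrite !lt_min ltr01 d10.
have t1 : t <= 1 by rewrite ge_min lexx.
have td1 : t <= d1 by rewrite !ge_min lexx orbT.
have td2 : t <= d2 by rewrite !ge_min lexx !orbT.
have {h1} := h1 t t0 td1; have {h2} := h2 t t0 td2.
have iG := L2_support_integrable hlambda LG Gs.
have tm := test_mollifier lambda t0.
pose phi := conv lambda G (mollifier lambda t).
have tphi : test_function phi by apply: conv_test => //; exists s.
have -> : conv lambda Gv (mollifier lambda t) = (fun l => 'D_(drift R i) phi l).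
  by apply/funext => l; rewrite (derive_conv_weak l iG wG tm).
rewrite -/phi => hv h.
have mphi := test_measurable tphi.
have mDphi := test_measurable (test_derive (drift R i) tphi).
have toR (q : R) u : measurable_fun setT u -> (sqint lambda u < q%:E)%E ->
    exists2 p : R, 0 <= p <= q & (sqint lambda u = p%:E).
  move=> mu_; move: (sqint_ge0 lambda u); case: (sqint _ _) => [p| |]//.
  by rewrite lee_fin lte_fin => p0 /ltW pq; exists p => //; rewrite p0.
have [p /andP[p0 pe] pE] := toR _ _ (measurable_funB mphi mG) h.
have [q /andP[q0 qe] qE] := toR _ _ (measurable_funB mDphi mGv) hv.
have phi_le : (sqint mu phi <= (2 * a + 2 * (Z^-1 * p))%:E)%E.
  have -> : phi = (fun l => G l + (phi l - G l)) by apply/funext => l; rewrite addrC subrK.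
  apply: le_trans (sqint_add _ mG (measurable_funB mphi mG)) _.
  rewrite aE (EFinD (2 * a)); apply: leeD; first by rewrite EFinM.
  rewrite (EFinM 2) (EFinM Z^-1) -pE; apply: lee_wpmul2l => //.
  by apply: sqint_gaussian_le => //; exact: measurable_funB.
have Dphi_le : (sqint mu (fun l => 'D_(drift R i) phi l) <= (2 * b + 2 * (Z^-1 * q))%:E)%E.
  have -> : (fun l => 'D_(drift R i) phi l) = (fun l => Gv l + ('D_(drift R i) phi l - Gv l)).
    by apply/funext => l; rewrite addrC subrK.
  apply: le_trans (sqint_add _ mGv (measurable_funB mDphi mGv)) _.
  rewrite bE (EFinD (2 * b)); apply: leeD; first by rewrite EFinM.
  rewrite (EFinM 2) (EFinM Z^-1) -qE; apply: lee_wpmul2l => //.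
  by apply: sqint_gaussian_le => //; exact: measurable_funB.
have err : (sqint mu (fun l => (laplacian l i * (phi l - G l))%R) <=
    ((4 * (s + 1)) ^+ 2 * Z^-1 * p)%:E)%E.
  rewrite (EFinM (_ * Z^-1)) -pE; apply: sqint_laplacian_support; first exact: measurable_funB.
  move=> l sl; have sl' : s < `|l| by rewrite (lt_trans _ sl)// ltrDl.
  rewrite (Gs _ sl') subr0.
  apply: (@conv_vanish _ _ lambda G (mollifier lambda t) s t l Gs) => [y|].
    exact: mollifier_eq0.
  by rewrite (le_lt_trans _ sl)// lerD2l.
have mL := measurable_laplacian i.
have -> : (fun l => laplacian l i * G l) =
    (fun l => laplacian l i * phi l + (-1) * (laplacian l i * (phi l - G l))).
  by apply/funext => l; ring.
have m1 : measurable_fun setT (fun l => laplacian l i * phi l) by exact: measurable_funM.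
have m2 : measurable_fun setT (fun l => laplacian l i * (phi l - G l)).
  by apply: measurable_funM => //; exact: measurable_funB.
apply: le_trans (sqint_add _ m1 (measurable_funM (measurable_cst _) m2)) _.
have err' : (sqint mu (fun l => (-1 * (laplacian l i * (phi l - G l)))%R) <=
    ((4 * (s + 1)) ^+ 2 * Z^-1 * p)%:E)%E.
  by apply: le_trans err; apply: sqint_le => l; rewrite mulN1r normrN.
have main : (sqint mu (fun l => (laplacian l i * phi l)%R) <=
    (C * ((2 * a + 2 * (Z^-1 * p)) + (2 * b + 2 * (Z^-1 * q))))%:E)%E.
  apply: le_trans (hC _ tphi) _.
  by rewrite (EFinM C) (EFinD (2 * a + _)) lee_wpmul2l ?leeD// lee_fin ltW.
apply: (@le_trans _ _ (2%:E * (C * ((2 * a + 2 * (Z^-1 * p)) + (2 * b + 2 * (Z^-1 * q))))%:E +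
  2%:E * ((4 * (s + 1)) ^+ 2 * Z^-1 * p)%:E)%E).
  by apply: leeD; rewrite lee_wpmul2l.
rewrite aE bE -EFinD -!EFinM -!EFinD lee_fin.
pose A := (4 * (s + 1)) ^+ 2.
have A0 : 0 <= A by exact: sqr_ge0.
have KE E : K * E = 4 * C * (Z^-1 * E) + (4 * C + 2 * A) * (Z^-1 * E) by rewrite /K /A; ring.
have h8 : 4 * C * (Z^-1 * q) + (4 * C + 2 * A) * (Z^-1 * p) <= e.
  apply: (@le_trans _ _ (K * (e / K))); last by rewrite mulrC divfK// gt_eqF.
  rewrite KE; apply: lerD; apply: ler_wpM2l.
  - by rewrite mulr_ge0// ltW.
  - by rewrite ler_wpM2l// ltW.
  - by rewrite addr_ge0// mulr_ge0// ltW.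
  - by rewrite ler_wpM2l// ltW.
apply: (@le_trans _ _ (4 * C * (a + b) +
    (4 * C * (Z^-1 * q) + (4 * C + 2 * A) * (Z^-1 * p)))); last by rewrite lerD2l.
by rewrite le_eqVlt; apply/orP; left; apply/eqP; rewrite /A; ring.
Qed.

End GaussianSobolev.

Section Core.
Variables (R : realType) (n : nat).
Local Notation S := (sumzero R n).
Local Notation N := (Zp_trunc n).+2.
Variable lambda : {measure set S -> \bar R}.
Hypothesis hlambda : is_haar lambda.
Local Notation mu := (gaussian lambda).
Implicit Types (f g h phi chi u : S -> R) (l v w x y : S) (i : 'Z_n).

(** The bound for compactly supported functions, applied to [cutoff k * g], is uniform in [k];
    Fatou's lemma removes the cutoff. *)
Lemma laplacian_L2 g gv i : L2 mu g -> L2 mu gv ->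
  weak_derivative lambda (drift R i) g gv -> L2 mu (fun l => laplacian l i * g l).
Proof.
move=> Lg Lgv wg; have mg := L2_measurable Lg; have mgv := L2_measurable Lgv.
have mL := @measurable_laplacian R n i.
apply/L2P; split; first exact: measurable_funM.
have [M M0 hM] := cutoff_bounds (drift R i).
have [C C0 hC] := laplacian_bound_support hlambda i.
have [a a0 aE] := L2_sq_real Lg; have [b b0 bE] := L2_sq_real Lgv.
have tc k := @test_cutoff R n k.
have mc k : measurable_fun setT (@cutoff R n k) := test_measurable (tc k).
have mDc k : measurable_fun setT (fun l => 'D_(drift R i) (@cutoff R n k) l).
  exact: test_measurable (test_derive _ (tc k)).
have Dc_le k l : `|'D_(drift R i) (@cutoff R n k) l| <= M.
  have [_ _ h _ _] := hM k l; apply: le_trans h _.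
  by rewrite ler_piMr ?(ltW M0)// invS_le1.
pose Q : R := C * (M ^+ 2 * a + (2 * (M ^+ 2 * b) + 2 * (M ^+ 2 * a))).
have bound k : (sqint mu (fun l => (laplacian l i * (cutoff k l * g l))%R) <= Q%:E)%E.
  pose G l := cutoff k l * g l.
  pose Gv l := cutoff k l * gv l + 'D_(drift R i) (cutoff k) l * g l.
  have LG : L2 lambda G := L2_localize hlambda (tc k) Lg.
  have LGv : L2 lambda Gv.
    apply: L2_add; first exact: L2_localize.
    by apply: (L2_localize hlambda) => //; exact: test_derive.
  have k0 : 0 < k.+1%:R :> R by rewrite ltr0n.
  apply: le_trans (hC G Gv _ LG LGv k0 _ _ _) _.
  - by move=> l kl; rewrite /G cutoff_eq0// mul0r.
  - move=> l kl; rewrite /Gv cutoff_eq0// (derive_vanish _ (fun x => @cutoff_eq0 _ _ k x) kl).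
    by rewrite !mul0r addr0.
  - exact: (weak_derivative_mul hlambda).
  rewrite /Q EFinM; apply: lee_wpmul2l; first by rewrite lee_fin ltW.
  rewrite (EFinD (M ^+ 2 * a)); apply: leeD.
    rewrite (EFinM (M ^+ 2)) -aE; apply: sqint_scale_le => // l.
    by rewrite normrM ler_wpM2r//; have [] := hM k l.
  apply: le_trans (sqint_add _ _ _) _; [exact: measurable_funM|exact: measurable_funM|].
  rewrite (EFinD (2 * (M ^+ 2 * b))) (EFinM 2) (EFinM 2); apply: leeD; apply: lee_wpmul2l => //.
    rewrite (EFinM (M ^+ 2)) -bE; apply: sqint_scale_le => // l.
    by rewrite normrM ler_wpM2r//; have [] := hM k l.
  rewrite (EFinM (M ^+ 2)) -aE; apply: sqint_scale_le => // l.
  by rewrite normrM ler_wpM2r.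
pose F k l : \bar R := ((laplacian l i * (cutoff k l * g l)) ^+ 2)%:E.
have mF k : measurable_fun setT (F k).
  by apply: measurable_sq; apply: measurable_funM => //; exact: measurable_funM.
have F0 k x : (0 <= F k x)%E by rewrite lee_fin sqr_ge0.
have fat := @fatou _ _ _ mu setT measurableT F mF (fun k x _ => F0 k x).
apply: (@le_lt_trans _ _ Q%:E); last by rewrite ltry.
have -> : sqint mu (fun l => laplacian l i * g l) = (\int[mu]_l limn_einf (F^~ l))%E.
  apply: eq_integral => l _.
  have cv : F k l @[k --> \oo] --> ((laplacian l i * g l) ^+ 2)%:E.
    apply/fine_cvgP; split; first exact: nearW.
    rewrite /F /=; under eq_fun do rewrite /= expr2.
    rewrite expr2; have c1 : (laplacian l i * (cutoff k l * g l)) @[k --> \oo] --> laplacian l i * g l.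
      rewrite -{2}[g l]mul1r; apply: cvgMr; apply: cvgMl; exact: cutoff_cvg.
    exact: cvgM.
  by rewrite is_cvg_limn_einfE ?(cvg_lim _ cv)//; exact: cvgP cv.
apply: le_trans fat _.
rewrite limn_einf_lim; apply: lime_le; first exact: is_cvg_einfs.
by apply: nearW => k; apply: le_trans (bound k); apply: ereal_inf_lbound; exists k => /=.
Qed.

Lemma wD_spec v f : (exists g, L2 mu g /\ weak_derivative lambda v f g) ->
  L2 mu (wD lambda v f) /\ weak_derivative lambda v f (wD lambda v f).
Proof. by move=> h; have := xgetPex (cst 0) h. Qed.

(** [wD] is an arbitrary choice, while [H22] provides second derivatives of some unspecified first
    derivative. The two are reconciled because the derivative of a test function is a test
    function. *)
Lemma weak_derivative_transfer v w f g1 g2 h : weak_derivative lambda v f g1 ->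
  weak_derivative lambda v f g2 -> weak_derivative lambda w g1 h ->
  weak_derivative lambda w g2 h.
Proof.
move=> w1 w2 w3 phi tp; have tD := test_derive w tp.
by rewrite -(w3 _ tp); apply: oppr_inj; rewrite -(w1 _ tD) -(w2 _ tD).
Qed.

Lemma H22_spec f v : H22 lambda f ->
  [/\ L2 mu (wD lambda v f), weak_derivative lambda v f (wD lambda v f),
      L2 mu (wD lambda v (wD lambda v f)) &
      weak_derivative lambda v (wD lambda v f) (wD lambda v (wD lambda v f))].
Proof.
move=> [Lf /(_ v)[g [Lg wg /(_ v)[h [Lh wh]]]]].
have [L1 w1] := wD_spec (ex_intro _ g (conj Lg wg)).
have w2 := weak_derivative_transfer wg w1 wh.
by have [L2' w2'] := wD_spec (ex_intro _ h (conj Lh w2)).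
Qed.

Lemma test_H22 phi : test_function phi -> H22 lambda phi.
Proof.
move=> tp; split; first exact: test_L2.
move=> v; have tD := test_derive v tp.
exists (fun l => 'D_v phi l); split; [exact: test_L2|exact: weak_derivative_test|].
move=> w; exists (fun l => 'D_w (fun l => 'D_v phi l) l).
by split; [exact: (test_L2 _ (test_derive w tD))|exact: weak_derivative_test].
Qed.

Lemma wD_test phi v : test_function phi ->
  {ae mu, forall l, wD lambda v phi l = 'D_v phi l}.
Proof.
move=> tp; have [L1 w1 _ _] := H22_spec v (test_H22 tp).
have LD := test_L2 lambda (test_derive v tp).
apply: (weak_unique hlambda L1 LD) => psi tpsi.
by apply: oppr_inj; rewrite -w1// -(weak_derivative_test hlambda).
Qed.

Lemma wD2_test phi v : test_function phi ->
  {ae mu, forall l, wD lambda v (wD lambda v phi) l = 'D_v (fun l => 'D_v phi l) l}.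
Proof.
move=> tp; have [L1 w1 L2' w2] := H22_spec v (test_H22 tp).
have tD := test_derive v tp.
have w3 := weak_derivative_transfer (weak_derivative_test hlambda v tp) w1
  (weak_derivative_test hlambda v tD).
have LD := test_L2 lambda (test_derive v tD).
apply: (weak_unique hlambda L2' LD) => psi tpsi.
by apply: oppr_inj; rewrite -w2// -w3.
Qed.

Definition genZ_classical phi l : R := (2 * n%:R)^-1 * \sum_(i : 'Z_n)
  ('D_(drift R i) (fun l => 'D_(drift R i) phi l) l +
   laplacian l i * 'D_(drift R i) phi l).

Lemma genZ_test phi : test_function phi ->
  {ae mu, forall l, genZ lambda phi l = genZ_classical phi l}.
Proof.
move=> tp.
have h1 := ae_forall_fin (fun i : 'Z_n => wD_test (drift R i) tp).
have h2 := ae_forall_fin (fun i : 'Z_n => wD2_test (drift R i) tp).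
apply: filterS2 h1 h2 => l e1 e2; rewrite /genZ; congr (_ * _).
by apply: eq_bigr => i _; rewrite e1 e2.
Qed.

Lemma genZ_L2 f : H22 lambda f -> L2 mu (genZ lambda f).
Proof.
move=> hf; apply: L2_scale; apply: L2_sum => i.
have [L1 w1 L2' w2] := H22_spec (drift R i) hf.
by apply: L2_add => //; exact: (laplacian_L2 L1 L2' w2).
Qed.

Lemma test_genZ_classical phi : test_function phi -> test_function (genZ_classical phi).
Proof.
move=> tp; apply: test_scale.
elim: (index_enum _) => [|i r IH].
  by under eq_fun do rewrite big_nil; exact: test_cst0.
under eq_fun do rewrite big_cons; apply: test_add => //; apply: test_add.
  by apply: test_derive; exact: test_derive.
by apply: test_mul; [exact: smooth_laplacian|exact: test_derive].
Qed.

(** Each further summand divides the budget by 4, as in [sqint_add_lt]. *)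
Lemma sqint_sum_lt (I : Type) (r : seq I) (F : I -> S -> R) (e : R) : 0 < e ->
  (forall j, measurable_fun setT (F j)) ->
  (forall j, sqint mu (F j) < (e / 4 ^+ size r)%:E)%E ->
  (sqint mu (fun l => (\sum_(j <- r) F j l)%R) < e%:E)%E.
Proof.
move=> + mF; elim: r e => [|j r IH] e e0 hF.
  under eq_fun do rewrite big_nil.
  by rewrite /sqint expr0n/= integral0 lte_fin.
under eq_fun do rewrite big_cons.
have e4 : 0 < e / 4 by rewrite divr_gt0.
have p4 : 0 < 4 ^+ size r :> R by rewrite exprn_gt0.
have eE : e / 4 ^+ size (j :: r) = e / 4 / 4 ^+ size r.
  by rewrite /= exprS invfM mulrA.
apply: sqint_add_lt => //.
- by apply: measurable_sum.
- apply: lt_le_trans (hF j) _; rewrite eE lee_fin ler_pdivrMr// ler_peMr ?(ltW e4)//.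
  by rewrite exprn_ege1// ler1n.
- by apply: IH => // k; rewrite -eE.
Qed.

Lemma small_forall_fin (I : finType) (P : I -> R -> Prop) :
  (forall j : I, exists2 d : R, 0 < d & forall t : R, 0 < t -> t <= d -> P j t) ->
  exists2 d : R, 0 < d & forall t : R, 0 < t -> t <= d -> forall j : I, P j t.
Proof.
move=> h.
suff [d d0 hd] : exists2 d : R, 0 < d & forall t : R, 0 < t -> t <= d ->
    forall j : I, j \in enum I -> P j t.
  by exists d => // t t0 td j; apply: hd => //; rewrite mem_enum.
elim: (enum I) => [|k r [d d0 hd]]; first by exists 1.
have [d' d'0 hd'] := h k; exists (Num.min d d'); first by rewrite lt_min d0.
move=> t t0; rewrite le_min => /andP[td td'] j; rewrite inE => /predU1P[->|jr].
  exact: hd'.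
exact: hd.
Qed.

End Core.

(** * Test functions form a core *)

Section CoreDensity.
Variables (R : realType) (n : nat).
Local Notation S := (sumzero R n).
Local Notation N := (Zp_trunc n).+2.
Variable lambda : {measure set S -> \bar R}.
Hypothesis hlambda : is_haar lambda.
Local Notation mu := (gaussian lambda).
Implicit Types (f g h phi chi u : S -> R) (l v w x y : S) (i : 'Z_n).

Lemma weak_derivative_add v f1 f2 g1 g2 : L2 mu f1 -> L2 mu f2 -> L2 mu g1 -> L2 mu g2 ->
  weak_derivative lambda v f1 g1 -> weak_derivative lambda v f2 g2 ->
  weak_derivative lambda v (fun l => f1 l + f2 l) (fun l => g1 l + g2 l).
Proof.
move=> Lf1 Lf2 Lg1 Lg2 w1 w2 phi tp; have tD := test_derive v tp.
under eq_Rintegral do rewrite mulrDl.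
under [in RHS]eq_Rintegral do rewrite mulrDl.
rewrite RintegralD//; [|exact: (local_integrable hlambda)..].
rewrite RintegralD//; [|exact: (local_integrable hlambda)..].
by rewrite w1// w2// opprD.
Qed.

Lemma ler_normB4 (a b c e : R) : `|a - b - c - e| <= `|a| + `|b| + `|c| + `|e|.
Proof. by do 3 (apply: le_trans (ler_normB _ _) _; rewrite lerD2r). Qed.

Lemma inv2n_itv : 0 <= (2 * n%:R : R)^-1 <= 1.
Proof.
rewrite invr_ge0 mulr_ge0//=; case: n => [|m]; first by rewrite mulr0 invr0.
by rewrite invf_le1 ?mulr_gt0 ?ltr0n// -natrM ler1n.
Qed.

Lemma L2_norm (m : {measure set S -> \bar R}) u : L2 m u -> L2 m (fun l => `|u l|).
Proof.
move=> /L2P[mu_ fu]; apply/L2P; split; first exact: measurableT_comp.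
by apply: le_lt_trans fu; apply: sqint_le => l; rewrite normr_id.
Qed.

Section Cutoff.
Variable f : S -> R.
Hypothesis Hf : H22 lambda f.
Local Notation g i := (wD lambda (drift R i) f).
Local Notation h i := (wD lambda (drift R i) (g i)).
Local Notation chi k := (@cutoff R n k).
Local Notation Dchi k i := (fun l => 'D_(drift R i) (@cutoff R n k) l).
Local Notation DDchi k i := (fun l => 'D_(drift R i) (Dchi k i) l).

Definition cutoff1 k i l : R := chi k l * g i l + Dchi k i l * f l.

(** The Leibniz rule applied to the two products in [cutoff1]; the equal mixed terms are left apart
    so as to match the sum of two weak derivatives. *)
Definition cutoff2 k i l : R := chi k l * h i l + Dchi k i l * g i l +
  (Dchi k i l * g i l + DDchi k i l * f l).

Let Lf : L2 mu f := proj1 Hf.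

Lemma cutoff_L2 k : [/\ L2 lambda (fun l => chi k l * f l),
  forall i, L2 lambda (cutoff1 k i) & forall i, L2 lambda (cutoff2 k i)].
Proof.
have tc := @test_cutoff R n k.
have tD i : test_function (Dchi k i) by exact: test_derive.
have tDD i : test_function (DDchi k i) by exact: test_derive.
split => [|i|i]; first exact: L2_localize.
  have [L1 _ _ _] := H22_spec (drift R i) Hf.
  by apply: L2_add; [exact: L2_localize|exact: (L2_localize hlambda (tD i) Lf)].
have [L1 _ L2' _] := H22_spec (drift R i) Hf.
apply: L2_add; apply: L2_add.
- exact: L2_localize.
- exact: (L2_localize hlambda (tD i)).
- exact: (L2_localize hlambda (tD i)).
- exact: (L2_localize hlambda (tDD i)).
Qed.

Lemma cutoff_support k : [/\ forall l, k.+1%:R < `|l| -> chi k l * f l = 0,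
  forall i l, k.+1%:R < `|l| -> cutoff1 k i l = 0 &
  forall i l, k.+1%:R < `|l| -> cutoff2 k i l = 0].
Proof.
have cz l (kl : k.+1%:R < `|l|) := @cutoff_eq0 R n k l kl.
have Dz i l (kl : k.+1%:R < `|l|) := derive_vanish (drift R i) cz kl.
have DDz i l (kl : k.+1%:R < `|l|) := derive_vanish (drift R i) (Dz i) kl.
split => [l kl|i l kl|i l kl]; first by rewrite cz// mul0r.
  by rewrite /cutoff1 cz// Dz// !mul0r addr0.
by rewrite /cutoff2 cz// Dz// DDz// !mul0r !addr0.
Qed.

Lemma cutoff_weak k i :
  weak_derivative lambda (drift R i) (fun l => chi k l * f l) (cutoff1 k i) /\
  weak_derivative lambda (drift R i) (cutoff1 k i) (cutoff2 k i).
Proof.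
have tc := @test_cutoff R n k; have tD : test_function (Dchi k i) by exact: test_derive.
have tDD : test_function (DDchi k i) by exact: test_derive.
have [L1 w1 L2' w2] := H22_spec (drift R i) Hf.
split; first exact: weak_derivative_mul.
have L2loc c u : test_function c -> L2 mu u -> L2 mu (fun l => c l * u l).
  by move=> tc' Lu; apply: (L2_haar_gaussian hlambda); exact: L2_localize.
apply: weak_derivative_add.
- exact: L2loc.
- exact: (L2loc _ _ tD).
- by apply: L2_add; [exact: L2loc|exact: (L2loc _ _ tD)].
- by apply: L2_add; [exact: (L2loc _ _ tD)|exact: (L2loc _ _ tDD)].
- exact: weak_derivative_mul.
- exact: (weak_derivative_mul hlambda tD Lf L1 w1).
Qed.

Definition genZ_cutoff k l : R := (2 * n%:R)^-1 * \sum_(i : 'Z_n)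
  (cutoff2 k i l + laplacian l i * cutoff1 k i l).

Lemma measurable_genZ_cutoff k : measurable_fun setT (genZ_cutoff k).
Proof.
have [_ L1 L2'] := cutoff_L2 k.
apply: measurable_funM => //; apply: measurable_sum => i.
apply: measurable_funD; first exact: L2_measurable (L2' i).
by apply: measurable_funM; [exact: measurable_laplacian|exact: L2_measurable (L1 i)].
Qed.

(** Dominated convergence. Besides [1 - chi] times the full second-order expression, the difference
    of generators contains only terms with a derivative of the cutoff, which decay like
    [1 / (k + 1)] at each point. *)
Lemma cutoff_approx e : 0 < e -> exists k,
  (sqint mu (fun l => (f l - chi k l * f l)%R) < e%:E)%E /\
  (sqint mu (fun l => (genZ lambda f l - genZ_cutoff k l)%R) < e%:E)%E.
Proof.
move=> e0.
have mf := L2_measurable Lf.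
have mc k : measurable_fun setT (chi k) := test_measurable (@test_cutoff R n k).
have hex i : exists M : R, 0 < M /\ forall k l, [/\ `|chi k l| <= M,
    `|1 - chi k l| <= M * k.+1%:R^-1 * `|l|, `|Dchi k i l| <= M * k.+1%:R^-1,
    `|DDchi k i l| <= M * k.+1%:R^-1 & forall j, `|laplacian l j * Dchi k i l| <= M].
  by have [M M0 hM] := cutoff_bounds (drift R i); exists M.
have [M hM] := choice hex.
have M0 i : 0 <= M i by case: (hM i) => /ltW.
have K1 (k : nat) : k.+1%:R^-1 <= 1 :> R := invS_le1 R k.
have K0 (k : nat) : 0 <= k.+1%:R^-1 :> R := ltW (invS_gt0 R k).
have c1 : sqint mu (fun l => f l - chi k l * f l) @[k --> \oo] --> 0%E.
  apply: (@sqint_cvg_dominated _ _ _ mu (fun k l => f l - chi k l * f l)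
    (fun l => (1 + M 0) * `|f l|)).
  - by move=> k; apply: measurable_funB => //; exact: measurable_funM.
  - move=> l; apply: (@harmonic_squeeze _ _ (M 0 * `|l| * `|f l|)) => k.
    have [_ /(_ k l)[_ h1 _ _ _]] := hM 0.
    rewrite -{1}[f l]mul1r -mulrBl normrM mulrAC ler_wpM2r// mulrAC; exact: h1.
  - by apply: L2_scale; exact: L2_norm.
  - move=> k l; have [_ /(_ k l)[h1 _ _ _ _]] := hM 0.
    rewrite -{1}[f l]mul1r -mulrBl normrM ler_wpM2r//.
    by rewrite (le_trans (ler_normB _ _))// normr1 lerD2l.
(* Square integrable as a whole thanks to [laplacian_L2], so it may appear in the dominating
   function. *)
pose a i l := h i l + laplacian l i * g i l.
have La i : L2 mu (a i).
  have [L1 w1 L2' w2] := H22_spec (drift R i) Hf.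
  by apply: L2_add => //; exact: (laplacian_L2 hlambda L1 L2' w2).
have Lg i : L2 mu (g i) by have [] := H22_spec (drift R i) Hf.
pose u k i l := (1 - chi k l) * a i l - 2 * (Dchi k i l * g i l) - DDchi k i l * f l
  - laplacian l i * Dchi k i l * f l.
have uE k l : genZ lambda f l - genZ_cutoff k l =
    (2 * n%:R)^-1 * \sum_(i : 'Z_n) u k i l.
  rewrite -mulrBr -sumrB; congr (_ * _); apply: eq_bigr => i _.
  by rewrite /u /a /cutoff1 /cutoff2; ring.
have /andP[n0 n1] := inv2n_itv.
have c2 : sqint mu (fun l => genZ lambda f l - genZ_cutoff k l) @[k --> \oo] --> 0%E.
  apply: (@sqint_cvg_dominated _ _ _ mu (fun k l => genZ lambda f l - genZ_cutoff k l)
    (fun l => \sum_(i : 'Z_n) ((1 + M i) * `|a i l| + 2 * M i * `|g i l| + 2 * M i * `|f l|))).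
  - move=> k; apply: measurable_funB; last exact: measurable_genZ_cutoff.
    exact: L2_measurable (genZ_L2 hlambda Hf).
  - move=> l; apply: (@harmonic_squeeze _ _ (\sum_(i : 'Z_n)
      (M i * `|l| * `|a i l| + 2 * M i * `|g i l| + M i * `|f l| +
       4 * `|l| * M i * `|f l|))) => k.
    rewrite uE normrM (ger0_norm n0); apply: (@le_trans _ _ `|\sum_(i : 'Z_n) u k i l|);
      first by apply: ler_piMl.
    rewrite (le_trans (ler_norm_sum _ _ _))// mulr_suml; apply: ler_sum => i _.
    have [_ /(_ k l)[_ h1 h2 h3 _]] := hM i.
    rewrite 3!(mulrDl _ _ k.+1%:R^-1) /u; apply: (le_trans (ler_normB4 _ _ _ _)).
    apply: lerD; first apply: lerD; first apply: lerD.
    + by rewrite normrM mulrAC ler_wpM2r// mulrAC.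
    + rewrite !normrM (ger0_norm (ler0n _ 2)) -!mulrA; rewrite ler_wpM2l// mulrA.
      by rewrite (mulrC _ (k.+1%:R^-1)) !mulrA ler_wpM2r// mulrC.
    + by rewrite normrM mulrAC ler_wpM2r.
    + rewrite !normrM [leRHS]mulrAC ler_wpM2r// -[leRHS]mulrA ler_pM//; exact: laplacian_le.
  - apply: L2_sum => i; apply: L2_add; first apply: L2_add.
    + by apply: L2_scale; exact: L2_norm (La i).
    + by apply: L2_scale; exact: L2_norm (Lg i).
    + by apply: L2_scale; exact: L2_norm.
  - move=> k l; rewrite uE normrM (ger0_norm n0); apply: (@le_trans _ _ `|\sum_(i : 'Z_n) u k i l|);
      first by apply: ler_piMl.
    rewrite (le_trans (ler_norm_sum _ _ _))//; apply: ler_sum => i _.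
    have [_ /(_ k l)[h0 _ h2 h3 h4]] := hM i.
    have h2' : `|Dchi k i l| <= M i by apply: le_trans h2 _; rewrite ler_piMr.
    have h3' : `|DDchi k i l| <= M i by apply: le_trans h3 _; rewrite ler_piMr.
    (* One copy dominates the term with the second derivative of the cutoff, the other the product
       of the Laplacian with its first derivative. *)
    have -> : 2 * M i * `|f l| = M i * `|f l| + M i * `|f l| by ring.
    rewrite /u addrA; apply: (le_trans (ler_normB4 _ _ _ _)).
    apply: lerD; first apply: lerD; first apply: lerD.
    + rewrite normrM ler_wpM2r// (le_trans (ler_normB _ _))// normr1 lerD2l//.
    + by rewrite !normrM (ger0_norm (ler0n _ 2)) -!mulrA ler_wpM2l// ler_wpM2r.
    + by rewrite normrM ler_wpM2r.
    + by rewrite normrM ler_wpM2r.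
have n1' := near_sqint_lt e0 c1 (fun k => sqint_ge0 _ _).
have n2' := near_sqint_lt e0 c2 (fun k => sqint_ge0 _ _).
have [k _ hk] : \forall k \near \oo,
  (sqint mu (fun l => (f l - chi k l * f l)%R) < e%:E)%E /\
  (sqint mu (fun l => (genZ lambda f l - genZ_cutoff k l)%R) < e%:E)%E.
  by apply: filterS2 n1' n2' => k.
by exists k; exact: (hk k (leqnn k)).
Qed.

End Cutoff.

Lemma sqint_sub_sym (m : {measure set S -> \bar R}) (u v : S -> R) :
  sqint m (fun l => u l - v l) = sqint m (fun l => v l - u l).
Proof. by apply: eq_integral => l _; rewrite -sqrrN opprB. Qed.

(** Classical derivatives of the mollified function are mollified weak derivatives, so a single
    scale serves all orders and directions; keeping it at most 1 bounds the support. *)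
Lemma mollify_second_order (F : S -> R) (F1 F2 : 'Z_n -> S -> R) (s e : R) : 0 < s -> 0 < e ->
  L2 lambda F -> (forall i, L2 lambda (F1 i)) -> (forall i, L2 lambda (F2 i)) ->
  (forall l, s < `|l| -> F l = 0) -> (forall i l, s < `|l| -> F1 i l = 0) ->
  (forall i l, s < `|l| -> F2 i l = 0) ->
  (forall i, weak_derivative lambda (drift R i) F (F1 i)) ->
  (forall i, weak_derivative lambda (drift R i) (F1 i) (F2 i)) ->
  exists2 phi, test_function phi & [/\ forall l, s + 1 < `|l| -> phi l = 0,
    (sqint lambda (fun l => (F l - phi l)%R) < e%:E)%E &
    forall i, (sqint lambda (fun l => (F1 i l - 'D_(drift R i) phi l)%R) < e%:E)%E /\
    (sqint lambda (fun l => (F2 i l -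
      'D_(drift R i) (fun l => 'D_(drift R i) phi l) l)%R) < e%:E)%E].
Proof.
move=> s0 e0 LF LF1 LF2 Fs F1s F2s w1 w2.
have [d d0 hd] := mollifier_cvg hlambda LF Fs e0.
have [d1 d10 hd1] := small_forall_fin (fun i => mollifier_cvg hlambda (LF1 i) (F1s i) e0).
have [d2 d20 hd2] := small_forall_fin (fun i => mollifier_cvg hlambda (LF2 i) (F2s i) e0).
pose t := Num.min (Num.min d d1) (Num.min d2 1).
have t0 : 0 < t by rewrite !lt_min d0 d10 d20 ltr01.
have td : t <= d by rewrite !ge_min lexx.
have td1 : t <= d1 by rewrite !ge_min lexx !orbT.
have td2 : t <= d2 by rewrite !ge_min lexx !orbT.
have t1 : t <= 1 by rewrite !ge_min lexx !orbT.
have tm := test_mollifier lambda t0.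
have iF := L2_support_integrable hlambda LF Fs.
have iF1 i := L2_support_integrable hlambda (LF1 i) (F1s i).
exists (conv lambda F (mollifier lambda t)).
  by apply: (conv_test iF _ tm); exists s.
split.
- move=> l sl; refine (@conv_vanish _ _ lambda F (mollifier lambda t) s t l Fs _ _) => [y yt|].
    exact: mollifier_eq0.
  by apply: le_lt_trans sl; rewrite lerD2l.
- by rewrite sqint_sub_sym; exact: hd.
- move=> i; have DE l : 'D_(drift R i) (conv lambda F (mollifier lambda t)) l =
    conv lambda (F1 i) (mollifier lambda t) l by exact: (derive_conv_weak _ iF (w1 i) tm).
  split; rewrite sqint_sub_sym.
    apply: le_lt_trans (hd1 t t0 td1 i); rewrite le_eqVlt; apply/orP; left; apply/eqP.
    by apply: eq_integral => l _; rewrite -DE.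
  apply: le_lt_trans (hd2 t t0 td2 i); rewrite le_eqVlt; apply/orP; left; apply/eqP.
  apply: eq_integral => l _; rewrite -(derive_conv_weak l (iF1 i) (w2 i) tm).
  have -> // : conv lambda (F1 i) (mollifier lambda t) =
    (fun l => 'D_(drift R i) (conv lambda F (mollifier lambda t)) l) by apply/funext => x; rewrite DE.
Qed.

(** A quarter of the budget goes to the cutoff and a quarter to mollifying the cut-off function. The
    latter lives in a fixed ball, where the Laplacian is bounded and smallness in L^2(lambda) passes
    to L^2(mu). *)
Lemma genZ_test_dense f e : H22 lambda f -> 0 < e -> exists2 phi, test_function phi &
  (sqint mu (fun l => (f l - phi l)%R) < e%:E)%E /\
  (sqint mu (fun l => (genZ lambda f l - genZ lambda phi l)%R) < e%:E)%E.
Proof.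
move=> Hf e0; have e4 : 0 < e / 4 by rewrite divr_gt0.
have [k [k1 k2]] := cutoff_approx Hf e4.
have [LF LF1 LF2] := cutoff_L2 Hf k.
have [Fs F1s F2s] := cutoff_support f k.
pose s : R := k.+1%:R; have s0 : 0 < s by rewrite ltr0n.
pose Zi := (gauss_mass lambda)^-1; have Zi0 : 0 < Zi by rewrite invr_gt0 gauss_mass_gt0.
pose c : R := (4 * (s + 1)) ^+ 2; have c0 : 0 <= c by rewrite sqr_ge0.
(* The share of one of the two summands of the generator in one direction. *)
pose b := e / 4 / 4 ^+ size (index_enum 'Z_n) / 4.
have b0 : 0 < b by rewrite !divr_gt0// exprn_gt0.
(* Dominates both conversion factors from L^2(lambda) to L^2(mu): [Zi] for plain functions and
   [c * Zi] for those multiplied by the Laplacian. *)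
pose C := Zi * (c + 1) + 1; have C0 : 0 < C by rewrite ltr_wpDl// mulr_ge0 ?addr_ge0// ltW.
pose e' := Num.min (e / 4) b / C.
have m0 : 0 < Num.min (e / 4) b by rewrite lt_min e4.
have e'0 : 0 < e' by rewrite divr_gt0.
have [phi tp [ps p1 p2]] := mollify_second_order s0 e'0 LF LF1 LF2 Fs F1s F2s
  (fun i => proj1 (cutoff_weak Hf k i)) (fun i => proj2 (cutoff_weak Hf k i)).
have small (q : R) u : 0 <= q -> q <= C -> (sqint lambda u < e'%:E)%E ->
    (q%:E * sqint lambda u < (Num.min (e / 4) b)%:E)%E.
  move=> q0 qC ue; apply: (@le_lt_trans _ _ (C%:E * sqint lambda u)%E).
    by apply: lee_wpmul2r; [exact: sqint_ge0|rewrite lee_fin].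
  apply: (@lt_le_trans _ _ (C%:E * e'%:E)%E); first by rewrite lte_pmul2l.
  by rewrite -EFinM lee_fin mulrCA divff ?mulr1// gt_eqF.
have ZiC : Zi <= C.
  by rewrite /C mulrDr mulr1 -addrA ler_wpDl ?lerDl// mulr_ge0// ltW.
have cZC : c * Zi <= C.
  by rewrite /C mulrDr mulr1 (mulrC c) -addrA lerDl addr_ge0// ltW.
exists phi => //; split.
  have -> : (fun l => f l - phi l) =
      (fun l => (f l - cutoff k l * f l) + (cutoff k l * f l - phi l)).
    by apply/funext => l; ring.
  have mF := L2_measurable LF; have mf := L2_measurable (proj1 Hf).
  have mp := test_measurable tp.
  apply: sqint_add_lt => //; [exact: measurable_funB|exact: measurable_funB|].
  apply: le_lt_trans (sqint_gaussian_le hlambda _) _; first exact: measurable_funB.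
  by apply: lt_le_trans (small _ _ (ltW Zi0) ZiC p1) _; rewrite lee_fin ge_min lexx.
have tD i := test_derive (drift R i) tp.
have mc := measurable_genZ_cutoff Hf k; have mg := L2_measurable (genZ_L2 hlambda Hf).
have mp := test_measurable (test_genZ_classical tp).
(* [genZ] involves chosen weak derivatives, which agree with the classical ones of [phi] only almost
   everywhere. *)
rewrite (@sqint_ae_eq _ _ _ mu _ (fun l => genZ lambda f l - genZ_classical phi l)); first last.
- by apply: filterS (genZ_test hlambda tp) => l ->.
- exact: measurable_funB.
- apply: measurable_funB => //; exact: L2_measurable (genZ_L2 hlambda (test_H22 hlambda tp)).
pose v i l := (cutoff2 f k i l - 'D_(drift R i) (fun l => 'D_(drift R i) phi l) l) +
  laplacian l i * (cutoff1 f k i l - 'D_(drift R i) phi l).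
have mv1 i : measurable_fun setT
    (fun l => cutoff2 f k i l - 'D_(drift R i) (fun l => 'D_(drift R i) phi l) l).
  apply: measurable_funB; first exact: L2_measurable (LF2 i).
  exact: test_measurable (test_derive _ (tD i)).
have mv2' i : measurable_fun setT (fun l => cutoff1 f k i l - 'D_(drift R i) phi l).
  apply: measurable_funB; first exact: L2_measurable (LF1 i).
  exact: test_measurable (tD i).
have mv2 i : measurable_fun setT
    (fun l => laplacian l i * (cutoff1 f k i l - 'D_(drift R i) phi l)).
  by apply: measurable_funM => //; exact: measurable_laplacian.
have vs i : (sqint mu (v i) < (e / 4 / 4 ^+ size (index_enum 'Z_n))%:E)%E.
  have [q1 q2] := p2 i; apply: sqint_add_lt => //.
    apply: le_lt_trans (sqint_gaussian_le hlambda (mv1 i)) _.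
    by apply: lt_le_trans (small _ _ (ltW Zi0) ZiC q2) _; rewrite lee_fin ge_min lexx orbT.
  apply: (@le_lt_trans _ _ ((c * Zi)%:E *
      sqint lambda (fun l => (cutoff1 f k i l - 'D_(drift R i) phi l)%R))%E).
    apply: sqint_laplacian_support => // l sl; rewrite F1s ?sub0r; last first.
      by apply: lt_trans sl; rewrite ltrDl.
    by rewrite (derive_vanish _ ps sl) oppr0.
  apply: lt_le_trans (small _ _ _ cZC q1) _; first by rewrite mulr_ge0// ltW.
  by rewrite lee_fin ge_min lexx orbT.
have -> : (fun l => genZ lambda f l - genZ_classical phi l) =
    (fun l => (genZ lambda f l - genZ_cutoff f k l) +
      (2 * n%:R)^-1 * \sum_(i : 'Z_n) v i l).
  apply/funext => l; have -> : (2 * n%:R)^-1 * \sum_(i : 'Z_n) v i l =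
      genZ_cutoff f k l - genZ_classical phi l.
    rewrite -mulrBr -sumrB; congr (_ * _); apply: eq_bigr => i _.
    by rewrite /v; ring.
  by rewrite addrA subrK.
have mS : measurable_fun setT (fun l => \sum_(i : 'Z_n) v i l).
  by apply: measurable_sum => i; apply: measurable_funD.
apply: sqint_add_lt => //; [exact: measurable_funB|exact: measurable_funM|].
apply: le_lt_trans (sqint_sum_lt e4 (fun i => measurable_funD (mv1 i) (mv2 i)) vs).
apply: sqint_le => l; have /andP[n0 n1] := inv2n_itv.
by rewrite normrM (ger0_norm n0) ler_piMl.
Qed.

Lemma test_function_core : is_core mu (H22 lambda) (genZ lambda) (@test_function R n).
Proof.
split.
- by move=> phi; exact: test_H22.
- exact: test_cst0.
- by move=> a f g tf tg; apply: test_add => //; exact: test_scale.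
- move=> f Hf e e0; have e2 : 0 < e ^+ 2 by rewrite exprn_gt0.
  have [phi tp [h1 h2]] := genZ_test_dense Hf e2.
  by exists phi; split => //; apply: norm2_lt.
Qed.

End CoreDensity.

(** * The walk before its first jump *)

Lemma ge0_integral_mono_in d (T : measurableType d) (R : realType)
  (m : {measure set T -> \bar R}) (D D' : set T) (f g : T -> \bar R) :
  (forall x, D x -> 0 <= f x)%E -> (forall x, D' x -> 0 <= g x)%E -> D `<=` D' ->
  (forall x, D x -> f x <= g x)%E -> (\int[m]_(x in D) f x <= \int[m]_(x in D') g x)%E.
Proof.
move=> f0 g0 DD' fg; rewrite integral_mkcond [leRHS]integral_mkcond.
apply: ge0_integral_mono => x; first exact: erestrict_ge0.
rewrite !patchE; case: ifPn => xD; last by apply: (erestrict_ge0 g0).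
by move: xD => /set_mem xD; rewrite mem_set ?fg//; exact: DD'.
Qed.

Lemma lebesgue_itvcc (R : realType) (a b : R) : a <= b ->
  @lebesgue_measure R `[a, b]%classic = (b - a)%:E.
Proof.
rewrite le_eqVlt => /predU1P[->|ab]; first by rewrite set_itv1 lebesgue_measure_set1 subrr.
by rewrite lebesgue_measure_itv/= lte_fin ab EFinB.
Qed.

Section TruncatedLine.
Variable R : realType.
Implicit Types a A s t T e : R.

Lemma Rintegral_itv_ge0_le (f : R -> R) s c : 0 <= s ->
  (forall r, 0 <= r <= s -> 0 <= f r <= c) ->
  0 <= \int[@lebesgue_measure R]_(r in `[0, s]) f r <= s * c.
Proof.
move=> s0 fc; have h : (\int[@lebesgue_measure R]_(r in `[0%R, s]) (f r)%:E <= (s * c)%:E)%E.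
  have <- : (\int[@lebesgue_measure R]_(r in `[0%R, s]) c%:E = (s * c)%:E)%E.
    by rewrite integral_cst//= lebesgue_itvcc// subr0 -EFinM mulrC.
  apply: ge0_integral_mono_in => // r /=; rewrite in_itv/= => /fc/andP[h1 h2];
  by rewrite lee_fin// (le_trans h1).
have h0 : (0 <= \int[@lebesgue_measure R]_(r in `[0%R, s]) (f r)%:E)%E.
  by apply: integral_ge0 => r /=; rewrite in_itv/= lee_fin => /fc/andP[].
rewrite /Rintegral; move: h h0; case: (integral _ _ _) => [x| |]//=.
by rewrite !lee_fin => -> ->.
Qed.

Lemma truncated_line_le a A s T : `|a| <= A -> 0 <= s <= T ->
  \int[@lebesgue_measure R]_(r in `[0, s]) Num.max (r + a) 0 <= s * (T + A).
Proof.
move=> aA /andP[s0 sT]; have A0 : 0 <= A := le_trans (normr_ge0 _) aA.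
have := @Rintegral_itv_ge0_le (fun r => Num.max (r + a) 0) s (T + A) s0.
case/(_ _)/andP => // r /andP[r0 rs]; rewrite le_max lexx orbT ge_max.
rewrite addr_ge0// ?(le_trans s0)// andbT lerD ?(le_trans rs)//.
exact: le_trans (ler_norm _) aA.
Qed.

Lemma truncated_line_unbounded a e : exists s, 0 <= s /\
  e <= \int[@lebesgue_measure R]_(r in `[0, s]) Num.max (r + a) 0.
Proof.
(* From time [q] on the rate is at least 1, so a further time [|e|] accumulates enough. *)
pose q := 1 + `|a|; have q0 : 0 <= q by rewrite addr_ge0.
pose s := q + `|e|; have s0 : 0 <= s by rewrite addr_ge0.
have qs : q <= s by rewrite lerDl.
exists s; split => //; apply: le_trans (ler_norm e) _.
have h1 : ((`|e|)%:E <= \int[@lebesgue_measure R]_(r in `[0%R, s]) (Num.max (r + a) 0)%:E)%E.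
  have <- : (\int[@lebesgue_measure R]_(r in `[q, s]) 1%:E = (`|e|)%:E)%E.
    by rewrite integral_cst//= lebesgue_itvcc// mul1e /s addrAC subrr add0r.
  apply: ge0_integral_mono_in => // r /=; rewrite ?in_itv/=.
  - by rewrite lee_fin le_max lexx orbT.
  - by move=> /andP[qr ->]; rewrite (le_trans q0).
  - move=> /andP[qr _]; rewrite lee_fin le_max; apply/orP; left.
    by move: qr (ler_norm (- a)); rewrite normrN /q; lra.
have h2 := @Rintegral_itv_ge0_le (fun r => Num.max (r + a) 0) s (s + `|a|) s0.
rewrite /Rintegral; apply: le_trans (_ : (_ <= fine (`|e|)%:E)) _ => //.
apply: fine_le => //.
rewrite ge0_fin_numE ?(le_trans _ h1) ?lee_fin//.
apply: (@le_lt_trans _ _ (\int[@lebesgue_measure R]_(r in `[0%R, s]) (s + `|a|)%:E)%E).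
  apply: ge0_integral_mono_in => // r /=; rewrite ?in_itv/= ?lee_fin ?le_max ?lexx ?orbT ?addr_ge0//.
  by move=> /andP[r0 rs]; rewrite ge_max addr_ge0// andbT lerD// ler_norm.
by rewrite integral_cst//= lebesgue_itvcc// -EFinM ltry.
Qed.

End TruncatedLine.

Section Path.
Variables (R : realType) (n : nat).
Local Notation S := (sumzero R n).
Local Notation N := (Zp_trunc n).+2.
Implicit Types (l : S) (i : 'Z_n) (t s : R).

(** Between jumps the current site rises at unit speed relative to its neighbours, so each rate is a
    truncated line of slope 1. The site [i + 1] differs from [i] because the cycle has at least two
    points. *)
Lemma rateR_line l i r : rateR (l + r *: drift R i) i = Num.max (r + - diffR l i) 0.
Proof.
rewrite /rateR /diffR !szcoordD !szcoordZ !drift_coord eqxx.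
have /negPf -> : i + 1 != i by rewrite -subr_eq0 addrAC subrr add0r oner_neq0.
by congr (Num.max _ _) => /=; ring.
Qed.

Lemma rateL_line l i r : rateL (l + r *: drift R i) i = Num.max (r + diffR l (i - 1)) 0.
Proof.
rewrite /rateL /diffR subrK !szcoordD !szcoordZ !drift_coord eqxx.
have /negPf -> : i - 1 != i by rewrite -subr_eq0 addrAC subrr add0r oppr_eq0 oner_neq0.
by congr (Num.max _ _) => /=; ring.
Qed.

Lemma diffR_norm l i : `|diffR l i| <= 2 * `|l|.
Proof.
by rewrite /diffR mulr_natl mulr2n (le_trans (ler_normB _ _))// lerD// coord_le_norm.
Qed.

Lemma ringing_ge0 (q : S -> 'Z_n -> R) l i e : 0 <= ringing q l i e.
Proof.
rewrite /ringing; set A := [set _ | _]; have [->|/set0P A0] := eqVneq A set0.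
  by rewrite inf0.
by apply: lb_le_inf => // s [].
Qed.

(* Since the rate grows linearly along the line, the set whose infimum defines
   the ringing time is not empty; this matters because inf set0 = 0. *)
Lemma ringing_gt (q : S -> 'Z_n -> R) l i a A t e :
  (forall r, q (l + r *: drift R i) i = Num.max (r + a) 0) -> `|a| <= A ->
  (* An infimum only yields a weak inequality, so the proof bounds the ringing time below by
     [2 * t]; on that time span the rate is at most [2 + A]. *)
  0 < t <= 1 -> 2 * t * (2 + A) < e -> t < ringing q l i e.
Proof.
move=> qa aA /andP[t0 t1] te; apply: (@lt_le_trans _ _ (2 * t)); first by lra.
have qE s : \int[@lebesgue_measure R]_(r in `[0, s]) q (l + r *: drift R i) i =
    \int[@lebesgue_measure R]_(r in `[0, s]) Num.max (r + a) 0 by exact: eq_Rintegral.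
apply: lb_le_inf => [|s [s0]].
  by have [s [s0 es]] := truncated_line_unbounded a e; exists s; split; rewrite ?qE.
rewrite qE => es; rewrite leNgt; apply/negP => st.
have := @truncated_line_le _ a A s 2 aA; rewrite s0/= => /(_ _)h.
have {}h := h ltac:(lra); have A0 : 0 <= A := le_trans (normr_ge0 _) aA.
have : s * (2 + A) <= 2 * t * (2 + A) by rewrite ler_wpM2r ?addr_ge0// ltW.
by move=> h'; have := lt_le_trans te (le_trans es (le_trans h h')); rewrite ltxx.
Qed.

Variables (e : nat * bool -> R) (x : S * 'Z_n).

Lemma jump_time_le (j k : nat) : (j <= k)%N -> (jump e x j).1 <= (jump e x k).1.
Proof.
move=> jk; rewrite -(subnKC jk); elim: (k - j)%N => [|m IH]; first by rewrite addn0.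
rewrite addnS (le_trans IH)//=; case: (jump e x (j + m)) => [t [l i]]/=.
by rewrite lerDl le_min !ringing_ge0.
Qed.

Lemma position_before_jump t s : t < (jump e x 1).1 -> 0 <= s <= t -> position e x s = x.2.
Proof.
move=> t1 /andP[s0 st]; rewrite /position; set A := [set _ | _].
have A2 : A x.2 by exists 0%N; split => //=; exact: le_lt_trans t1.
case: (xgetP x.2 A) => [y yE [k [k1 k2 ky]]|/(_ x.2)//].
(* Jump times are nondecreasing, so an index [k > 0] selected by [xget] would place the first jump
   before [t]. *)
case: k k1 k2 ky => [//|k] k1 _ _.
by have := le_lt_trans (le_trans (jump_time_le (ltn0Sn k)) (le_trans k1 st)) t1; rewrite ltxx.
Qed.

Lemma walk_before_jump t : 0 <= t -> t < (jump e x 1).1 ->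
  (walk e x t).1 = x.1 + t *: drift R x.2.
Proof.
move=> t0 t1; rewrite /walk/=; congr (_ + _).
have -> : local_time e x t = t *: delta_mx 0 x.2; last by rewrite centreZ.
apply/rowP => j; rewrite !mxE/=.
transitivity (\int[@lebesgue_measure R]_(s in `[0, t]) ((x.2 == j)%:R : R)).
  apply: eq_Rintegral => s; rewrite inE/= in_itv/= => s0t.
  by rewrite (position_before_jump t1).
by rewrite Rintegral_cst//= lebesgue_itvcc//= subr0 mulrC eq_sym.
Qed.

(** Valid for every realisation of the clocks, whatever the jumps: each local time is at most [t],
    and centring at most doubles the norm. *)
Lemma walk_dist t : 0 <= t -> `|(walk e x t).1 - x.1| <= 2 * t.
Proof.
move=> t0; rewrite /walk/= addrAC subrr add0r (le_trans (centre_norm _))// ler_wpM2l//.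
apply: rv_norm_le => // j; rewrite mxE ger0_norm.
  have /(_ _)/andP[|_] := @Rintegral_itv_ge0_le _ (fun s => (position e x s == j)%:R) t 1 t0.
    by move=> r _; case: (_ == _); rewrite ?lexx ?ler01.
  by rewrite mulr1.
by apply: Rintegral_ge0 => s _.
Qed.

Lemma walk_no_early_jump t r : 0 < t <= 1 -> `|x.1| <= r ->
  2 * t * (2 + 2 * r) < e (0%N, true) -> 2 * t * (2 + 2 * r) < e (0%N, false) ->
  (walk e x t).1 = x.1 + t *: drift R x.2.
Proof.
move=> t01 xr e1 e2; have /andP[t0 t1] := t01.
have dr i : `|diffR x.1 i| <= 2 * r by rewrite (le_trans (diffR_norm _ _))// ler_wpM2l.
apply: walk_before_jump; first exact: ltW.
rewrite /=; case: x xr dr => l i /= xr dr; rewrite add0r lt_min; apply/andP; split.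
  by apply: (ringing_gt (rateR_line l i)) t01 e1; rewrite normrN.
exact: (ringing_gt (rateL_line l i)) t01 e2.
Qed.

End Path.

Section Expectation.
Variables (d : measure_display) (T : measurableType d) (R : realType).
Variable P : probability T R.

(* No measurability of [F] is needed: the integral is the difference of the
   lower integrals of the positive and negative parts, which is monotone. *)
Lemma Rintegral_near_cst (F b : T -> R) (c M : R) : measurable_fun setT b ->
  (forall w, 0 <= b w <= M) -> (forall w, `|F w - c| <= b w) ->
  `|\int[P]_w F w - c| <= \int[P]_w b w.
Proof.
move=> mb bM Fb.
have ib : P.-integrable setT (EFin \o b).
  apply: (@le_integrable _ _ _ _ _ measurableT _ (cst M%:E)) => //; last first.
    exact: finite_measure_integrable_cst.
  - by move=> w _ /=; have /andP[b0 h] := bM w; rewrite lee_fin ger0_norm// (le_trans h) ?ler_norm.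
  - exact/measurable_EFinP.
have ic : P.-integrable setT (EFin \o cst c) by exact: finite_measure_integrable_cst.
have mono (u v : T -> R) : (forall w, u w <= v w) ->
    (\int[P]_w (u w)%:E <= \int[P]_w (v w)%:E)%E.
  move=> uv; rewrite (integralE _ _ (EFin \o u)) (integralE _ _ (EFin \o v)).
  apply: leeB; apply: ge0_integral_mono => // w.
    by rewrite !funeposE/= ge_max !le_max lee_fin uv lexx orbT.
  by rewrite !funenegE/= ge_max !le_max lee_fin lerN2 uv lexx orbT.
have Pc : \int[P]_w (cst c) w = c by rewrite Rintegral_cst//= probability_setT mulr1.
have up : (\int[P]_w (F w)%:E <= (c + \int[P]_w b w)%:E)%E.
  apply: le_trans (mono F (fun w => c + b w) _) _ => [w|].
    by have := Fb w; rewrite ler_norml => /andP[_]; rewrite lerBlDl.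
  rewrite -{2}Pc -(RintegralD measurableT ic ib) fineK//.
  exact/integrable_fin_num/(integrableD measurableT ic ib).
have dn : ((c - \int[P]_w b w)%:E <= \int[P]_w (F w)%:E)%E.
  apply: (le_trans _ (mono (fun w => c - b w) F _)) => [|w]; last first.
    by have := Fb w; rewrite ler_norml => /andP[h _]; lra.
  rewrite -{1}Pc -(RintegralB measurableT ic ib) fineK//.
  exact/integrable_fin_num/(integrableB measurableT ic ib).
have Ffin : (\int[P]_w (F w)%:E)%E \is a fin_num.
  by rewrite fin_numElt (lt_le_trans _ dn) ?ltNyr// (le_lt_trans up) ?ltry.
move: up dn; rewrite -(fineK Ffin) !lee_fin -/(Rintegral _ _ _) => up dn.
by rewrite ler_norml; apply/andP; split; lra.
Qed.

End Expectation.

Lemma exponential1_le (R : realType) (s : R) : 0 <= s ->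
  (exponential_prob 1 `]-oo, s]%classic <= s%:E)%E.
Proof.
move=> s0; rewrite /exponential_prob integral_mkcond.
have <- : (\int[@lebesgue_measure R]_(r in `[0%R, s]) 1%:E = s%:E)%E.
  by rewrite integral_cst//= lebesgue_itvcc// subr0 mul1e.
rewrite [leRHS]integral_mkcond; apply: ge0_integral_mono => x.
  by apply: erestrict_ge0 => r _; rewrite lee_fin exponential_pdf_ge0.
rewrite !patchE; case: ifPn => [|_]; last by case: ifPn => _; rewrite ?lee_fin ?ler01.
rewrite inE/= in_itv/= => xs; have [x0|x0] := ltP x 0.
  by rewrite lt0_exponential_pdf//; case: ifPn => _; rewrite ?lee_fin ?ler01.
rewrite mem_set/=; last by rewrite in_itv/= x0.
by rewrite exponential_pdfE// lee_fin mul1r -[leRHS]expR0 ler_expR mulN1r lerNl oppr0.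
Qed.

(** * Uniform short-time expansion of the semigroup *)

Section ShortTime.
Variables (R : realType) (n : nat) (d : measure_display) (Om : measurableType d).
Variables (P : probability Om R) (E : nat * bool -> {RV P >-> R}).
Hypothesis hE : iid_exp1 E.
Local Notation S := (sumzero R n).
Local Notation N := (Zp_trunc n).+2.
Implicit Types (f g : S -> R) (x : S * 'Z_n).

Lemma measurable_clock_le k s : measurable [set w | E k w <= s].
Proof. exact: (measurable_funPTI (E k) (measurable_itv `]-oo, s])). Qed.

Definition early (s : R) : set Om :=
  [set w | E (0%N, true) w <= s] `|` [set w | E (0%N, false) w <= s].

Lemma measurable_early s : measurable (early s).
Proof.
exact: measurableU (measurable_clock_le _ _) (measurable_clock_le _ _).
Qed.

Lemma early_prob s : 0 <= s -> (P (early s) <= (2 * s)%:E)%E.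
Proof.
move=> s0; have h k : (P [set w | (E k w <= s)%R] <= s%:E)%E.
  have [_ /(_ k `]-oo, s]%classic (measurable_itv _))] := hE.
  by rewrite /distribution /pushforward => eq; apply: le_trans (exponential1_le s0); rewrite -eq.
rewrite (le_trans (measureU2 _ (measurable_clock_le _ _) (measurable_clock_le _ _)))// mulr_natl mulr2n EFinD.
by apply: leeD; exact: h.
Qed.

(** The transport part of the formal generator; its jump terms vanish on functions of the profile
    alone. *)
Definition lift_drift f x : R := 'D_(drift R x.2) f x.1.

Lemma walk_taylor f : test_function f -> exists2 K : R, 0 < K & forall x (t : R), 0 < t <= 1 ->
  `|t^-1 * (walk_semigroup E t (f \o fst) x - f x.1) - lift_drift f x| <= K * t.
Proof.
move=> tf; have [_ [r r0 fr]] := (test_functionP f).1 tf.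
have [L L0 hL] := test_lipschitz tf.
have hex i : exists M : R, 0 < M /\
    ((forall l h, `|f (l + h *: drift R i) - f l - h * 'D_(drift R i) f l| <= M * h ^+ 2)
    /\ (forall l, `|'D_(drift R i) f l| <= M)).
  have [M1 M10 h1] := test_taylor2 (drift R i) tf.
  have [M2 M20 h2] := test_bounded (test_derive (drift R i) tf).
  exists (M1 + M2); split; first by rewrite addr_gt0.
  split => [l h|l]; [apply: le_trans (h1 l h) _|apply: le_trans (h2 l) _].
    by rewrite ler_wpM2r ?sqr_ge0// lerDl ltW.
  by rewrite lerDr ltW.
have [Mi hMi] := choice hex.
pose M := \sum_i Mi i; have Mi0 i : 0 < Mi i by case: (hMi i).
have MiM i : Mi i <= M.
  by rewrite /M (bigD1 i)//= lerDl sumr_ge0// => j _; exact: ltW.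
have M0 : 0 < M by exact: lt_le_trans (Mi0 0) (MiM 0).
(* [t * B] is the clock threshold of [walk_no_early_jump] for profiles of norm at most [r + 2]. *)
pose B : R := 2 * (2 + 2 * (r + 2)); have B0 : 0 < B by rewrite /B; lra.
have LM0 : 0 < 2 * L + M by rewrite addr_gt0// mulr_gt0.
(* The Taylor error [M * t ^+ 2], plus the crude error [t * (2 * L + M)] times the bound [2 * t * B]
   on the probability of an early clock, divided by [t]. *)
exists (M + (2 * L + M) * (2 * B)).
  by apply: addr_gt0 => //; apply: mulr_gt0 => //; exact: mulr_gt0.
move=> x t t01; have /andP[t0 t1] := t01.
have [hM1 hM2] := (hMi x.2).2.
pose b w := M * t ^+ 2 + t * (2 * L + M) * \1_(early (t * B)) w.
have mb : measurable_fun setT b.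
  apply: measurable_funD => //; apply: measurable_funM => //.
  exact/measurable_indic/measurable_early.
have q0 : 0 <= t * (2 * L + M) by rewrite mulr_ge0// ltW.
have bM w : 0 <= b w <= M * t ^+ 2 + t * (2 * L + M).
  rewrite /b indicE; case: (_ \in _); rewrite ?mulr1 ?mulr0 ?addr0 ?lexx ?andbT.
    by rewrite addr_ge0// mulr_ge0 ?sqr_ge0// ltW.
  by rewrite mulr_ge0 ?sqr_ge0 ?lerDl// ltW.
have Fb w : `|f (walk (fun k => E k w) x t).1 - (f x.1 + t * lift_drift f x)| <= b w.
  rewrite /b; set e := fun k => E k w.
  have wd := walk_dist e x (ltW t0).
  have Mt0 : 0 <= M * t ^+ 2 by rewrite mulr_ge0 ?sqr_ge0// ltW.
  have i0 : 0 <= (\1_(early (t * B)) w : R) by rewrite indicE.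
  (* Starting further out, the profile moves by at most [2 * t <= 2] and stays outside the support
     of [f], so everything vanishes. The margin 2 has this purpose. *)
  have [xr|xr] := leP `|x.1| (r + 2); last first.
    rewrite /lift_drift (derive_vanish _ fr); last by rewrite (lt_trans _ xr)// ltrDl.
    rewrite (fr x.1); last by rewrite (lt_trans _ xr)// ltrDl.
    rewrite fr; first by rewrite mulr0 addr0 subr0 normr0 addr_ge0// mulr_ge0.
    by have := ler_distD (walk e x t).1 x.1 0; rewrite !subr0 distrC; lra.
  have [/[!inE] we|we] := boolP (w \in early (t * B)); last first.
    have [w1 w2] : (t * B < E (0%N, true) w) /\ (t * B < E (0%N, false) w).
      move: we; rewrite notin_setE => we.
      by split; rewrite ltNge; apply/negP => h; apply: we; [left|right].
    have BE : 2 * t * (2 + 2 * (r + 2)) = t * B by rewrite /B; ring.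
    rewrite (walk_no_early_jump t01 xr) ?BE// opprD addrA.
    apply: le_trans (hM1 _ _) _; apply: le_trans (_ : M * t ^+ 2 <= _).
      by rewrite ler_wpM2r ?sqr_ge0.
    by rewrite lerDl mulr_ge0.
  rewrite indicE mem_set// mulr1 opprD addrA.
  apply: le_trans (ler_normB _ _) _; apply: le_trans (_ : t * (2 * L + M) <= _); last by rewrite lerDr.
  rewrite mulrDr; apply: lerD.
    rewrite (_ : t * (2 * L) = L * (2 * t)); last by ring.
    by apply: le_trans (hL _ _) _; rewrite ler_wpM2l// ltW.
  rewrite normrM gtr0_norm//; apply: ler_wpM2l; [exact: ltW|exact: le_trans (hM2 _) (MiM _)].
have := Rintegral_near_cst P mb bM Fb.
have ib : \int[P]_w b w <= M * t ^+ 2 + t * (2 * L + M) * (2 * (t * B)).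
  have mE := measurable_early (t * B).
  have iE : P.-integrable setT (EFin \o \1_(early (t * B))) by exact: integrable_indic.
  rewrite /b RintegralD//; last 2 first.
  - exact: finite_measure_integrable_cst.
  - exact: (integrableZl measurableT (t * (2 * L + M)) iE).
  rewrite Rintegral_cst//= probability_setT mulr1 RintegralZl// lerD2l ler_wpM2l//.
  rewrite /Rintegral integral_indic// setIT -lee_fin fineK ?fin_num_measure//.
  by apply: early_prob; rewrite mulr_ge0// ltW.
have -> : t^-1 * (walk_semigroup E t (f \o fst) x - f x.1) - lift_drift f x =
    t^-1 * (walk_semigroup E t (f \o fst) x - (f x.1 + t * lift_drift f x)).
  by rewrite opprD addrA [RHS]mulrBr mulrA mulVf ?mul1r// gt_eqF.
rewrite normrM (gtr0_norm (_ : 0 < t^-1)) ?invr_gt0// => /le_trans/(_ ib) h.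
rewrite ler_pdivrMl//; apply: (le_trans h); rewrite le_eqVlt; apply/orP; left.
by apply/eqP; ring.
Qed.

End ShortTime.

Lemma bounded_integrable d (T : measurableType d) (R : realType)
  (m : {measure set T -> \bar R}) (f : T -> R) (M : R) : (m setT < +oo)%E ->
  measurable_fun setT f -> (forall x, `|f x| <= M) -> m.-integrable setT (EFin \o f).
Proof.
move=> mT mf fM; apply/integrableP; split; first exact/measurable_EFinP.
apply: (@le_lt_trans _ _ (\int[m]_x M%:E)%E).
  by apply: ge0_integral_mono => x; rewrite ?abse_ge0//= lee_fin.
by rewrite integral_cst//= -ge0_fin_numE ?fin_numM// ?ge0_fin_numE// mule_ge0// lee_fin (le_trans _ (fM point)).
Qed.

Lemma sqint_bounded_le d (T : measurableType d) (R : realType)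
  (m : {measure set T -> \bar R}) (f : T -> R) (M : R) :
  (forall x, `|f x| <= M) -> (sqint m f <= (M ^+ 2)%:E * m setT)%E.
Proof.
move=> fM; rewrite -integral_cst//; apply: ge0_integral_mono => x; rewrite lee_fin ?sqr_ge0//.
by rewrite -(real_normK (num_real (f x))) lerXn2r ?nnegrE// (le_trans _ (fM x)).
Qed.

(** * Integration against the uniform and the product measure *)

Section Unif.
Variables (R : realType) (n : nat).
Local Notation N := (Zp_trunc n).+2.
Local Notation unif := (unif R n).

Lemma unif_integral (h : 'Z_n -> R) :
  (\int[unif]_i (h i)%:E = (N%:R^-1 * \sum_(i : 'Z_n) h i)%:E)%E.
Proof.
have counting1 i : @counting 'Z_n R [set i] = 1%E.
  rewrite /counting asboolT; last exact: finite_set1. by rewrite fset_set1 finmap.cardfs1.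
have sumE (h' : 'Z_n -> R) : (\int[unif]_i (h' i)%:E =
    \sum_(i : 'Z_n) (h' i)%:E * unif [set i])%E.
  have TE : [set: 'Z_n] = \big[setU/set0]_(i <- index_enum 'Z_n) [set i].
    apply/seteqP; split => // i _; rewrite -bigcup_seq; exists i => //=.
    exact: mem_index_enum.
  rewrite {1}TE integral_bigsetU_EFin//.
  - apply: eq_bigr => i _; rewrite -integral_cst//.
    by apply: eq_integral => j; rewrite inE => ->.
  - exact: index_enum_uniq.
  - by move=> i j _ _ [k [-> ->]].
have fT : finite_set [set: 'Z_n] by exact: finite_finset.
have cT0 : @counting 'Z_n R setT != 0%E.
  apply/negP => /eqP c0; have : (@counting 'Z_n R [set (0%R : 'Z_n)] <= @counting 'Z_n R setT)%E.
    by apply: (le_measure (@counting 'Z_n R)); rewrite ?inE.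
  by rewrite c0 counting1 leNgt lte_fin ltr01.
have cTy : @counting 'Z_n R setT != +oo%E by rewrite /counting asboolT.
pose c := (fine (@counting 'Z_n R setT))^-1.
have cE i : unif [set i] = c%:E.
  by rewrite /Defs.unif/= /mnormalize (negPf cT0) (negPf cTy)/= counting1 mul1e.
(* The normalising constant is found by integrating 1 against the probability measure. *)
have cN : N%:R * c = 1.
  have /= := sumE (fun=> 1); rewrite integral_cst//= probability_setT mule1.
  under eq_bigr do rewrite cE mul1e.
  by rewrite sumEFin sumr_const card_ord mulr_natl => -[<-].
rewrite sumE; under eq_bigr do rewrite cE -EFinM.
rewrite sumEFin -mulr_suml mulrC; congr (_ * _)%:E.
by apply: (mulfI (_ : N%:R != 0)); rewrite ?pnatr_eq0// cN divff// pnatr_eq0.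
Qed.

End Unif.

Section Lift.
Variables (R : realType) (n : nat).
Local Notation S := (sumzero R n).
Local Notation N := (Zp_trunc n).+2.
Variable lambda : {measure set S -> \bar R}.
Local Notation mu := (gaussian lambda).
Local Notation muhat := (gaussian_unif lambda).
Implicit Types (f g : S -> R) (F G : S * 'Z_n -> R) (x : S * 'Z_n).

Lemma gaussian_unif_setT : muhat setT = 1%E.
Proof.
by rewrite /gaussian_unif -setXTT [LHS]product_measure1E//= !probability_setT mule1.
Qed.

(** With a finite second factor, [F] is a finite sum of slices times indicators. *)
Lemma measurable_fun_prod_fin F : (forall i, measurable_fun setT (fun l => F (l, i))) ->
  measurable_fun setT F.
Proof.
move=> mF; have -> : F = fun x => \sum_(i : 'Z_n) F (x.1, i) * \1_[set i] x.2.
  apply/funext => -[l i]/=; rewrite (bigD1 i)//= big1 => [|j ji].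
    by rewrite indicE mem_set// mulr1 addr0.
  by rewrite indicE memNset ?mulr0//= => ij; rewrite ij eqxx in ji.
apply: measurable_sum => i; apply: measurable_funM.
  exact: (measurableT_comp (mF i) measurable_fst).
by apply: (measurableT_comp _ measurable_snd); exact: measurable_indic.
Qed.

Lemma Rintegral_gaussian_unif F (M : R) : measurable_fun setT F -> (forall x, `|F x| <= M) ->
  \int[muhat]_x F x = N%:R^-1 * \sum_(i : 'Z_n) \int[mu]_l F (l, i).
Proof.
move=> mF FM; rewrite /Rintegral.
have iF : muhat.-integrable setT (EFin \o F).
  by apply: (bounded_integrable _ mF FM); rewrite gaussian_unif_setT ltry.
rewrite -(integral21_prod_meas1 iF) /fubini_G.
transitivity (fine (\int[unif R n]_i (fine (\int[mu]_l (F (l, i))%:E))%:E)).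
  congr fine; apply: eq_integral => i _; rewrite fineK//.
  apply/integrable_fin_num => //; apply: (@bounded_integrable _ _ _ _ _ M) => //.
    exact: le_lt_trans (probability_le1 _ measurableT) (ltry 1).
  exact: measurableT_comp mF (pair2_measurable i).
by rewrite unif_integral.
Qed.


End Lift.

(** * The generator of the lifted process *)

Lemma Rintegral_sum d (T : measurableType d) (R : realType) (m : {measure set T -> \bar R})
  (I : Type) (s : seq I) (u : I -> T -> R) :
  (forall i, m.-integrable setT (EFin \o u i)) ->
  \int[m]_x (\sum_(i <- s) u i x) = \sum_(i <- s) \int[m]_x u i x.
Proof.
move=> iu; have isum r : m.-integrable setT (EFin \o (fun x => \sum_(i <- r) u i x)).
  elim: r => [|i r IH].
    by under eq_fun do rewrite big_nil; exact: integrable0.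
  under eq_fun do rewrite big_cons; exact: (integrableD measurableT (iu i) IH).
elim: s => [|i s IH].
  by rewrite big_nil; under eq_Rintegral do rewrite big_nil; rewrite Rintegral_cst// mul0r.
rewrite big_cons -IH; under eq_Rintegral do rewrite big_cons.
by rewrite (RintegralD measurableT (iu i) (isum s)).
Qed.

(** * The Dirichlet form of the diffusion on test functions *)

Section DirichletForm.
Variables (R : realType) (n : nat).
Local Notation S := (sumzero R n).
Variable lambda : {measure set S -> \bar R}.
Hypothesis hlambda : is_haar lambda.
Local Notation mu := (gaussian lambda).
Implicit Types (f g : S -> R).

Lemma test_integrable_gaussian f : test_function f -> mu.-integrable setT (EFin \o f).
Proof.
move=> tf; have [M _ hM] := test_bounded tf.
apply: (@bounded_integrable _ _ _ _ _ M) => //; last exact: test_measurable.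
exact: le_lt_trans (probability_le1 _ measurableT) (ltry 1).
Qed.

Lemma Rintegral_mul_derive_sum0 f g : test_function f -> test_function g ->
  \sum_(i : 'Z_n) \int[mu]_l ('D_(drift R i) f l * g l) = 0.
Proof.
move=> tf tg; rewrite -Rintegral_sum => [|i]; last first.
  apply: test_integrable_gaussian; apply: test_mul tg.
  exact: test_smooth (test_derive _ tf).
under eq_Rintegral do rewrite -mulr_suml test_derive_drift_sum0// mul0r.
by rewrite Rintegral_cst// mul0r.
Qed.

(** Each direction is integrated by parts with the test function [f] times the derivative of [g]:
    the product rule produces both the integrand of the generator and the product of derivatives. *)
Lemma inner_genZ f g : test_function f -> test_function g ->
  - inner mu f (genZ lambda g) =
  (2 * n%:R)^-1 * \sum_(i : 'Z_n) \int[mu]_l ('D_(drift R i) f l * 'D_(drift R i) g l).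
Proof.
move=> tf tg; have sf := test_smooth tf.
pose v i l := f l * ('D_(drift R i) (fun l => 'D_(drift R i) g l) l +
  laplacian l i * 'D_(drift R i) g l).
pose u i l := 'D_(drift R i) f l * 'D_(drift R i) g l.
have tD i : test_function (fun l => 'D_(drift R i) g l) by exact: test_derive.
have tv i : test_function (v i).
  apply: test_mul => //; apply: test_add; first exact: test_derive.
  by apply: test_mul => //; exact: smooth_laplacian.
have tu i : test_function (u i).
  by apply: test_mul => //; exact: test_smooth (test_derive _ tf).
have uv i : \int[mu]_l v i l = - \int[mu]_l u i l.
  apply/eqP; rewrite -addr_eq0 addrC; apply/eqP.
  rewrite -(RintegralD measurableT (test_integrable_gaussian (tu i)) (test_integrable_gaussian (tv i))).
  rewrite (Rintegral_gaussian hlambda); last exact: test_measurable (test_add (tu i) (tv i)).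
  rewrite -(gaussian_ibp hlambda i (test_mul sf (tD i))).
  apply: eq_Rintegral => l _; rewrite deriveM_smooth//; last exact: test_smooth.
  by rewrite /u /v; ring.
have mf := test_measurable tf.
rewrite /inner (@Rintegral_ae_eq _ _ _ mu _ (fun l => f l * genZ_classical g l)).
- transitivity (- \int[mu]_l ((2 * n%:R)^-1 * \sum_(i : 'Z_n) v i l)).
    by congr (- _); apply: eq_Rintegral => l _; rewrite /genZ_classical mulrCA mulr_sumr.
  under eq_Rintegral do rewrite mulr_sumr.
  rewrite (Rintegral_sum _ (fun i => test_integrable_gaussian (test_scale _ (tv i)))).
  rewrite mulr_sumr -sumrN; apply: eq_bigr => i _.
  by rewrite RintegralZl//; [rewrite uv mulrN opprK|exact: test_integrable_gaussian].
- apply: measurable_funM => //; exact: L2_measurable (genZ_L2 hlambda (test_H22 hlambda tg)).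
- by apply: measurable_funM => //; exact: test_measurable (test_genZ_classical tg).
- by apply: filterS (genZ_test hlambda tg) => l ->.
Qed.

End DirichletForm.

Section Generator.
Variables (R : realType) (n : nat).
Local Notation S := (sumzero R n).
Local Notation N := (Zp_trunc n).+2.
Variable lambda : {measure set S -> \bar R}.
Hypothesis hlambda : is_haar lambda.
Variables (d : measure_display) (Om : measurableType d) (P : probability Om R).
Variable E : nat * bool -> {RV P >-> R}.
Hypothesis hE : iid_exp1 E.
Local Notation mu := (gaussian lambda).
Local Notation muhat := (gaussian_unif lambda).
Local Notation semigroup := (@walk_semigroup R n d Om P E).
Implicit Types (f g : S -> R) (x : S * 'Z_n).

Lemma measurable_lift_drift f : test_function f -> measurable_fun setT (@lift_drift R n f).
Proof.
move=> tf; apply: measurable_fun_prod_fin => i.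
exact: test_measurable (test_derive (drift R i) tf).
Qed.

Lemma lift_drift_bounded f : test_function f -> exists M : R, forall x, `|lift_drift f x| <= M.
Proof.
move=> tf; have hex i : exists M : R, forall l, `|'D_(drift R i) f l| <= M.
  by have [M _ hM] := test_bounded (test_derive (drift R i) tf); exists M.
have [M hM] := choice hex; exists (\sum_i M i) => -[l i] /=.
rewrite (bigD1 i)//= ler_wpDr ?hM// sumr_ge0// => j _.
exact: le_trans (normr_ge0 _) (hM j 0).
Qed.

Lemma L2_gaussian_unif_bounded (F : S * 'Z_n -> R) (M : R) : measurable_fun setT F ->
  (forall x, `|F x| <= M) -> L2 muhat F.
Proof.
move=> mF FM; apply/L2P; split => //; apply: le_lt_trans (sqint_bounded_le _ FM) _.
by rewrite gaussian_unif_setT mule1 ltry.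
Qed.

Lemma lift_drift_L2 f : test_function f -> L2 muhat (@lift_drift R n f).
Proof.
move=> tf; have [M hM] := lift_drift_bounded tf.
exact: L2_gaussian_unif_bounded (measurable_lift_drift tf) hM.
Qed.

Lemma test_fst_L2 f : test_function f -> L2 muhat (f \o fst).
Proof.
move=> tf; have [M _ hM] := test_bounded tf.
apply: (@L2_gaussian_unif_bounded _ M); last by move=> x; exact: hM.
by apply: measurable_fun_prod_fin => i; exact: test_measurable tf.
Qed.

(** The expansion error is at most [K * t] at every state, hence also in L^2 of a probability
    measure, with no question of measurability of the semigroup. *)
Lemma lift_drift_has_gen f : test_function f ->
  has_gen muhat semigroup (f \o fst) (@lift_drift R n f).
Proof.
move=> tf; split; first exact: lift_drift_L2.
have [K K0 hK] := walk_taylor hE tf.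
have c0 : (fun t : R => (K * t)%:E) @ 0^'+ --> 0%E.
  apply: cvg_EFin; first by near=> t.
  rewrite /comp/= -[X in _ --> X](mulr0 K); apply: cvgM; first exact: cvg_cst.
  exact: cvg_at_right_filter.
apply: (squeeze_cvge _ (cvg_cst 0%E) c0); near=> t.
rewrite norm2E poweR_ge0/=.
have t01 : 0 < t <= 1.
  by apply/andP; split; near: t; [exact: nbhs_right_gt|exact: nbhs_right_le].
have t0 : 0 < t by case/andP: t01.
rewrite -norm2E; apply: norm2_le; first by rewrite mulr_ge0// ltW.
apply: le_trans (sqint_bounded_le muhat (M := K * t) _) _ => [x|]; first exact: hK.
by rewrite gaussian_unif_setT mule1.
Unshelve. all: by end_near. Qed.

(** Uniqueness of the L^2 limit. The difference quotient is not known to be measurable, so the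
    triangle inequality cannot be applied to it; the proof passes through a measurable minorant
    instead. *)
Lemma has_gen_lift_ae f (g : S * 'Z_n -> R) : test_function f ->
  has_gen muhat semigroup (f \o fst) g -> {ae muhat, forall x, g x = lift_drift f x}.
Proof.
move=> tf [Lg hg]; have [K K0 hK] := walk_taylor hE tf.
have mg := L2_measurable Lg; have mD := measurable_lift_drift tf.
suff : sqint muhat (fun x => g x - lift_drift f x) = 0%E.
  move/(sqint0_ae (measurable_funB mg mD)); apply: filterS => x /eqP.
  by rewrite subr_eq0 => /eqP.
apply: sqint_lt0 => e e0.
pose s := Num.sqrt (e / 4); have e4 : 0 < e / 4 by rewrite divr_gt0.
have s0 : 0 < s by rewrite sqrtr_gt0.
have sE : s ^+ 2 = e / 4 by rewrite sqr_sqrtr// ltW.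
have : \forall t \near 0^'+, [/\ 0 < t <= 1, K * t < s &
    (norm2 muhat (fun x => (t^-1 * (semigroup t (f \o fst) x - (f \o fst) x) - g x)%R) < s%:E)%E].
  near=> t; split.
  - by apply/andP; split; near: t; [exact: nbhs_right_gt|exact: nbhs_right_le].
  - rewrite mulrC -ltr_pdivlMr//; near: t; apply: nbhs_right_lt; exact: divr_gt0.
  - near: t; move: hg => /(_ [set y | (y < s%:E)%E]); apply.
    by apply: open_nbhs_nbhs; split; [exact: open_ereal_lt_ereal|rewrite /= lte_fin].
move=> /(@filter_ex _ _ (at_right_proper_filter 0))[t [t01 Kt ht]].
have t0 : 0 < t by case/andP: t01.
pose u x := t^-1 * (semigroup t (f \o fst) x - (f \o fst) x).
(* Built from measurable functions only. By the uniform expansion it lies below the distance from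
   the quotient [u] to [g], and adding [K * t] recovers a bound on the difference of interest. *)
pose v x := Num.max (`|g x - lift_drift f x| - K * t) 0.
have mv : measurable_fun setT v.
  apply: measurable_maxr => //; apply: measurable_funB => //.
  by apply: measurableT_comp => //; exact: measurable_funB.
apply: (@le_lt_trans _ _ (sqint muhat (fun x => v x + K * t)%R)).
  apply: sqint_le => x; apply: le_trans (ler_norm _); rewrite /v -lerBlDr le_max lexx//.
apply: sqint_add_lt => //.
  apply: le_lt_trans (_ : sqint muhat (fun x => u x - g x)%R < _)%E.
    apply: sqint_le => x; rewrite ger0_norm; last by rewrite /v le_max lexx orbT.
    rewrite /v ge_max normr_ge0 andbT lerBlDr.
    have := hK x t t01; rewrite -/(u x) => h.
    by apply: le_trans (ler_distD (u x) _ _) _; rewrite (distrC (g x)) lerD2l.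
  by rewrite -sE; exact: sqint_norm2_lt.
apply: le_lt_trans (sqint_bounded_le muhat (M := K * t) _) _ => [x|].
  by rewrite ger0_norm// mulr_ge0// ltW.
by rewrite gaussian_unif_setT mule1 lte_fin -sE ltrXn2r ?nnegrE// ltW// mulr_gt0.
Unshelve. all: by end_near. Qed.

(** [gen] picks some limit; existence makes the pick a genuine one and uniqueness identifies it
    almost everywhere. *)
Lemma gen_lift_ae f : test_function f ->
  L2 muhat (gen muhat semigroup (f \o fst)) /\
  {ae muhat, forall x, gen muhat semigroup (f \o fst) x = lift_drift f x}.
Proof.
move=> tf; have := lift_drift_has_gen tf.
move=> h; have hg : has_gen muhat semigroup (f \o fst) (gen muhat semigroup (f \o fst)).
  exact: (@xgetPex _ (cst 0) [set g | has_gen muhat semigroup (f \o fst) g] (ex_intro _ _ h)).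
by split; [case: hg|exact: has_gen_lift_ae].
Qed.

Lemma inner_lift_fst f g : test_function f -> test_function g ->
  inner muhat (gen muhat semigroup (f \o fst)) (g \o fst) = 0.
Proof.
move=> tf tg; have [Lf aef] := gen_lift_ae tf.
have mD := measurable_lift_drift tf; have mg := L2_measurable (test_fst_L2 tg).
rewrite /inner (@Rintegral_ae_eq _ _ _ muhat _ (fun x => lift_drift f x * (g \o fst) x)).
- have [M hM] := lift_drift_bounded tf; have [M' _ hM'] := test_bounded tg.
  rewrite (@Rintegral_gaussian_unif _ _ _ _ (M * M')).
  + have -> : \sum_(i : 'Z_n) \int[mu]_l (lift_drift f (l, i) * (g \o fst) (l, i)) = 0.
      by rewrite -[RHS](Rintegral_mul_derive_sum0 lambda tf tg).
    by rewrite mulr0.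
  + exact: measurable_funM.
  + by move=> x; rewrite normrM ler_pM ?hM//; exact: hM'.
- by apply: measurable_funM => //; exact: L2_measurable Lf.
- exact: measurable_funM.
- by apply: filterS aef => x ->.
Qed.

Lemma inner_lift_lift f g : test_function f -> test_function g ->
  inner muhat (gen muhat semigroup (f \o fst)) (gen muhat semigroup (g \o fst)) =
  N%:R^-1 * \sum_(i : 'Z_n) \int[mu]_l ('D_(drift R i) f l * 'D_(drift R i) g l).
Proof.
move=> tf tg; have [Lf aef] := gen_lift_ae tf; have [Lg aeg] := gen_lift_ae tg.
have mf := measurable_lift_drift tf; have mg := measurable_lift_drift tg.
rewrite /inner (@Rintegral_ae_eq _ _ _ muhat _ (fun x => lift_drift f x * lift_drift g x)).
- have [M hM] := lift_drift_bounded tf; have [M' hM'] := lift_drift_bounded tg.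
  rewrite (@Rintegral_gaussian_unif _ _ _ _ (M * M'))//.
  + exact: measurable_funM.
  + by move=> x; rewrite normrM ler_pM.
- by apply: measurable_funM; [exact: L2_measurable Lf|exact: L2_measurable Lg].
- exact: measurable_funM.
- by apply: filterS2 aef aeg => x -> ->.
Qed.

End Generator.

Theorem theorem3 (R : realType) (n : nat) (hn : (2 <= n)%N)
    (lambda : {measure set (sumzero R n) -> \bar R}) (hlambda : is_haar lambda)
    (d : measure_display) (Om : measurableType d) (P : probability Om R)
    (E : nat * bool -> {RV P >-> R}) (hE : iid_exp1 E) :
  let mu := gaussian lambda in
  let muhat := gaussian_unif lambda in
  let Lhat := gen muhat (@walk_semigroup R n d Om P E) in
  let DomLhat := gen_dom muhat (@walk_semigroup R n d Om P E) in
  let L := genZ lambda in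
  let DomL := H22 lambda in
  exists C : set (sumzero R n -> R),
    [/\ is_core mu DomL L C,
        forall f, C f -> DomLhat (f \o fst)
      & forall f g, C f -> C g ->
          inner muhat (Lhat (f \o fst)) (g \o fst) = 0 /\
          2^-1 * inner muhat (Lhat (f \o fst)) (Lhat (g \o fst))
            = - inner mu f (L g)].
Proof.
move=> mu muhat Lhat DomLhat L DomL; exists (@test_function R n); split.
- exact: test_function_core.
- move=> f tf; split; first exact: test_fst_L2.
  by exists (@lift_drift R n f); exact: lift_drift_has_gen.
- move=> f g tf tg; split; first exact: inner_lift_fst.
  (* The uniform measure divides by the number of sites and [genZ] by [n]; they agree since
     [n >= 2]. The factor 1/2 of the lift then matches [(2 * n%:R)^-1]. *)
  have NE : (Zp_trunc n).+2%:R = n%:R :> R by rewrite (Zp_cast hn).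
  by rewrite inner_lift_lift// inner_genZ// mulrA -invfM NE.
Qed.
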